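(* Let $i:Y^k\to(X^n,g)$ be an immersion with $1\le k<n$ and $n\ge3$, with $n\ne4$. Then $$\mathcal J:=-\overline\Delta W_{\alpha\beta}{}^{\alpha\beta}+2W_{\alpha\beta}{}^{\alpha\beta}\mathcal P_\gamma{}^\gamma-2(k-6)\Bigl[\overline\nabla^\alpha\mathcal C_\alpha-\mathcal P^{\alpha\beta}W_{\alpha\gamma\beta}{}^\gamma+\mathsf D^{\alpha\alpha'}W_{\alpha\beta\alpha'}{}^\beta+\mathring L^{\alpha\beta\alpha'}\mathcal C_{\alpha\alpha'\beta}+\frac{k-3}{n-4}\mathcal B_\alpha{}^\alpha\Bigr]$$ is conformally invariant of weight $-4$.
   Context: **Curvature.** $\nabla$ is the Levi-Civita connection of $g$; $R_{abcd}$ is determined by $\nabla_a\nabla_b\tau_c-\nabla_b\nabla_a\tau_c=R_{abc}{}^d\tau_d$; $R_{ab}=R_{acb}{}^c$, $R=R_a{}^a$, $\mathsf J=\frac{R}{2(n-1)}$, $\mathsf P_{ab}=\frac1{n-2}(R_{ab}-\mathsf Jg_{ab})$, $W_{abcd}=R_{abcd}-\mathsf P_{ac}g_{bd}-\mathsf P_{bd}g_{ac}+\mathsf P_{ad}g_{bc}+\mathsf P_{bc}g_{ad}$, $C_{abc}=\nabla_a\mathsf P_{bc}-\nabla_b\mathsf P_{ac}$, $B_{ab}=\nabla^cC_{cab}+W_{acbd}\mathsf P^{cd}$. Round parentheses on indices denote symmetrization: $T_{(ab)}=\frac12(T_{ab}+T_{ba})$. **Submanifold.** $i^*TX=TY\oplus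 NY$ ($g$-orthogonal); abstract indices $\alpha,\beta,\gamma,\dots$ denote projection to $TY$, primed indices projection to $NY$, Latin indices label $i^*TX$; indices are raised and lowered with $g$. $\overline\nabla$ is the connection on $TY$ and $NY$ obtained by projecting $\nabla$; $\overline\Delta=\overline\nabla^\alpha\overline\nabla_\alpha$. $L(U,V)=(\nabla_UV)^\perp$ is the second fundamental form $L_{\alpha\beta\alpha'}$, $H_{\alpha'}=\frac1kL_\alpha{}^\alpha{}_{\alpha'}$, $\mathring L_{\alpha\beta\alpha'}=L_{\alpha\beta\alpha'}-H_{\alpha'}g_{\alpha\beta}$. Define $\mathsf D_{\alpha\alpha'}=\mathsf P_{\alpha\alpha'}-\overline\nabla_\alpha H_{\alpha'}$; $\mathcal P_{\alpha\beta}=\mathsf P_{\alpha\beta}+H^{\alpha'}\mathring L_{\alpha\beta\alpha'}+\frac12H^{\alpha'}H_{\alpha'}g_{\alpha\beta}$; $\mathcal C_{abc}=C_{abc}-H^{\alpha'}W_{abc\alpha'}$, $\mathcal C_a=\mathcal C_{\beta a}{}^\beta$; $\mathcal B_{\alpha\beta}=B_{\alpha\beta}+2(n-4)H^{\alpha'}C_{\alpha'(\alpha\beta)}+(n-4)H^{\alpha'}H^{\beta'}W_{\alpha\alpha'\beta\beta'}$. A scalar $T$, assigning to each immersion $i:Y^k\to(X^n,g)$ a function $T^g$ on $Y$, is conformally invariant of weight $w$ if $T^{e^{2\Upsilon}g}=e^{w\,i^*\Upsilon}T^g$ for all immersions and all $\Upsilon\in C^\infty(X)$. *)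

(* Defs.v *)
From HB Require Import structures.
From mathcomp Require Import all_boot all_order all_algebra.
From mathcomp Require Import all_classical all_reals all_analysis.

Set Implicit Arguments.
Unset Strict Implicit.
Unset Printing Implicit Defensive.

Import Order.TTheory GRing.Theory Num.Theory.
Import numFieldNormedType.Exports.

Local Open Scope classical_set_scope.
Local Open Scope ring_scope.

(** * Smooth functions on open subsets of R^n *)

Section Smooth.
Context {R : realType}.

Definition partial n (a : 'I_n) (f : 'rV[R]_n -> R) (x : 'rV[R]_n) : R :=
  'D_(delta_mx 0 a) f x.

(* [U] is meant to be open: continuity and differentiability are those of [f]
   as a function on the whole space, at the points of [U]. *)
Fixpoint Ck n (m : nat) (U : set 'rV[R]_n) (f : 'rV[R]_n -> R) : Prop :=
  (forall x, U x -> {for x, continuous f}) /\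
  (if m is m'.+1 then
     forall a, (forall x, U x -> derivable f x (delta_mx 0 a)) /\
               Ck m' U (partial a f)
   else True).

Definition smooth_on n (U : set 'rV[R]_n) (f : 'rV[R]_n -> R) : Prop :=
  forall m, Ck m U f.

Definition smooth_map_on k n (U : set 'rV[R]_k) (F : 'rV[R]_k -> 'rV[R]_n) :=
  forall a, smooth_on U (fun x => F x 0 a).

(* Row [al] is the coordinate tangent vector d_al F. *)
Definition tangent_frame k n (F : 'rV[R]_k -> 'rV[R]_n) (y : 'rV[R]_k)
    : 'M[R]_(k, n) :=
  \matrix_(al, a) partial al (fun z => F z 0 a) y.

End Smooth.

(** * Smooth manifolds, Riemannian metrics, immersions *)

Section Manifolds.
Context {R : realType}.

(* [chart_map] is only meaningful on [chart_dom], and [chart_inv] only on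
   [chart_img]. *)
Record chart (T : topologicalType) (n : nat) := Chart {
  chart_dom : set T;
  chart_map : T -> 'rV[R]_n;
  chart_inv : 'rV[R]_n -> T }.

Definition chart_img T n (c : chart T n) : set 'rV[R]_n :=
  chart_map c @` chart_dom c.

Definition is_chart T n (c : chart T n) : Prop :=
  [/\ open (chart_dom c), open (chart_img c),
      (forall p, chart_dom c p -> chart_inv c (chart_map c p) = p),
      {within chart_dom c, continuous (chart_map c)} &
      {within chart_img c, continuous (chart_inv c)}].

Record manifold (n : nat) := Manifold {
  points :> topologicalType;
  atlas : set (chart points n);
  manifold_hausdorff : hausdorff_space points;
  manifold_countable : @second_countable points;
  atlas_chart : forall c, atlas c -> is_chart c;
  atlas_cover : forall p : points, exists2 c, atlas c & chart_dom c p;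
  atlas_smooth : forall c c', atlas c -> atlas c' ->
    smooth_map_on (chart_map c @` (chart_dom c `&` chart_dom c'))
                  (chart_map c' \o chart_inv c) }.

Definition smooth_function n (X : manifold n) (u : X -> R) : Prop :=
  forall c, atlas c -> smooth_on (chart_img c) (u \o chart_inv c).

(* A family of matrix fields [g c], [g c x a b] being the (a, b) component at
   the point of coordinates [x] in the chart [c]. *)
Definition two_tensor n (X : manifold n) := chart X n -> 'rV[R]_n -> 'M[R]_n.

Definition riemannian_metric n (X : manifold n) (g : two_tensor X) : Prop :=
  [/\ (forall c, atlas c -> forall a b,
         smooth_on (chart_img c) (fun x => g c x a b)),
      (forall c, atlas c -> forall x, chart_img c x -> (g c x)^T = g c x),
      (forall c, atlas c -> forall x, chart_img c x ->
         forall v : 'rV[R]_n, v != 0 -> 0 < (v *m g c x *m v^T) 0 0) &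
      (forall c c', atlas c -> atlas c' ->
         let F := chart_map c' \o chart_inv c in
         forall x, (chart_map c @` (chart_dom c `&` chart_dom c')) x ->
         g c x = tangent_frame F x *m g c' (F x) *m (tangent_frame F x)^T)].

Definition conformal_change n (X : manifold n) (u : X -> R) (g : two_tensor X)
    : two_tensor X :=
  fun c x => expR (2 * u (chart_inv c x)) *: g c x.

Definition coord_map k n (Y : manifold k) (X : manifold n) (i : Y -> X)
    (c : chart Y k) (c' : chart X n) : 'rV[R]_k -> 'rV[R]_n :=
  chart_map c' \o i \o chart_inv c.

Definition immersion k n (Y : manifold k) (X : manifold n) (i : Y -> X) : Prop :=
  continuous i /\
  forall c c', atlas c -> atlas c' ->
    let U := chart_map c @` (chart_dom c `&` i @^-1` chart_dom c') in
    smooth_map_on U (coord_map i c c') /\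
    forall y, U y -> \rank (tangent_frame (coord_map i c c') y) = k.

(* A scalar is given by its coordinate expression: a function of the component
   matrix of the metric in a chart of X and of the immersion read in a chart of
   Y and this chart of X.  Its value at a point is computed in any two charts
   around the point and its image; invariance is required in all of them. *)
Definition coord_scalar k n :=
  ('rV[R]_n -> 'M[R]_n) -> ('rV[R]_k -> 'rV[R]_n) -> 'rV[R]_k -> R.

Definition scalar_at k n (T : coord_scalar k n) (Y : manifold k)
    (X : manifold n) (g : two_tensor X) (i : Y -> X)
    (c : chart Y k) (c' : chart X n) (y : Y) : R :=
  T (g c') (coord_map i c c') (chart_map c y).

Definition conformally_invariant k n (w : R) (T : coord_scalar k n) : Prop :=
  forall (Y : manifold k) (X : manifold n) (g : two_tensor X) (i : Y -> X)
         (u : X -> R),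
  riemannian_metric g -> immersion i -> smooth_function u ->
  forall (y : Y) (c : chart Y k) (c' : chart X n),
  atlas c -> atlas c' -> chart_dom c y -> chart_dom c' (i y) ->
  scalar_at T (conformal_change u g) i c c' y =
  expR (w * u (i y)) * scalar_at T g i c c' y.

End Manifolds.

(** * Curvature, in coordinates

  A covariant tensor field is a function of its indices, in order, and then of
  the point. *)

Section Curvature.
Context {R : realType} {n : nat}.
Context (g : 'rV[R]_n -> 'M[R]_n).
Implicit Types (a b c d e f : 'I_n) (x : 'rV[R]_n).

Definition ginv x : 'M[R]_n := invmx (g x).

(* Gamma^c_{ab} *)
Definition christoffel c a b x : R :=
  2^-1 * \sum_d ginv x c d * (partial a (fun z => g z b d) x +
                              partial b (fun z => g z a d) x -
                              partial d (fun z => g z a b) x).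

(* In nabla_a t_{b..}, the index of the derivative comes first. *)
Definition nabla1 (t : 'I_n -> 'rV[R]_n -> R) a b x : R :=
  partial a (t b) x - \sum_d christoffel d a b x * t d x.

Definition nabla2 (t : 'I_n -> 'I_n -> 'rV[R]_n -> R) a b c x : R :=
  partial a (t b c) x
  - \sum_e (christoffel e a b x * t e c x + christoffel e a c x * t b e x).

Definition nabla3 (t : 'I_n -> 'I_n -> 'I_n -> 'rV[R]_n -> R) a b c d x : R :=
  partial a (t b c d) x
  - \sum_e (christoffel e a b x * t e c d x + christoffel e a c x * t b e d x
            + christoffel e a d x * t b c e x).

Definition dcoord d : 'I_n -> 'rV[R]_n -> R := fun e _ => (e == d)%:R.

(* R_{abc}^d: the commutator identity
   nabla_a nabla_b tau_c - nabla_b nabla_a tau_c = R_{abc}^d tau_d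
   applied to the covector field tau = dx^d. *)
Definition riemann_up a b c d x : R :=
  nabla2 (nabla1 (dcoord d)) a b c x - nabla2 (nabla1 (dcoord d)) b a c x.

Definition riemann a b c d x : R := \sum_e riemann_up a b c e x * g x e d.

(* R_{ab} = R_{acb}^c *)
Definition ricci a b x : R := \sum_c riemann_up a c b c x.

Definition scalar_curvature x : R := \sum_a \sum_b ginv x a b * ricci a b x.

Definition schouten_trace x : R := scalar_curvature x / (2 * (n%:R - 1)).

Definition schouten a b x : R :=
  (ricci a b x - schouten_trace x * g x a b) / (n%:R - 2).

Definition weyl a b c d x : R :=
  riemann a b c d x - schouten a c x * g x b d - schouten b d x * g x a c
  + schouten a d x * g x b c + schouten b c x * g x a d.

Definition cotton a b c x : R :=
  nabla2 schouten a b c x - nabla2 schouten b a c x.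

(* B_{ab} = nabla^c C_{cab} + W_{acbd} P^{cd} *)
Definition bach a b x : R :=
  \sum_c \sum_d ginv x c d * nabla3 cotton d c a b x
  + \sum_c \sum_d weyl a c b d x *
      (\sum_e \sum_f ginv x c e * ginv x d f * schouten e f x).

End Curvature.

(** * Submanifold geometry along F : R^k -> R^n

  Tangential indices refer to the coordinate basis [tvec al] = d_al F of TY.
  Sections of F^*TX are row vectors with upper indices; a primed index is the
  index of such a vector lying in the normal space, so an argument of an ambient
  tensor contracted with a primed index is a normal vector. *)

Section Submanifold.
Context {R : realType} {k n : nat}.
Context (g : 'rV[R]_n -> 'M[R]_n) (F : 'rV[R]_k -> 'rV[R]_n).
Implicit Types (al be ga de : 'I_k) (y : 'rV[R]_k) (u v w z : 'rV[R]_n).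

Definition tvec al y : 'rV[R]_n := row al (tangent_frame F y).

(* Restrictions to Y of ambient tensors, as multilinear functions of vectors. *)
Definition gY y u v : R := (u *m g (F y) *m v^T) 0 0.

Definition PY y u v : R :=
  \sum_a \sum_b schouten g a b (F y) * u 0 a * v 0 b.

Definition BY y u v : R :=
  \sum_a \sum_b bach g a b (F y) * u 0 a * v 0 b.

Definition CY y u v w : R :=
  \sum_a \sum_b \sum_c cotton g a b c (F y) * u 0 a * v 0 b * w 0 c.

Definition WY y u v w z : R :=
  \sum_a \sum_b \sum_c \sum_d
    weyl g a b c d (F y) * u 0 a * v 0 b * w 0 c * z 0 d.

Definition gbar y : 'M[R]_k := \matrix_(al, be) gY y (tvec al y) (tvec be y).

(* t_al^al *)
Definition contr y (t : 'I_k -> 'I_k -> R) : R :=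
  \sum_al \sum_be invmx (gbar y) al be * t al be.

(* The components in the basis [tvec] of the tangential part of a vector. *)
Definition tangential y v ga : R :=
  \sum_de invmx (gbar y) ga de * gY y v (tvec de y).

Definition normal y v : 'rV[R]_n := v - \sum_ga tangential y v ga *: tvec ga y.

(* nabla_al V for a section V of F^*TX *)
Definition nablaY al (V : 'rV[R]_k -> 'rV[R]_n) y : 'rV[R]_n :=
  \row_a (partial al (fun p => V p 0 a) y
          + \sum_b \sum_c christoffel g a b c (F y) * tvec al y 0 b * V y 0 c).

(* The connection nabla-bar on TY and on NY: projection of nabla.
   nabla-bar_al (tvec be) = \sum_ga (nablabar_coef ga al be) tvec ga. *)
Definition nablabar_coef ga al be y : R :=
  tangential y (nablaY al (tvec be) y) ga.

Definition nablabar_normal al (V : 'rV[R]_k -> 'rV[R]_n) y : 'rV[R]_n :=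
  normal y (nablaY al V y).

(* nabla-bar_al t_be *)
Definition nablabar (t : 'I_k -> 'rV[R]_k -> R) al be y : R :=
  partial al (t be) y - \sum_ga nablabar_coef ga al be y * t ga y.

Definition divbar (t : 'I_k -> 'rV[R]_k -> R) y : R :=
  contr y (fun al be => nablabar t al be y).

Definition laplacebar (h : 'rV[R]_k -> R) y : R :=
  divbar (fun al => partial al h) y.

(* L(U, V) = (nabla_U V)^perp; [sff0] is its trace-free part L-ring. *)
Definition sff al be y : 'rV[R]_n := normal y (nablaY al (tvec be) y).

Definition mean_curv y : 'rV[R]_n :=
  k%:R^-1 *: (\sum_al \sum_be invmx (gbar y) al be *: sff al be y).

Definition sff0 al be y : 'rV[R]_n := sff al be y - gbar y al be *: mean_curv y.

(* D_al^{a'}, with the primed index raised; the first term is the normal part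
   of P_al^a. *)
Definition Dmixed al y : 'rV[R]_n :=
  normal y ((\row_b \sum_a schouten g a b (F y) * tvec al y 0 a)
              *m ginv g (F y))
  - nablabar_normal al mean_curv y.

Definition calP al be y : R :=
  PY y (tvec al y) (tvec be y) + gY y (mean_curv y) (sff0 al be y)
  + 2^-1 * gY y (mean_curv y) (mean_curv y) * gbar y al be.

Definition calC y u v w : R := CY y u v w - WY y u v w (mean_curv y).

(* C_a = C_{be a}^be, for a tangential index a = al *)
Definition calC_trace al y : R :=
  contr y (fun be ga => calC y (tvec be y) (tvec al y) (tvec ga y)).

Definition calB al be y : R :=
  BY y (tvec al y) (tvec be y)
  + 2 * (n%:R - 4) *
      (2^-1 * (CY y (mean_curv y) (tvec al y) (tvec be y)
               + CY y (mean_curv y) (tvec be y) (tvec al y)))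
  + (n%:R - 4) * WY y (tvec al y) (mean_curv y) (tvec be y) (mean_curv y).

(* W_{al ga be}^ga *)
Definition W_trace1 al be y : R :=
  contr y (fun ga de => WY y (tvec al y) (tvec ga y) (tvec be y) (tvec de y)).

(* W_{al be}^{al be} *)
Definition W_trace2 y : R := contr y (fun al be => W_trace1 al be y).

(* P^{al be} W_{al ga be}^ga *)
Definition calP_W y : R :=
  contr y (fun al ga => contr y (fun be de =>
    calP ga de y * W_trace1 al be y)).

(* D^{al al'} W_{al be al'}^be *)
Definition D_W y : R :=
  contr y (fun al ga => contr y (fun be de =>
    WY y (tvec al y) (tvec be y) (Dmixed ga y) (tvec de y))).

(* L-ring^{al be al'} C_{al al' be} *)
Definition sff0_C y : R :=
  contr y (fun al ga => contr y (fun be de =>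
    calC y (tvec al y) (sff0 ga de y) (tvec be y))).

Definition calJ y : R :=
  - laplacebar W_trace2 y
  + 2 * W_trace2 y * contr y (fun al be => calP al be y)
  - 2 * (k%:R - 6) *
    (divbar calC_trace y - calP_W y + D_W y + sff0_C y
     + (k%:R - 3) / (n%:R - 4) * contr y (fun al be => calB al be y)).

End Submanifold.

(* Main.v *)
(** The coordinate expression of J is rational in finitely many smooth
  functions and their partial derivatives, so the transformation law can be
  checked in the commutative ring of smooth functions on a coordinate domain,
  equipped with its commuting derivations; restriction along the immersion is a
  ring morphism to the corresponding ring of the submanifold, related to the
  derivations by the chain rule.

  Under g -> e^{2 Upsilon} g, with Y = d Upsilon and U its gradient, W_abcd has
  weight 2, C_abc changes by - W_abcd U^d, the trace-free second fundamental form
  is unchanged up to the weight and H changes by the normal part of - U.  Thus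
  only the tangential part y of Y survives in the transformation laws of the
  calligraphic tensors, and each term of J changes by an explicit expression in
  y and its covariant derivative.  The single relation between these changes
  which is not formal is the value of the divergence of W_{al ga be}^ga: the
  Gauss and Weingarten formulas and the contracted Bianchi identity of the Weyl
  tensor express it through the differential of W_{al be}^{al be}, the trace of
  the calligraphic C, and contractions of the trace-free second fundamental form
  with W.  Once it is substituted, all changes cancel. *)
Require Import Defs.
From HB Require Import structures.
From mathcomp Require Import all_boot all_order all_algebra.
From mathcomp Require Import all_classical all_reals all_analysis.
From mathcomp Require Import ring lra zify.

Set Implicit Arguments.
Unset Strict Implicit.
Unset Printing Implicit Defensive.

Import GRing.Theory.
Local Open Scope ring_scope.

(** * Derivations, connections and contractions *)

(** The laws for the ambient tensors, up to that of the Bach tensor, are all proved on X before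
    anything is restricted. Along Y it then suffices to differentiate the restricted [g], Y and W
    once; the outer derivatives in the Laplacian and in the divergence are treated intrinsically and
    never expanded.

    The Christoffel expression of the rescaled metric is never expanded either: the classical
    formula for the new connection is written down, checked to be torsion-free and metric, and
    recognised by uniqueness of the Levi-Civita connection.

    Smooth functions do not form a field. The numbers 1/2, 1/k, 1/(n-2), 1/(2(n-1)) and 1/(n-4)
    therefore enter as ring elements with their defining equations. [ring] does not know these
    equations, so many proofs regroup an expression around a product such as [hf * 2] or [e * ei],
    rewrite it to 1, and call [ring] again. *)

Section Sums.
Context {A : comPzRingType} {m : nat}.
Implicit Types (f h : 'I_m -> A).

Lemma sum_delta_l (a : 'I_m) f : \sum_b (b == a)%:R * f b = f a.
Proof.
rewrite (bigD1 a) //= eqxx mul1r big1 ?addr0 // => b /negPf ->.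
by rewrite mul0r.
Qed.

Lemma sum_delta_r (a : 'I_m) f : \sum_b (a == b)%:R * f b = f a.
Proof. by rewrite -[RHS](sum_delta_l a); apply: eq_bigr => b _; rewrite eq_sym. Qed.

End Sums.

Record derivation (A : comPzRingType) := Derivation {
  der :> A -> A;
  derD : {morph der : x y / x + y};
  derM : forall x y, der (x * y) = der x * y + x * der y }.

Section Derivation.
Context {A : comPzRingType} (D : derivation A).

Lemma der0 : D 0 = 0.
Proof. by apply: (addrI (D 0)); rewrite -derD !addr0. Qed.

Lemma derN x : D (- x) = - D x.
Proof. by apply: (addrI (D x)); rewrite -derD !subrr der0. Qed.

Lemma derB x y : D (x - y) = D x - D y.
Proof. by rewrite derD derN. Qed.

Lemma der1 : D 1 = 0.
Proof. by apply: (addrI (D 1)); rewrite addr0 -{3}(mul1r 1) derM mul1r mulr1. Qed.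

Lemma der_nat p : D p%:R = 0.
Proof. by elim: p => [|p IH]; rewrite ?der0 // mulrS derD der1 IH addr0. Qed.

Lemma der_sum I (r : seq I) (P : pred I) (f : I -> A) :
  D (\sum_(i <- r | P i) f i) = \sum_(i <- r | P i) D (f i).
Proof. exact: (big_morph D (@derD _ D) der0). Qed.

Lemma der_inv x y : x * y = 1 -> D y = - (y * y * D x).
Proof.
move=> xy; have /(congr1 D) := xy; rewrite derM der1 => /(congr1 ( *%R y)).
rewrite mulr0 mulrDr (mulrA y x) (mulrC y x) xy mul1r => /eqP.
by rewrite addr_eq0 => /eqP E; ring: E.
Qed.

(** Inverses of integers are constants for every derivation; this does the work of linearity over R,
    which [derivation] does not include. *)
Lemma der_cst x p : x * p%:R = 1 -> D x = 0.
Proof. by move=> /[1! mulrC] /der_inv ->; rewrite der_nat mulr0 oppr0. Qed.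

End Derivation.

(* [w c b] is the component along e_c of the derivative of e_b, in a frame (e_b)
   of a bundle of rank [m]; [D] is the derivation in the given direction. *)
Section Covariant.
Context {A : comPzRingType} {m : nat} (D : derivation A) (w : 'I_m -> 'I_m -> A).

Definition cov1 (t : 'I_m -> A) b := D (t b) - \sum_d w d b * t d.
Definition cov2 (t : 'I_m -> 'I_m -> A) b c :=
  D (t b c) - \sum_e (w e b * t e c + w e c * t b e).
Definition cov3 (t : 'I_m -> 'I_m -> 'I_m -> A) b c d :=
  D (t b c d)
  - \sum_e (w e b * t e c d + w e c * t b e d + w e d * t b c e).
Definition cov4 (t : 'I_m -> 'I_m -> 'I_m -> 'I_m -> A) b c d f :=
  D (t b c d f)
  - \sum_e (w e b * t e c d f + w e c * t b e d f + w e d * t b c e f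
            + w e f * t b c d e).
Definition covv (u : 'I_m -> A) a := D (u a) + \sum_b w a b * u b.

(** Freezing the first index leaves a tensor of lower rank and one correction term. The Leibniz and
    pullback rules are inductions on the rank along this identity. *)
Lemma cov2S t b c : cov2 t b c = cov1 (t b) c - \sum_e w e b * t e c.
Proof. rewrite /cov2 /cov1 big_split /=; ring. Qed.

Lemma cov3S t b c d : cov3 t b c d = cov2 (t b) c d - \sum_e w e b * t e c d.
Proof. rewrite /cov3 /cov2 !big_split /=; ring. Qed.

Lemma cov4S t b c d f :
  cov4 t b c d f = cov3 (t b) c d f - \sum_e w e b * t e c d f.
Proof. rewrite /cov4 /cov3 !big_split /=; ring. Qed.

End Covariant.

Section Eval.
Context {A : comPzRingType} {m : nat}.
Implicit Types (u v w z : 'I_m -> A).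

Definition ev1 (t : 'I_m -> A) u := \sum_a u a * t a.
Definition ev2 (t : 'I_m -> 'I_m -> A) u v := ev1 (fun a => ev1 (t a) v) u.
Definition ev3 (t : 'I_m -> 'I_m -> 'I_m -> A) u v w :=
  ev1 (fun a => ev2 (t a) v w) u.
Definition ev4 (t : 'I_m -> 'I_m -> 'I_m -> 'I_m -> A) u v w z :=
  ev1 (fun a => ev3 (t a) v w z) u.

Lemma eq_ev1 s t u v : s =1 t -> u =1 v -> ev1 s u = ev1 t v.
Proof. by move=> e1 e2; apply: eq_bigr => a _; rewrite e1 e2. Qed.

Lemma ev1D s t u : ev1 (fun a => s a + t a) u = ev1 s u + ev1 t u.
Proof. by rewrite -big_split; apply: eq_bigr => a _; rewrite mulrDr. Qed.
Lemma ev1N t u : ev1 (fun a => - t a) u = - ev1 t u.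
Proof. by rewrite -sumrN; apply: eq_bigr => a _; rewrite mulrN. Qed.
Lemma ev1Z x t u : ev1 (fun a => x * t a) u = x * ev1 t u.
Proof. by rewrite /ev1 mulr_sumr; apply: eq_bigr => a _; ring. Qed.
Lemma ev1_sum p (t : 'I_p -> 'I_m -> A) u :
  ev1 (fun a => \sum_d t d a) u = \sum_d ev1 (t d) u.
Proof. by rewrite exchange_big; apply: eq_bigr => a _; rewrite mulr_sumr. Qed.
Lemma ev1vD t u v : ev1 t (fun a => u a + v a) = ev1 t u + ev1 t v.
Proof. by rewrite -big_split; apply: eq_bigr => a _; rewrite mulrDl. Qed.
Lemma ev1vN t u : ev1 t (fun a => - u a) = - ev1 t u.
Proof. by rewrite -sumrN; apply: eq_bigr => a _; rewrite mulNr. Qed.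
Lemma ev1vZ x t u : ev1 t (fun a => x * u a) = x * ev1 t u.
Proof. by rewrite /ev1 mulr_sumr; apply: eq_bigr => a _; ring. Qed.
Lemma ev1v_sum p t (u : 'I_p -> 'I_m -> A) :
  ev1 t (fun a => \sum_d u d a) = \sum_d ev1 t (u d).
Proof. by rewrite exchange_big; apply: eq_bigr => a _; rewrite mulr_suml. Qed.
Lemma ev1C t u : ev1 t u = ev1 u t.
Proof. by apply: eq_bigr => a _; rewrite mulrC. Qed.

End Eval.

Section Multilinear.
Context {A : comPzRingType} {m : nat}.
Implicit Types (u v w z : 'I_m -> A) (phi : ('I_m -> A) -> A).

(** Linearity is encoded as having components: compatibility with finite sums, extensionality in the
    argument and agreement on a basis all follow from the one representation. *)
Definition linear_form phi := exists t, phi =1 ev1 t.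

Lemma lfD phi u v : linear_form phi -> phi (fun a => u a + v a) = phi u + phi v.
Proof. by case=> t E; rewrite !E ev1vD. Qed.
Lemma lfN phi u : linear_form phi -> phi (fun a => - u a) = - phi u.
Proof. by case=> t E; rewrite !E ev1vN. Qed.
Lemma lfB phi u v : linear_form phi -> phi (fun a => u a - v a) = phi u - phi v.
Proof. by move=> L; rewrite lfD // lfN. Qed.
Lemma lfZ phi x u : linear_form phi -> phi (fun a => x * u a) = x * phi u.
Proof. by case=> t E; rewrite !E ev1vZ. Qed.
Lemma lf_sum phi p (c : 'I_p -> A) (u : 'I_p -> 'I_m -> A) : linear_form phi ->
  phi (fun a => \sum_d c d * u d a) = \sum_d c d * phi (u d).
Proof.
by case=> t E; rewrite !E ev1v_sum; apply: eq_bigr => d _; rewrite E ev1vZ.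
Qed.
Lemma lf_eq phi u v : linear_form phi -> u =1 v -> phi u = phi v.
Proof. by case=> t E e; rewrite !E; apply: eq_ev1. Qed.

Lemma lf_add phi psi : linear_form phi -> linear_form psi ->
  linear_form (fun u => phi u + psi u).
Proof. by case=> s E [t F]; exists (fun a => s a + t a) => u; rewrite ev1D E F. Qed.
Lemma lf_opp phi : linear_form phi -> linear_form (fun u => - phi u).
Proof. by case=> s E; exists (fun a => - s a) => u; rewrite ev1N E. Qed.
Lemma lf_mull c phi : linear_form phi -> linear_form (fun u => c * phi u).
Proof. by case=> s E; exists (fun a => c * s a) => u; rewrite ev1Z E. Qed.
Lemma lf_mulr c phi : linear_form phi -> linear_form (fun u => phi u * c).
Proof.
by case=> s E; exists (fun a => c * s a) => u; rewrite ev1Z E mulrC.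
Qed.

Definition basis_vec (a : 'I_m) : 'I_m -> A := fun b => (b == a)%:R.

Lemma ev1_basis t a : ev1 t (basis_vec a) = t a.
Proof. exact: sum_delta_l. Qed.

(** Applied to one argument at a time, this turns an identity between multilinear expressions in
    tangent vectors into the identity between components. *)
Lemma lf_ext phi psi : linear_form phi -> linear_form psi ->
  (forall a, phi (basis_vec a) = psi (basis_vec a)) -> phi =1 psi.
Proof.
move=> [s E] [t F] e u; rewrite E F; apply: eq_ev1 => // a.
by rewrite -[LHS]ev1_basis -E e F ev1_basis.
Qed.

Lemma ev2_swap t u v : ev2 t u v = ev2 (fun a b => t b a) v u.
Proof.
rewrite /ev2 /ev1; under eq_bigr do rewrite mulr_sumr.
rewrite exchange_big; apply: eq_bigr => a _; rewrite mulr_sumr.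
by apply: eq_bigr => b _; ring.
Qed.
Lemma ev3_swap12 t u v w : ev3 t u v w = ev3 (fun a b c => t b a c) v u w.
Proof. by rewrite /ev3 /ev2 -/(ev2 _ u v) -/(ev2 _ v u) ev2_swap. Qed.
Lemma ev3_swap23 t u v w : ev3 t u v w = ev3 (fun a b c => t a c b) u w v.
Proof. by apply: eq_ev1 => // a; rewrite ev2_swap. Qed.
Lemma ev4_swap12 t u v w z :
  ev4 t u v w z = ev4 (fun a b c d => t b a c d) v u w z.
Proof. by rewrite /ev4 /ev3 -/(ev2 _ u v) -/(ev2 _ v u) ev2_swap. Qed.
Lemma ev4_swap23 t u v w z :
  ev4 t u v w z = ev4 (fun a b c d => t a c b d) u w v z.
Proof. by apply: eq_ev1 => // a; rewrite ev3_swap12. Qed.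
Lemma ev4_swap34 t u v w z :
  ev4 t u v w z = ev4 (fun a b c d => t a b d c) u v z w.
Proof. by apply: eq_ev1 => // a; rewrite ev3_swap23. Qed.

Lemma lf1 t : linear_form (ev1 t). Proof. by exists t. Qed.
Lemma lf2_1 t v : linear_form (fun u => ev2 t u v).
Proof. by exists (fun a => ev1 (t a) v). Qed.
Lemma lf2_2 t u : linear_form (fun v => ev2 t u v).
Proof. by exists (fun b => ev1 (t^~ b) u) => v; rewrite ev2_swap. Qed.
Lemma lf3_1 t v w : linear_form (fun u => ev3 t u v w).
Proof. by exists (fun a => ev2 (t a) v w). Qed.
(** Swaps bring the argument to the first place, where the form is an [ev1]; unification then
    supplies the components. *)
Lemma lf3_2 t u w : linear_form (fun v => ev3 t u v w).
Proof. by eexists => v; rewrite ev3_swap12. Qed.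
Lemma lf3_3 t u v : linear_form (fun w => ev3 t u v w).
Proof. by eexists => w; rewrite ev3_swap23 ev3_swap12. Qed.
Lemma lf4_1 t v w z : linear_form (fun u => ev4 t u v w z).
Proof. by eexists. Qed.
Lemma lf4_2 t u w z : linear_form (fun v => ev4 t u v w z).
Proof. by eexists => v; rewrite ev4_swap12. Qed.
Lemma lf4_3 t u v z : linear_form (fun w => ev4 t u v w z).
Proof. by eexists => w; rewrite ev4_swap23 ev4_swap12. Qed.
Lemma lf4_4 t u v w : linear_form (fun z => ev4 t u v w z).
Proof. by eexists => z; rewrite ev4_swap34 ev4_swap23 ev4_swap12. Qed.

Lemma eq_ev2 s t u v : (forall a b, s a b = t a b) -> ev2 s u v = ev2 t u v.
Proof. by move=> e; apply: eq_ev1 => // a; apply: eq_ev1. Qed.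
Lemma eq_ev3 s t u v w :
  (forall a b c, s a b c = t a b c) -> ev3 s u v w = ev3 t u v w.
Proof. by move=> e; apply: eq_ev1 => // a; apply: eq_ev2. Qed.
Lemma eq_ev4 s t u v w z :
  (forall a b c d, s a b c d = t a b c d) -> ev4 s u v w z = ev4 t u v w z.
Proof. by move=> e; apply: eq_ev1 => // a; apply: eq_ev3. Qed.

Lemma ev2D s t u v :
  ev2 (fun a b => s a b + t a b) u v = ev2 s u v + ev2 t u v.
Proof. by rewrite -ev1D; apply: eq_ev1 => // a; rewrite ev1D. Qed.
Lemma ev2Z x t u v : ev2 (fun a b => x * t a b) u v = x * ev2 t u v.
Proof. by rewrite -ev1Z; apply: eq_ev1 => // a; rewrite ev1Z. Qed.
Lemma ev2N t u v : ev2 (fun a b => - t a b) u v = - ev2 t u v.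
Proof. by rewrite -ev1N; apply: eq_ev1 => // a; rewrite ev1N. Qed.
Lemma ev2_tens (s t : 'I_m -> A) u v :
  ev2 (fun a b => s a * t b) u v = ev1 s u * ev1 t v.
Proof. by rewrite mulrC -ev1Z; apply: eq_ev1 => // a; rewrite ev1Z mulrC. Qed.
Lemma ev3D s t u v w :
  ev3 (fun a b c => s a b c + t a b c) u v w = ev3 s u v w + ev3 t u v w.
Proof. by rewrite -ev1D; apply: eq_ev1 => // a; rewrite ev2D. Qed.
Lemma ev3Z x t u v w : ev3 (fun a b c => x * t a b c) u v w = x * ev3 t u v w.
Proof. by rewrite -ev1Z; apply: eq_ev1 => // a; rewrite ev2Z. Qed.
Lemma ev3N t u v w : ev3 (fun a b c => - t a b c) u v w = - ev3 t u v w.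
Proof. by rewrite -ev1N; apply: eq_ev1 => // a; rewrite ev2N. Qed.
Lemma ev4Z x t u v w z :
  ev4 (fun a b c d => x * t a b c d) u v w z = x * ev4 t u v w z.
Proof. by rewrite -ev1Z; apply: eq_ev1 => // a; rewrite ev3Z. Qed.
Lemma ev4N t u v w z :
  ev4 (fun a b c d => - t a b c d) u v w z = - ev4 t u v w z.
Proof. by rewrite -ev1N; apply: eq_ev1 => // a; rewrite ev3N. Qed.
Lemma ev2_ev1 t u v w : ev2 (fun a b => ev1 (fun x => t x a b) w) u v = ev3 t w u v.
Proof. by rewrite ev3_swap12 ev3_swap23. Qed.

Lemma lf_ev1 (phi : 'I_m -> ('I_m -> A) -> A) v :
  (forall x, linear_form (phi x)) -> linear_form (fun u => ev1 (fun x => phi x u) v).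
Proof.
move=> L; exists (fun a => ev1 (fun x => phi x (basis_vec a)) v) => u.
rewrite /ev1; under [RHS]eq_bigr do rewrite mulr_sumr.
rewrite exchange_big; apply: eq_bigr => x _ /=.
have [t E] := L x; rewrite E mulr_sumr; apply: eq_bigr => a _.
by rewrite E ev1_basis; ring.
Qed.

Lemma ev4_anti12 t u v w z : (forall a b c d, t b a c d = - t a b c d) ->
  ev4 t v u w z = - ev4 t u v w z.
Proof. by move=> e; rewrite ev4_swap12 -ev4N; apply: eq_ev4. Qed.
Lemma ev4_anti34 t u v w z : (forall a b c d, t a b d c = - t a b c d) ->
  ev4 t u v z w = - ev4 t u v w z.
Proof. by move=> e; rewrite ev4_swap34 -ev4N; apply: eq_ev4. Qed.
Lemma ev4_pair t u v w z : (forall a b c d, t c d a b = t a b c d) ->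
  ev4 t w z u v = ev4 t u v w z.
Proof.
move=> e; rewrite ev4_swap23 ev4_swap12 ev4_swap34 ev4_swap23.
by apply: eq_ev4 => a b c d; rewrite e.
Qed.

End Multilinear.

Ltac lf_auto := repeat first
  [ exact: lf1 | exact: lf2_1 | exact: lf2_2 | exact: lf3_1 | exact: lf3_2
  | exact: lf3_3 | exact: lf4_1 | exact: lf4_2 | exact: lf4_3 | exact: lf4_4
  | apply: lf_add | apply: lf_opp | apply: lf_mull | apply: lf_mulr
  | apply: lf_ev1 => ? ].

(** * Leibniz rules for tensors evaluated on vectors *)

Section Leibniz.
Context {A : comPzRingType} {m : nat} (D : derivation A) (w : 'I_m -> 'I_m -> A).
Implicit Types (u v x z : 'I_m -> A).
Local Notation nb := (covv D w).

(** The connection terms of the covector and of the vector are the same double sum with opposite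
    signs. *)
Lemma der_ev1 t u : D (ev1 t u) = ev1 (cov1 D w t) u + ev1 t (nb u).
Proof.
rewrite der_sum (eq_bigr (fun a => D (u a) * t a + u a * D (t a)));
  last by move=> a _; rewrite derM.
have E : ev1 (fun b => \sum_d w d b * t d) u = ev1 t (fun a => \sum_b w a b * u b).
  rewrite ev1_sum; apply: eq_bigr => d _; rewrite mulr_suml.
  by apply: eq_bigr => b _; ring.
rewrite /cov1 /covv ev1D ev1N ev1vD E big_split /= /ev1; ring.
Qed.

Lemma cov1_ev p (t : 'I_m -> 'I_p -> A) (y : 'I_p -> A) a :
  cov1 D w (fun a => ev1 (t a) y) a =
  D (ev1 (t a) y) - ev1 (fun b => \sum_d w d a * t d b) y.
Proof.
rewrite /cov1 ev1_sum; congr (_ - _); apply: eq_bigr => d _; by rewrite ev1Z.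
Qed.

Lemma cov1_ev1 t u a : cov1 D w (fun a => ev1 (t a) u) a =
  ev1 (cov2 D w t a) u + ev1 (t a) (nb u).
Proof.
rewrite cov1_ev der_ev1 addrAC; congr (_ + _); rewrite -ev1N -ev1D.
by apply: eq_ev1 => // c; rewrite cov2S.
Qed.

Lemma der_ev2 t u v :
  D (ev2 t u v) = ev2 (cov2 D w t) u v + ev2 t (nb u) v + ev2 t u (nb v).
Proof.
rewrite der_ev1 (@eq_ev1 _ _ _ (fun a => ev1 (cov2 D w t a) v + ev1 (t a) (nb v)) _ u) //; last first.
  move=> a; rewrite cov1_ev der_ev1.
  rewrite (@eq_ev1 _ _ (cov2 D w t a) (fun c => cov1 D w (t a) c - \sum_e w e a * t e c) v v) //.
    rewrite ev1D ev1N; ring.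
  by move=> c; rewrite cov2S.
rewrite ev1D -/(ev2 _ u v) -/(ev2 _ u (nb v)) -/(ev2 _ (nb u) v); ring.
Qed.

Lemma ev2_sum p (t : 'I_p -> 'I_m -> 'I_m -> A) u v :
  ev2 (fun a b => \sum_d t d a b) u v = \sum_d ev2 (t d) u v.
Proof. by rewrite /ev2 -ev1_sum; apply: eq_ev1 => // a; rewrite ev1_sum. Qed.
Lemma ev3_sum p (t : 'I_p -> 'I_m -> 'I_m -> 'I_m -> A) u v x :
  ev3 (fun a b c => \sum_d t d a b c) u v x = \sum_d ev3 (t d) u v x.
Proof. by rewrite /ev3 -ev1_sum; apply: eq_ev1 => // a; rewrite ev2_sum. Qed.

Lemma der_ev3 t u v x :
  D (ev3 t u v x) = ev3 (cov3 D w t) u v x + ev3 t (nb u) v x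
    + ev3 t u (nb v) x + ev3 t u v (nb x).
Proof.
rewrite der_ev1 (@eq_ev1 _ _ _ (fun a => ev2 (cov3 D w t a) v x
   + ev2 (t a) (nb v) x + ev2 (t a) v (nb x)) _ u) //; last first.
  move=> a; rewrite /cov1 der_ev2.
  rewrite (@eq_ev2 _ _ (cov3 D w t a) (fun c d => cov2 D w (t a) c d - \sum_e w e a * t e c d)).
    rewrite ev2D ev2N ev2_sum.
    have -> : \sum_d ev2 (fun b c => w d a * t d b c) v x = \sum_d w d a * ev2 (t d) v x.
      by apply: eq_bigr => d _; rewrite ev2Z.
    ring.
  by move=> c d; rewrite cov3S.
rewrite !ev1D -/(ev3 _ u v x) -/(ev3 _ u v (nb x)) -/(ev3 _ u (nb v) x) -/(ev3 _ (nb u) v x); ring.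
Qed.

Lemma der_ev4 t u v x z :
  D (ev4 t u v x z) = ev4 (cov4 D w t) u v x z + ev4 t (nb u) v x z
    + ev4 t u (nb v) x z + ev4 t u v (nb x) z + ev4 t u v x (nb z).
Proof.
rewrite der_ev1 (@eq_ev1 _ _ _ (fun a => ev3 (cov4 D w t a) v x z
   + ev3 (t a) (nb v) x z + ev3 (t a) v (nb x) z + ev3 (t a) v x (nb z)) _ u) //; last first.
  move=> a; rewrite /cov1 der_ev3.
  rewrite (@eq_ev3 _ _ (cov4 D w t a) (fun c d f => cov3 D w (t a) c d f - \sum_e w e a * t e c d f)).
    rewrite ev3D ev3N ev3_sum.
    have -> : \sum_d ev3 (fun b c f => w d a * t d b c f) v x z = \sum_d w d a * ev3 (t d) v x z.
      by apply: eq_bigr => d _; rewrite ev3Z.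
    ring.
  by move=> c d f; rewrite cov4S.
rewrite !ev1D -/(ev4 _ u v x z) -/(ev4 _ u v (nb x) z) -/(ev4 _ u (nb v) x z) -/(ev4 _ (nb u) v x z)
  -/(ev4 _ u v x (nb z)); ring.
Qed.

End Leibniz.

(** * Contraction with a metric and parallel metrics *)

Section Trace.
Context {A : comPzRingType} {m : nat}.
Implicit Types (gi : 'I_m -> 'I_m -> A).

Definition tr gi (t : 'I_m -> 'I_m -> A) := \sum_a \sum_b gi a b * t a b.
Definition raise gi (x : 'I_m -> A) a := \sum_b gi a b * x b.

Section Linear.
Variable gi : 'I_m -> 'I_m -> A.
Implicit Types (s t : 'I_m -> 'I_m -> A) (x y : 'I_m -> A).

Lemma eq_tr s t : (forall a b, s a b = t a b) -> tr gi s = tr gi t.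
Proof. by move=> e; apply: eq_bigr => a _; apply: eq_bigr => b _; rewrite e. Qed.
Lemma trD s t : tr gi (fun a b => s a b + t a b) = tr gi s + tr gi t.
Proof.
rewrite -big_split; apply: eq_bigr => a _; rewrite -big_split.
by apply: eq_bigr => b _; rewrite mulrDr.
Qed.
Lemma trN t : tr gi (fun a b => - t a b) = - tr gi t.
Proof.
rewrite -sumrN; apply: eq_bigr => a _; rewrite -sumrN.
by apply: eq_bigr => b _; rewrite mulrN.
Qed.
Lemma trB s t : tr gi (fun a b => s a b - t a b) = tr gi s - tr gi t.
Proof. by rewrite trD trN. Qed.
Lemma trZ c t : tr gi (fun a b => c * t a b) = c * tr gi t.
Proof.
rewrite mulr_sumr; apply: eq_bigr => a _; rewrite mulr_sumr.
by apply: eq_bigr => b _; ring.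
Qed.
Lemma trZr c t : tr gi (fun a b => t a b * c) = tr gi t * c.
Proof. by rewrite mulrC -trZ; apply: eq_tr => a b; rewrite mulrC. Qed.
Lemma tr_sum p (t : 'I_p -> 'I_m -> 'I_m -> A) :
  tr gi (fun a b => \sum_d t d a b) = \sum_d tr gi (t d).
Proof.
rewrite exchange_big; apply: eq_bigr => a _; rewrite exchange_big.
by apply: eq_bigr => b _; rewrite mulr_sumr.
Qed.
Lemma tr0 t : (forall a b, t a b = 0) -> tr gi t = 0.
Proof. by move=> e; rewrite /tr big1 // => a _; rewrite big1 // => b _; rewrite e mulr0. Qed.
End Linear.

Lemma trZg gi c t : tr (fun a b => c * gi a b) t = c * tr gi t.
Proof.
by rewrite -trZ; apply: eq_bigr => a _; apply: eq_bigr => b _; ring.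
Qed.

End Trace.

Lemma lf_tr (A : comPzRingType) (m n : nat) (gi : 'I_m -> 'I_m -> A)
    (phi : ('I_n -> A) -> A) (u : 'I_m -> 'I_m -> 'I_n -> A) : linear_form phi ->
  phi (fun i => tr gi (fun a b => u a b i)) = tr gi (fun a b => phi (u a b)).
Proof.
case=> t E; rewrite E /tr /= ev1v_sum; apply: eq_bigr => a _.
by rewrite ev1v_sum; apply: eq_bigr => b _; rewrite ev1vZ E.
Qed.

Lemma tr_exch (A : comPzRingType) (m p : nat) (gi : 'I_m -> 'I_m -> A)
  (hi : 'I_p -> 'I_p -> A) (t : 'I_m -> 'I_m -> 'I_p -> 'I_p -> A) :
  tr gi (fun a b => tr hi (fun c d => t a b c d)) =
  tr hi (fun c d => tr gi (fun a b => t a b c d)).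
Proof.
have E : forall a b, tr hi (t a b) = \sum_c \sum_d hi c d * t a b c d by [].
rewrite tr_sum; apply: eq_bigr => c _; rewrite tr_sum; apply: eq_bigr => d _.
by rewrite trZ.
Qed.

Section Metric.
Context {A : comPzRingType} {m : nat} (g gi : 'I_m -> 'I_m -> A).
Hypothesis g_sym : forall a b, g a b = g b a.
Hypothesis gi_sym : forall a b, gi a b = gi b a.
Hypothesis gi_g : forall a c, \sum_b gi a b * g b c = (a == c)%:R.
Implicit Types (t : 'I_m -> 'I_m -> A) (x y : 'I_m -> A).

Lemma g_gi a c : \sum_b g a b * gi b c = (a == c)%:R.
Proof.
by rewrite eq_sym -gi_g; apply: eq_bigr => b _; rewrite g_sym gi_sym mulrC.
Qed.

Lemma tr_sym t : tr gi t = tr gi (fun a b => t b a).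
Proof.
rewrite /tr exchange_big; apply: eq_bigr => a _; apply: eq_bigr => b _.
by rewrite gi_sym.
Qed.

Lemma tr_anti t : (forall a b, t b a = - t a b) -> tr gi t = - tr gi t.
Proof. by move=> e; rewrite {1}tr_sym -trN; apply: eq_tr => a b; rewrite e. Qed.

Lemma tr_metric : tr gi g = m%:R.
Proof.
rewrite /tr (eq_bigr (fun=> 1)); first by rewrite sumr_const card_ord.
move=> a _; transitivity (\sum_b gi a b * g b a); last by rewrite gi_g eqxx.
by apply: eq_bigr => b _; rewrite g_sym.
Qed.

Lemma tr_gl c x : tr gi (fun a b => g a c * x b) = x c.
Proof.
rewrite /tr exchange_big /= -[RHS]sum_delta_l; apply: eq_bigr => b _.
rewrite -gi_g mulr_suml; apply: eq_bigr => a _; rewrite (gi_sym a b); ring.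
Qed.
Lemma tr_gl' c x : tr gi (fun a b => g c a * x b) = x c.
Proof. by rewrite -[RHS]tr_gl; apply: eq_tr => a b; rewrite g_sym. Qed.
Lemma tr_gr c x : tr gi (fun a b => g b c * x a) = x c.
Proof. by rewrite tr_sym tr_gl. Qed.
Lemma tr_gr' c x : tr gi (fun a b => g c b * x a) = x c.
Proof. by rewrite tr_sym tr_gl'. Qed.

Lemma tr_tens x y : tr gi (fun a b => x a * y b) = ev1 y (raise gi x).
Proof.
rewrite /tr exchange_big; apply: eq_bigr => b _; rewrite mulr_suml.
by apply: eq_bigr => a _; rewrite (gi_sym b); ring.
Qed.

Lemma raiseK x c : \sum_a raise gi x a * g a c = x c.
Proof.
rewrite -[RHS]tr_gl; apply: eq_bigr => a _.
by rewrite mulr_suml; apply: eq_bigr => b _; ring.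
Qed.

Lemma ev1_raiseC x y : ev1 x (raise gi y) = ev1 y (raise gi x).
Proof.
by rewrite -!tr_tens tr_sym; apply: eq_tr => a b; rewrite mulrC.
Qed.

Lemma metric_inj x y :
  (forall c, \sum_a x a * g a c = \sum_a y a * g a c) -> x =1 y.
Proof.
move=> e b.
have E z : z b = \sum_c gi c b * (\sum_a z a * g a c).
  under eq_bigr do rewrite mulr_sumr.
  rewrite exchange_big /= -[LHS]sum_delta_l; apply: eq_bigr => a _.
  by rewrite -g_gi mulr_suml; apply: eq_bigr => c _; ring.
by rewrite E (E y); apply: eq_bigr => c _; rewrite e.
Qed.

Section Parallel.
Context (D : derivation A) (w : 'I_m -> 'I_m -> A).
Hypothesis par : forall b c, cov2 D w g b c = 0.

Lemma der_metric b c : D (g b c) = \sum_e (w e b * g e c + w e c * g b e).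
Proof. by apply/eqP; rewrite -subr_eq0; apply/eqP; apply: par. Qed.

(** Both sides are compared after lowering [d] with [g]; differentiating [gi_g] then trades the
    derivative of [gi] for that of [g]. *)
Lemma der_ginv a d :
  D (gi a d) = - \sum_e (w a e * gi e d + w d e * gi a e).
Proof.
have E1 c : \sum_b D (gi a b) * g b c = - \sum_b gi a b * D (g b c).
  apply/eqP; rewrite -addr_eq0 -big_split /=; apply/eqP.
  transitivity (D (\sum_b gi a b * g b c)); last by rewrite gi_g der_nat.
  by rewrite der_sum; apply: eq_bigr => b _; rewrite derM.
move: d; apply: metric_inj => c; rewrite E1.
have E2 : \sum_b gi a b * (\sum_e w e c * g b e) = w a c.
  under eq_bigr do rewrite mulr_sumr.
  rewrite exchange_big /= -(sum_delta_r a (w^~ c)); apply: eq_bigr => e _.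
  by rewrite -gi_g mulr_suml; apply: eq_bigr => b _; ring.
have E3 : \sum_b (\sum_e w a e * gi e b) * g b c = w a c.
  under eq_bigr do rewrite mulr_suml.
  rewrite exchange_big /= -(sum_delta_l c (w a)); apply: eq_bigr => e _.
  by rewrite -gi_g mulr_suml; apply: eq_bigr => b _; ring.
have E4 : \sum_b gi a b * (\sum_e w e b * g e c) =
          \sum_b (\sum_e w b e * gi a e) * g b c.
  under eq_bigr do rewrite mulr_sumr.
  rewrite exchange_big /=; apply: eq_bigr => e _.
  by rewrite mulr_suml; apply: eq_bigr => b _; ring.
have -> : \sum_b gi a b * D (g b c) = \sum_b gi a b * (\sum_e w e b * g e c)
    + \sum_b gi a b * (\sum_e w e c * g b e).
  by rewrite -big_split; apply: eq_bigr => b _; rewrite der_metric big_split mulrDr.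
rewrite E2 E4 -{}E3 -big_split -sumrN; apply: eq_bigr => b _ /=.
rewrite big_split /=; ring.
Qed.

(** The derivative of [gi] supplies exactly the connection terms of [cov2], one for each index of
    [t]. *)
Lemma der_tr t : D (tr gi t) = tr gi (cov2 D w t).
Proof.
have -> : D (tr gi t) = tr gi (fun a b => D (t a b)) + tr (fun a b => D (gi a b)) t.
  rewrite der_sum -big_split; apply: eq_bigr => a _; rewrite der_sum -big_split.
  by apply: eq_bigr => b _; rewrite derM addrC.
rewrite trB; congr (_ + _); rewrite -[LHS]opprK; congr (- _).
have -> : tr gi (fun a b => \sum_e (w e a * t e b + w e b * t a e)) =
   tr gi (fun a b => \sum_e w e a * t e b) + tr gi (fun a b => \sum_e w e b * t a e).
  by rewrite -trD; apply: eq_tr => a b; rewrite big_split.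
have E s : tr gi (fun a b => \sum_e w e a * s e b) =
   \sum_a \sum_b (\sum_e w a e * gi e b) * s a b.
  rewrite tr_sum; apply: eq_bigr => a _; rewrite /tr exchange_big.
  by apply: eq_bigr => b _; rewrite mulr_suml; apply: eq_bigr => e _; ring.
rewrite E [X in _ = _ + X]tr_sym E [X in _ = _ + X]exchange_big -big_split -sumrN.
apply: eq_bigr => a _; rewrite -big_split -sumrN; apply: eq_bigr => b _ /=.
have Eb : \sum_e w b e * gi a e = \sum_e w b e * gi e a.
  by apply: eq_bigr => e _; rewrite gi_sym.
rewrite der_ginv big_split /= Eb; ring.
Qed.

End Parallel.
End Metric.

(** * Curvature of a torsion-free metric connection *)

(** The four cyclic identities, one for each index in the last place, combine with signs; after the
    antisymmetries only twice the difference of the two sides is left, whence the factor [hf]. *)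
Lemma pair_symmetry (A : comPzRingType) (I : Type) (hf : A)
    (r : I -> I -> I -> I -> A) :
  hf * 2 = 1 -> (forall a b c d, r b a c d = - r a b c d) ->
  (forall a b c d, r a b d c = - r a b c d) ->
  (forall a b c d, r a b c d + r b c a d + r c a b d = 0) ->
  forall a b c d, r c d a b = r a b c d.
Proof.
move=> hf2 r12 r34 cyc a b c d.
have c1 : r c a b d = - r a b c d - r b c a d.
  by apply/eqP; rewrite -subr_eq0 -(cyc a b c d); apply/eqP; ring.
have c2 : - r b c a d - r c d a b + r b d a c = 0.
  rewrite -[RHS](cyc b c d a) (r34 b c a d) (r34 c d a b) (r34 d b a c).
  rewrite (r12 b d a c); ring.
have c3 : r c d a b + r a d b c + r c a b d = 0.
  rewrite -[RHS](cyc c d a b) (r34 d a b c) (r12 a d b c) (r34 a c b d).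
  rewrite (r12 c a b d); ring.
have c4 : - r a d b c - r a b c d + r b d a c = 0.
  by rewrite -[RHS](cyc d a b c) (r34 a b c d) (r12 a d b c); ring.
apply/eqP; rewrite -subr_eq0 -[_ - _]mul1r -hf2; apply/eqP.
transitivity (hf * ((r c d a b + r a d b c + r c a b d)
  - (- r b c a d - r c d a b + r b d a c)
  + (- r a d b c - r a b c d + r b d a c))); first by rewrite c1; ring.
by rewrite c2 c3 c4; ring.
Qed.

Section Connection.
Context {A : comPzRingType} {m : nat} (D : 'I_m -> derivation A).
Implicit Types (G : 'I_m -> 'I_m -> 'I_m -> A).

(* [G c a b] is the Christoffel symbol Gamma^c_{ab}. *)
Definition conn G a := fun c b => G c a b.
Definition nab1 G t a b := cov1 (D a) (conn G a) t b.
Definition nab2 G t a b c := cov2 (D a) (conn G a) t b c.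
Definition nab3 G t a b c d := cov3 (D a) (conn G a) t b c d.
Definition nab4 G t a b c d e := cov4 (D a) (conn G a) t b c d e.

(** Sign and index order are those of the commutator acting on covectors, see [ricci_identity]. *)
Definition rup G a b c d :=
  D b (G d a c) - D a (G d b c)
  + \sum_e G e a c * G d b e - \sum_e G e b c * G d a e.

Definition levi_civita (g : 'I_m -> 'I_m -> A) G :=
  (forall c a b, G c a b = G c b a) /\ (forall a b c, nab2 G g a b c = 0).

(** The Koszul formula ([key]) determines the Christoffel symbols with the upper index lowered, and
    lowering is injective. This is what identifies the connection of the rescaled metric with
    [conf_conn]. *)
Lemma levi_civita_unique (hf : A) (g gi : 'I_m -> 'I_m -> A) G G' :
  hf * 2 = 1 ->
  (forall a b, g a b = g b a) -> (forall a b, gi a b = gi b a) ->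
  (forall a c, \sum_b gi a b * g b c = (a == c)%:R) ->
  levi_civita g G -> levi_civita g G' -> forall c a b, G c a b = G' c a b.
Proof.
move=> hf2 gs gis gig [Gs Gm] [Gs' Gm'] c a b; move: c.
apply: (metric_inj gs gis gig (x := fun c => G c a b)) => c.
pose L G a b c := \sum_d G d a b * g d c.
have LM H : (forall a b c, nab2 H g a b c = 0) ->
    forall a b c, D a (g b c) = L H a b c + L H a c b.
  move=> Hm x y z; rewrite (der_metric (Hm x)) big_split /=; congr (_ + _).
  by apply: eq_bigr => e _; rewrite (gs y).
have LS H : (forall c a b, H c a b = H c b a) -> forall a b c, L H a b c = L H b a c.
  by move=> Hs x y z; apply: eq_bigr => d _; rewrite Hs.
have key H : levi_civita g H ->
    L H a b c = hf * (D a (g b c) + D b (g a c) - D c (g a b)).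
  case=> Hs Hm; rewrite !(LM H Hm) (LS H Hs b a) (LS H Hs c a) (LS H Hs c b).
  by rewrite -[LHS]mul1r -hf2; ring.
by rewrite -!/(L _ a b c) !key.
Qed.

Hypothesis DC : forall a b x, D a (D b x) = D b (D a x).

Section Curvature.
Variable G : 'I_m -> 'I_m -> 'I_m -> A.
Hypothesis G_sym : forall c a b, G c a b = G c b a.

Lemma rup_anti a b c d : rup G b a c d = - rup G a b c d.
Proof. rewrite /rup; ring. Qed.

Lemma rup_cyc a b c d : rup G a b c d + rup G b c a d + rup G c a b d = 0.
Proof.
rewrite /rup (G_sym d b a) (G_sym d c a) (G_sym d c b).
have E x y z : \sum_e G e x y * G d z e = \sum_e G e y x * G d z e.
  by apply: eq_bigr => e _; rewrite G_sym.
rewrite (E b a) (E c a) (E c b); ring.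
Qed.

(** The second derivatives of [t] cancel because the derivations commute, the terms in [nab1 G t]
    contracted with G^e_{ab} because [G] is symmetric. *)
Lemma ricci_identity t a b c :
  nab2 G (nab1 G t) a b c - nab2 G (nab1 G t) b a c = \sum_d rup G a b c d * t d.
Proof.
have E x y : nab2 G (nab1 G t) x y c =
  D x (D y (t c)) - \sum_d D x (G d y c) * t d - \sum_d G d y c * D x (t d)
  - \sum_e G e x y * nab1 G t e c
  - \sum_e G e x c * D y (t e) + \sum_e \sum_d G e x c * G d y e * t d.
  rewrite /nab2 /cov2 /nab1 {1}/cov1 derB der_sum.
  rewrite (eq_bigr (fun d => D x (G d y c) * t d + G d y c * D x (t d))); last first.
    by move=> d _; rewrite derM.
  rewrite !big_split /= /conn -/(nab1 G t).
  have -> : \sum_i G i x c * cov1 (D y) (fun c b => G c y b) t i =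
      \sum_e G e x c * D y (t e) - \sum_e \sum_d G e x c * G d y e * t d.
    rewrite -sumrB; apply: eq_bigr => e _; rewrite /cov1 mulrBr mulr_sumr.
    by congr (_ - _); apply: eq_bigr => d _; rewrite mulrA.
  ring.
rewrite !E (DC b a).
have -> : \sum_e G e b a * nab1 G t e c = \sum_e G e a b * nab1 G t e c.
  by apply: eq_bigr => e _; rewrite G_sym.
have -> : \sum_d rup G a b c d * t d =
   \sum_d D b (G d a c) * t d - \sum_d D a (G d b c) * t d
   + \sum_d (\sum_e G e a c * G d b e * t d) - \sum_d (\sum_e G e b c * G d a e * t d).
  rewrite -!(sumrB, big_split) /=; apply: eq_bigr => d _; rewrite -!mulr_suml /rup; ring.
rewrite [\sum_d \sum_e _ in RHS]exchange_big /=.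
rewrite [X in _ = _ - X]exchange_big /=; ring.
Qed.

Lemma rup_dcoord a b c d :
  nab2 G (nab1 G (fun e => (e == d)%:R)) a b c -
  nab2 G (nab1 G (fun e => (e == d)%:R)) b a c = rup G a b c d.
Proof.
rewrite ricci_identity -[RHS]sum_delta_l; apply: eq_bigr => e _.
by rewrite mulrC.
Qed.

(** Matrix form of the connection: rows carry the lower index, columns the upper one. By [mKE] the
    curvature matrix [mK a b] is the commutator of the operators D_a - [mG a] and D_b - [mG b]. *)
Let mD a (M : 'M[A]_m) : 'M[A]_m := map_mx (D a) M.
Let mG a : 'M[A]_m := \matrix_(c, d) G d a c.
Let mK a b : 'M[A]_m := \matrix_(c, d) rup G a b c d.

Let mxD (M N : 'M[A]_m) i j : (M + N) i j = M i j + N i j. Proof. by rewrite mxE. Qed.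
Let mxN (M : 'M[A]_m) i j : (- M) i j = - M i j. Proof. by rewrite mxE. Qed.

Let mDM a M N : mD a (M *m N) = mD a M *m N + M *m mD a N.
Proof.
apply/matrixP => i j; rewrite !mxE der_sum -big_split; apply: eq_bigr => e _.
by rewrite derM !mxE.
Qed.
Let mDD a M N : mD a (M + N) = mD a M + mD a N.
Proof. by apply/matrixP => i j; rewrite !mxE derD. Qed.
Let mDN a M : mD a (- M) = - mD a M.
Proof. by apply/matrixP => i j; rewrite !mxE derN. Qed.
Let mDC a b M : mD a (mD b M) = mD b (mD a M).
Proof. by apply/matrixP => i j; rewrite !mxE DC. Qed.

Let mKE a b : mK a b = mD b (mG a) - mD a (mG b) + mG a *m mG b - mG b *m mG a.
Proof.
apply/matrixP => c d; rewrite !mxE /rup; congr (_ + _ - _);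
  by apply: eq_bigr => e _; rewrite !mxE.
Qed.

Let expE := (mDM, mDD, mDN, mulmxDl, mulmxDr, mulNmx, mulmxN, mulmxA).

(** The Jacobi identity for the three operators D_x - [mG x]: each bracket is the commutator of one
    of them with the curvature of the other two. *)
Let jacobi e a b :
  (mD e (mK a b) - mG e *m mK a b + mK a b *m mG e)
  + (mD a (mK b e) - mG a *m mK b e + mK b e *m mG a)
  + (mD b (mK e a) - mG b *m mK e a + mK e a *m mG b) = 0.
Proof.
rewrite !mKE !expE (mDC b a) (mDC a e) (mDC b e).
(* All products are expanded and reassociated, so their entries are atoms and the cancellation is
   linear. *)
apply/matrixP => c d; rewrite !(mxD, mxN) [RHS]mxE; ring.
Qed.

Section Metric.
Variables (g gi : 'I_m -> 'I_m -> A).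
Hypothesis g_sym : forall a b, g a b = g b a.
Hypothesis G_par : forall a b c, nab2 G g a b c = 0.

Definition rlow a b c d := \sum_e rup G a b c e * g e d.

Lemma rlow_anti12 a b c d : rlow b a c d = - rlow a b c d.
Proof. by rewrite -sumrN; apply: eq_bigr => e _; rewrite rup_anti mulNr. Qed.

Lemma rlow_cyc a b c d : rlow a b c d + rlow b c a d + rlow c a b d = 0.
Proof.
rewrite -!big_split big1 // => e _.
by rewrite /= -!mulrDl rup_cyc mul0r.
Qed.

Let mg : 'M[A]_m := \matrix_(c, d) g c d.
Let mg_par a : mD a mg = mG a *m mg + mg *m (mG a)^T.
Proof.
apply/matrixP => c d; rewrite !mxE (der_metric (G_par a)) big_split /=.
by congr (_ + _); apply: eq_bigr => e _; rewrite !mxE // mulrC.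
Qed.
Let mDT a M : mD a M^T = (mD a M)^T.
Proof. by apply/matrixP => i j; rewrite !mxE. Qed.

(** Second derivatives of the metric commute. Expressed through [mg_par], this says that
    [mK a b *m mg] plus its transpose vanishes. *)
Lemma rlow_anti34 a b c d : rlow a b d c = - rlow a b c d.
Proof.
have E : mK a b *m mg + mg *m (mK a b)^T = 0.
  have := mDC a b mg; rewrite !mg_par !expE !mg_par !expE !mDT => H.
  apply/matrixP => i j; move/matrixP: H => /(_ i j).
  rewrite !mKE !linearD /= !linearN /= !trmx_mul !expE !(mxD, mxN) [X in _ -> _ = X]mxE.
  by move/eqP; rewrite -subr_eq0 => /eqP H; rewrite -[RHS]oppr0 -H; ring.
apply/eqP; rewrite -addr_eq0 addrC; apply/eqP.
move/matrixP: E => /(_ c d); rewrite !mxE => <-; congr (_ + _).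
  by apply: eq_bigr => e _; rewrite !mxE.
by apply: eq_bigr => e _; rewrite !mxE mulrC g_sym.
Qed.

(** The indices [c] and [d] are absorbed into the matrix derivative of [jacobi], [d] being lowered
    with a parallel metric; only the corrections for [a] and [b] stay explicit. *)
Let nab_rlow e a b c d : nab4 G rlow e a b c d =
  \sum_f (mD e (mK a b) - mG e *m mK a b + mK a b *m mG e) c f * g f d
  - \sum_x (G x e a * rlow x b c d + G x e b * rlow a x c d).
Proof.
rewrite /nab4 /cov4 /conn !big_split /= der_sum.
have -> : \sum_i D e (rup G a b c i * g i d) = \sum_f D e (rup G a b c f) * g f d
    + \sum_f (\sum_x rup G a b c x * G f e x) * g f d
    + \sum_x G x e d * rlow a b c x.
  have -> : \sum_x G x e d * rlow a b c x =
      \sum_f rup G a b c f * \sum_x G x e d * g f x.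
    under eq_bigr do rewrite mulr_sumr.
    rewrite exchange_big /=; apply: eq_bigr => f _; rewrite mulr_sumr.
    by apply: eq_bigr => x _; ring.
  have -> : \sum_f (\sum_x rup G a b c x * G f e x) * g f d =
      \sum_f rup G a b c f * \sum_x G x e f * g x d.
    under eq_bigr do rewrite mulr_suml.
    rewrite exchange_big /=; apply: eq_bigr => f _; rewrite mulr_sumr.
    by apply: eq_bigr => x _; ring.
  rewrite -!big_split /=; apply: eq_bigr => f _.
  by rewrite derM (der_metric (G_par e)) big_split /=; ring.
have -> : \sum_i G i e c * rlow a b i d =
    \sum_f (\sum_x G x e c * rup G a b x f) * g f d.
  under eq_bigr do rewrite mulr_sumr.
  rewrite exchange_big /=; apply: eq_bigr => f _; rewrite mulr_suml.
  by apply: eq_bigr => x _; ring.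
have -> : \sum_f (mD e (mK a b) - mG e *m mK a b + mK a b *m mG e) c f * g f d =
   \sum_f D e (rup G a b c f) * g f d
   - \sum_f (\sum_x G x e c * rup G a b x f) * g f d
   + \sum_f (\sum_x rup G a b c x * G f e x) * g f d.
  rewrite -sumrB -big_split; apply: eq_bigr => f _ /=.
  rewrite !mxE -!mulrBl -mulrDl; congr (_ * _); congr (_ - _ + _);
    by apply: eq_bigr => x _; rewrite !mxE.
ring.
Qed.

(** [jacobi] disposes of the matrix part. The corrections for the first two indices cancel in pairs,
    by symmetry of [G] and antisymmetry of the curvature. *)
Lemma second_bianchi e a b c d :
  nab4 G rlow e a b c d + nab4 G rlow a b e c d + nab4 G rlow b e a c d = 0.
Proof.
rewrite !nab_rlow !big_split /=.
have S1 x y z : \sum_i G i x y * rlow i z c d = \sum_i G i y x * rlow i z c d.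
  by apply: eq_bigr => i _; rewrite G_sym.
have S2 x y z : \sum_i G i x y * rlow z i c d = - \sum_i G i x y * rlow i z c d.
  by rewrite -sumrN; apply: eq_bigr => i _; rewrite rlow_anti12 mulrN.
rewrite !S2 (S1 a e) (S1 b a) (S1 b e).
pose J e a b := \sum_f
  (mD e (mK a b) - mG e *m mK a b + mK a b *m mG e) c f * g f d.
rewrite -/(J e a b) -/(J a b e) -/(J b e a).
have : J e a b + J a b e + J b e a = 0.
  rewrite -!big_split big1 // => f _; rewrite /= -!mulrDl.
  have /matrixP/(_ c f) := jacobi e a b; rewrite !mxD => ->.
  by rewrite mxE mul0r.
by move=> <-; ring.
Qed.

End Metric.
End Curvature.
End Connection.

(** * Covariant derivatives of sums, index permutations and traces *)

Section CovariantProducts.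
Context {A : comPzRingType} {m : nat} (D : derivation A) (w : 'I_m -> 'I_m -> A).
Implicit Types (s t : 'I_m -> 'I_m -> A) (r : 'I_m -> 'I_m -> 'I_m -> 'I_m -> A).
Variable g : 'I_m -> 'I_m -> A.
Hypothesis par : forall b c, cov2 D w g b c = 0.

Lemma eq_cov2 s t b c : (forall a b, s a b = t a b) -> cov2 D w s b c = cov2 D w t b c.
Proof. by move=> e; rewrite /cov2 e; under eq_bigr do rewrite !e. Qed.

Lemma eq_cov4 r r' a b c d : (forall a b c d, r a b c d = r' a b c d) ->
  cov4 D w r a b c d = cov4 D w r' a b c d.
Proof. by move=> e; rewrite /cov4 e; under eq_bigr do rewrite !e. Qed.

Lemma cov2B s t a b :
  cov2 D w (fun a b => s a b - t a b) a b = cov2 D w s a b - cov2 D w t a b.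
Proof.
rewrite /cov2 derB.
have -> : \sum_e (w e a * (s e b - t e b) + w e b * (s a e - t a e)) =
    \sum_e (w e a * s e b + w e b * s a e) - \sum_e (w e a * t e b + w e b * t a e).
  by rewrite -sumrB; apply: eq_bigr => e _; ring.
ring.
Qed.

Lemma eq_cov3 (t u : 'I_m -> 'I_m -> 'I_m -> A) a b c :
  (forall a b c, t a b c = u a b c) -> cov3 D w t a b c = cov3 D w u a b c.
Proof. by move=> e; rewrite /cov3 e; under eq_bigr do rewrite !e. Qed.

Lemma cov3B (t u : 'I_m -> 'I_m -> 'I_m -> A) a b c :
  cov3 D w (fun a b c => t a b c - u a b c) a b c = cov3 D w t a b c - cov3 D w u a b c.
Proof.
rewrite /cov3 derB.
have -> : \sum_e (w e a * (t e b c - u e b c) + w e b * (t a e c - u a e c)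
      + w e c * (t a b e - u a b e)) =
    \sum_e (w e a * t e b c + w e b * t a e c + w e c * t a b e)
    - \sum_e (w e a * u e b c + w e b * u a e c + w e c * u a b e).
  by rewrite -sumrB; apply: eq_bigr => e _; ring.
ring.
Qed.

Lemma cov4D r r' a b c d :
  cov4 D w (fun a b c d => r a b c d + r' a b c d) a b c d =
  cov4 D w r a b c d + cov4 D w r' a b c d.
Proof.
rewrite /cov4 derD addrACA -opprD -big_split /=; congr (_ - _).
by apply: eq_bigr => e _; ring.
Qed.

Lemma cov4N r a b c d :
  cov4 D w (fun a b c d => - r a b c d) a b c d = - cov4 D w r a b c d.
Proof.
rewrite /cov4 derN opprB addrC -sumrN; congr (_ + _).
by apply: eq_bigr => e _; ring.
Qed.

Lemma cov4_swap12 r a b c d :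
  cov4 D w (fun a b c d => r b a c d) a b c d = cov4 D w r b a c d.
Proof. by rewrite /cov4; congr (_ - _); apply: eq_bigr => e _; ring. Qed.
Lemma cov4_swap34 r a b c d :
  cov4 D w (fun a b c d => r a b d c) a b c d = cov4 D w r a b d c.
Proof. by rewrite /cov4; congr (_ - _); apply: eq_bigr => e _; ring. Qed.
Lemma cov4_swap_pairs r a b c d :
  cov4 D w (fun a b c d => r c d a b) a b c d = cov4 D w r c d a b.
Proof. by rewrite /cov4; congr (_ - _); apply: eq_bigr => e _; ring. Qed.

Lemma cov4_metric s a b c d :
  cov4 D w (fun a b c d => s a c * g b d) a b c d = cov2 D w s a c * g b d.
Proof.
rewrite /cov4 derM (der_metric par) /cov2.
have -> : \sum_e (w e a * (s e c * g b d) + w e b * (s a c * g e d)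
      + w e c * (s a e * g b d) + w e d * (s a c * g b e)) =
    (\sum_e (w e a * s e c + w e c * s a e)) * g b d +
    s a c * \sum_e (w e b * g e d + w e d * g b e).
  by rewrite mulr_suml mulr_sumr -big_split; apply: eq_bigr => e _ /=; ring.
ring.
Qed.

Section Trace.
Variable gi : 'I_m -> 'I_m -> A.
Hypothesis g_sym : forall a b, g a b = g b a.
Hypothesis gi_sym : forall a b, gi a b = gi b a.
Hypothesis gi_g : forall a c, \sum_b gi a b * g b c = (a == c)%:R.

(** By [der_tr] the connection terms of the contracted indices are those of the derivative of the
    trace; the terms of the free indices pass through the trace by linearity. *)
Lemma cov2_trace r a b :
  cov2 D w (fun a b => tr gi (fun c d => r a c b d)) a b =
  tr gi (fun c d => cov4 D w r a c b d).
Proof.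
have E c d : cov4 D w r a c b d = cov2 D w (fun c d => r a c b d) c d -
   (\sum_e w e a * r e c b d + \sum_e w e b * r a c e d).
  by rewrite /cov4 /cov2 !big_split /=; ring.
rewrite (eq_tr gi E) trB [X in _ = _ - X]trD [X in _ = _ - (X + _)]tr_sum
  [X in _ = _ - (_ + X)]tr_sum -(der_tr g_sym gi_sym gi_g par).
rewrite /cov2 big_split /=; congr (_ - (_ + _)).
  by apply: eq_bigr => e _; rewrite trZ.
by apply: eq_bigr => e _; rewrite trZ.
Qed.

Lemma cov4_trace0 r : (forall a b, tr gi (fun c d => r a c b d) = 0) ->
  forall a b, tr gi (fun c d => cov4 D w r a c b d) = 0.
Proof.
move=> r0 a b; rewrite -cov2_trace (eq_cov2 _ _ (t := fun _ _ => 0)) //.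
by rewrite /cov2 der0 big1 ?subr0 // => e _; rewrite !mulr0 addr0.
Qed.
End Trace.

End CovariantProducts.

Section RaiseCov.
Context {A : comPzRingType} {m : nat} (D : derivation A) (w : 'I_m -> 'I_m -> A).
Variables (g gi : 'I_m -> 'I_m -> A).
Hypothesis g_sym : forall a b, g a b = g b a.
Hypothesis gi_sym : forall a b, gi a b = gi b a.
Hypothesis gi_g : forall a c, \sum_b gi a b * g b c = (a == c)%:R.
Hypothesis par : forall b c, cov2 D w g b c = 0.

Lemma covv_raise x a : covv D w (raise gi x) a = raise gi (cov1 D w x) a.
Proof.
rewrite /covv /raise /cov1 der_sum.
have -> : \sum_b w a b * (\sum_c gi b c * x c) =
    \sum_c (\sum_e w a e * gi e c) * x c.
  under eq_bigr do rewrite mulr_sumr.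
  rewrite exchange_big; apply: eq_bigr => c _; rewrite mulr_suml.
  by apply: eq_bigr => e _; ring.
have -> : \sum_b gi a b * (D (x b) - \sum_d w d b * x d) =
    \sum_b gi a b * D (x b) - \sum_b (\sum_e w b e * gi a e) * x b.
  rewrite -[in RHS]sumrN.
  have -> : \sum_i - ((\sum_e w i e * gi a e) * x i) = - \sum_i gi a i * \sum_d w d i * x d.
    rewrite sumrN; congr (- _); under [RHS]eq_bigr do rewrite mulr_sumr.
    rewrite exchange_big; apply: eq_bigr => c _; rewrite mulr_suml.
    by apply: eq_bigr => e _; ring.
  by rewrite -sumrB; apply: eq_bigr => b _; rewrite mulrBr.
rewrite -!(sumrB, big_split); apply: eq_bigr => b _ /=.
rewrite derM (der_ginv g_sym gi_sym gi_g par) big_split /=; ring.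
Qed.

Lemma cov3_ev1 (t : 'I_m -> 'I_m -> 'I_m -> 'I_m -> A) u b c d :
  cov3 D w (fun b c d => ev1 (t b c d) u) b c d =
  ev1 (cov4 D w t b c d) u + ev1 (t b c d) (covv D w u).
Proof.
rewrite /cov3 (der_ev1 D w).
rewrite (_ : \sum_e _ = ev1 (fun f => \sum_e (w e b * t e c d f + w e c * t b e d f
   + w e d * t b c e f)) u).
  rewrite addrAC -ev1N -ev1D; congr (_ + _); apply: eq_ev1 => // f.
  by rewrite /cov4 /cov1 [in RHS]big_split /=; ring.
rewrite ev1_sum; apply: eq_bigr => e _; by rewrite !ev1D !ev1Z.
Qed.

End RaiseCov.

(* [Z] stands for the covariant derivative of the Weyl tensor, with the index of
   the derivative first, and [C] for the Cotton tensor. *)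
Section WeylBianchiContraction.
Context {A : comPzRingType} {m : nat} (g gi : 'I_m -> 'I_m -> A).
Hypothesis g_sym : forall a b, g a b = g b a.
Hypothesis gi_sym : forall a b, gi a b = gi b a.
Hypothesis gi_g : forall a c, \sum_b gi a b * g b c = (a == c)%:R.
Variables (Z : 'I_m -> 'I_m -> 'I_m -> 'I_m -> 'I_m -> A)
          (C : 'I_m -> 'I_m -> 'I_m -> A).
Hypothesis Z12 : forall e a b c d, Z e b a c d = - Z e a b c d.
Hypothesis Z34 : forall e a b c d, Z e a b d c = - Z e a b c d.
Hypothesis Zpair : forall e a b c d, Z e c d a b = Z e a b c d.
Hypothesis C12 : forall a b c, C b a c = - C a b c.
Hypothesis bianchi : forall e a b c d,
  Z e a b c d + Z a b e c d + Z b e a c d =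
  - (C e a c * g b d + C b e c * g a d + C a b c * g e d
     - C e a d * g b c - C b e d * g a c - C a b d * g e c).

Let G1 x (y : 'I_m -> A) : tr gi (fun e d => y e * g x d) = y x.
Proof. by rewrite -[RHS](tr_gr' g_sym gi_sym gi_g); apply: eq_tr => e d; rewrite mulrC. Qed.
Let G2 x (y : 'I_m -> A) : tr gi (fun e d => y d * g e x) = y x.
Proof. by rewrite -[RHS](tr_gl gi_sym gi_g); apply: eq_tr => e d; rewrite mulrC. Qed.

(** Stated before trace-freeness is assumed, because it serves twice: on X, where both traces on the
    left vanish, and along Y with the induced metric, where the tangential traces of the Weyl tensor
    survive. *)
Lemma bianchi_contraction2 f :
  tr gi (fun a b => tr gi (fun c d => Z f a c b d))
  - 2 * tr gi (fun e a => tr gi (fun c d => Z e a c f d)) =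
  2 * (m%:R - 2) * tr gi (fun a b => C a f b).
Proof.
pose T t := tr gi (fun a b => tr gi (fun c d => t a b c d)).
have TD s t : T (fun a b c d => s a b c d + t a b c d) = T s + T t.
  by rewrite /T -trD; apply: eq_tr => a b; rewrite trD.
have TN t : T (fun a b c d => - t a b c d) = - T t.
  by rewrite /T -trN; apply: eq_tr => a b; rewrite trN.
have E2 : T (fun a b c d => Z a c f b d) = - T (fun e a c d => Z e a c f d).
  rewrite -TN /T; apply: eq_tr => a b; rewrite (tr_sym gi_sym).
  by apply: eq_tr => c d; rewrite -Zpair Z34.
have E3 : T (fun a b c d => Z c f a b d) = - T (fun e a c d => Z e a c f d).
  rewrite -TN /T tr_exch; apply: eq_tr => a b; rewrite (tr_sym gi_sym).
  by apply: eq_tr => c d; rewrite -Zpair Z12.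
pose c0 := tr gi (fun a b => C a f b).
have c0N : tr gi (fun a b => C f a b) = - c0.
  by rewrite -trN; apply: eq_tr => a b; rewrite C12.
have F1 : T (fun a b c d => C f a b * g c d) = - (m%:R * c0).
  rewrite -mulrN -c0N -trZ; apply: eq_tr => a b.
  by rewrite trZ (tr_metric g_sym gi_g) mulrC.
have F2 : T (fun a b c d => C c f b * g a d) = c0.
  by apply: eq_tr => a b; rewrite (G1 a (fun c => C c f b)).
have F3 : T (fun a b c d => C a c b * g f d) = c0.
  by apply: eq_tr => a b; rewrite (G1 f (fun c => C a c b)).
have F4 : T (fun a b c d => C f a d * g c b) = - c0.
  by rewrite -c0N; apply: eq_tr => a b; rewrite (G2 b (fun d => C f a d)).
have F5 : T (fun a b c d => C c f d * g a b) = m%:R * c0.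
  rewrite /T tr_exch /c0 -trZ; apply: eq_tr => a b.
  by rewrite trZ (tr_metric g_sym gi_g) mulrC.
have F6 : T (fun a b c d => C a c d * g f b) = - c0.
  rewrite /T tr_exch -c0N; apply: eq_tr => c d.
  by rewrite (G1 f (fun a => C a c d)).
have : T (fun a b c d => Z f a c b d + Z a c f b d + Z c f a b d) =
  - (T (fun a b c d => C f a b * g c d) + T (fun a b c d => C c f b * g a d)
   + T (fun a b c d => C a c b * g f d) - T (fun a b c d => C f a d * g c b)
   - T (fun a b c d => C c f d * g a b) - T (fun a b c d => C a c d * g f b)).
  rewrite -!TN -!TD -TN; apply: eq_tr => a b; apply: eq_tr => c d.
  exact: bianchi.
rewrite !TD E2 E3 F1 F2 F3 F4 F5 F6 => H.
transitivity (T (fun a b c d => Z f a c b d) - T (fun a b c d => Z a b c f d)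
  - T (fun a b c d => Z a b c f d)); first by rewrite /T; ring.
rewrite H -/c0; ring.
Qed.

Hypothesis Z24 : forall e a b, tr gi (fun c d => Z e a c b d) = 0.
Variable hf c2 : A.
Hypothesis hf2 : hf * 2 = 1.
Hypothesis c2E : c2 * (m%:R - 2) = 1.

(** The left side of [bianchi_contraction2] vanishes, and 2 (m - 2) is invertible. *)
Lemma cotton_trace0 f : tr gi (fun a b => C a f b) = 0.
Proof.
have := bianchi_contraction2 f.
rewrite [X in X - _]tr0; last by move=> a b; apply: Z24.
rewrite [X in _ - _ * X]tr0; last by move=> a b; apply: Z24.
rewrite mulr0 subr0 => /(congr1 (fun x => hf * c2 * x)).
rewrite mulr0 => H; rewrite [RHS]H.
transitivity ((hf * 2) * (c2 * (m%:R - 2)) * tr gi (fun a b => C a f b)); last by ring.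
by rewrite hf2 c2E !mul1r.
Qed.

(** Contracting [e] with [d] kills the two other derivative terms, which are traces. On the right
    the metric terms give m - 2 - 1 copies of [C a b c]. *)
Lemma bianchi_contraction1 a b c :
  tr gi (fun e d => Z e a b c d) = - (m%:R - 3) * C a b c.
Proof.
have c0 x : tr gi (fun e d => C e x d) = 0 := cotton_trace0 x.
have c0' x : tr gi (fun e d => C x e d) = 0.
  by rewrite -oppr0 -(c0 x) -trN; apply: eq_tr => e d; rewrite C12.
have E2 : tr gi (fun e d => Z a b e c d) = 0 by apply: Z24.
have E3 : tr gi (fun e d => Z b e a c d) = 0.
  rewrite -oppr0 -(Z24 b a c) -trN; apply: eq_tr => e d; exact: Z12.
have := eq_tr gi (fun e d => bianchi e a b c d).
rewrite !(trD, trN) !trZr E2 E3 c0 c0'.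
rewrite (G1 b (fun e => C e a c)) (G1 a (fun e => C b e c)).
rewrite (G2 c (fun d => C a b d)) trZ (tr_metric g_sym gi_g) !addr0 => ->.
rewrite (C12 a b c); ring.
Qed.

End WeylBianchiContraction.

(* [c1] and [c2] stand for the inverses of 2(m - 1) and m - 2. *)
Section CurvatureTensors.
Context {A : comPzRingType} {m : nat} (D : 'I_m -> derivation A) (c1 c2 : A).
Implicit Types (G : 'I_m -> 'I_m -> 'I_m -> A) (g gi : 'I_m -> 'I_m -> A).

Definition ric G a b := \sum_c rup D G a c b c.
Definition schtr gi G := tr gi (ric G) * c1.
Definition sch g gi G a b := (ric G a b - schtr gi G * g a b) * c2.
Definition weylA g gi G a b c d :=
  rlow D G g a b c d - sch g gi G a c * g b d - sch g gi G b d * g a c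
  + sch g gi G a d * g b c + sch g gi G b c * g a d.
Definition cott g gi G a b c :=
  nab2 D G (sch g gi G) a b c - nab2 D G (sch g gi G) b a c.
Definition bachA g gi G a b :=
  tr gi (fun c d => nab3 D G (cott g gi G) d c a b)
  + tr gi (fun c e => tr gi (fun d f => weylA g gi G a c b d * sch g gi G e f)).

End CurvatureTensors.

(** * Symmetries, traces and Bianchi identities of the curvature tensors *)

Section Metric.
Context {A : comPzRingType} {m : nat} (D : 'I_m -> derivation A) (hf c1 c2 : A).
Hypothesis DC : forall a b x, D a (D b x) = D b (D a x).
Hypothesis hf2 : hf * 2 = 1.
Hypothesis c1E : c1 * (2 * (m%:R - 1)) = 1.
Hypothesis c2E : c2 * (m%:R - 2) = 1.
Variables (g gi : 'I_m -> 'I_m -> A) (G : 'I_m -> 'I_m -> 'I_m -> A).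
Hypothesis g_sym : forall a b, g a b = g b a.
Hypothesis gi_sym : forall a b, gi a b = gi b a.
Hypothesis gi_g : forall a c, \sum_b gi a b * g b c = (a == c)%:R.
Hypothesis LC : levi_civita D g G.

Let G_sym : forall c a b, G c a b = G c b a := LC.1.
Let par : forall a b c, nab2 D G g a b c = 0 := LC.2.
Let R := rlow D G g.
Let P := sch D c1 c2 g gi G.
Let J := schtr D c1 gi G.
Let W := weylA D c1 c2 g gi G.
Let C := cott D c1 c2 g gi G.
Let ggi := g_gi g_sym gi_sym gi_g.

Lemma ric_tr a b : ric D G a b = tr gi (fun c d => R a c b d).
Proof.
apply: eq_bigr => c _; under [RHS]eq_bigr do rewrite mulr_sumr.
rewrite exchange_big /= -[LHS](sum_delta_l c (rup D G a c b)).
apply: eq_bigr => e _; rewrite -ggi mulr_suml; apply: eq_bigr => d _.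
rewrite (gi_sym d); ring.
Qed.

Let R_pair a b c d : R c d a b = R a b c d.
Proof.
apply: (pair_symmetry hf2) => {a b c d} a b c d; first exact: rlow_anti12.
- exact: (rlow_anti34 DC g_sym par).
- exact: rlow_cyc.
Qed.

Lemma ric_sym a b : ric D G a b = ric D G b a.
Proof.
by rewrite !ric_tr [RHS](tr_sym gi_sym); apply: eq_tr => c d; rewrite R_pair.
Qed.

Lemma sch_sym a b : P a b = P b a.
Proof. by rewrite /P /sch ric_sym g_sym. Qed.

Lemma tr_ric : tr gi (ric D G) = 2 * (m%:R - 1) * J.
Proof.
rewrite /J /schtr; transitivity (tr gi (ric D G) * (c1 * (2 * (m%:R - 1)))).
  by rewrite c1E mulr1.
ring.
Qed.

Lemma ricE a b : ric D G a b = (m%:R - 2) * P a b + J * g a b.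
Proof.
rewrite /P /sch; transitivity ((ric D G a b - J * g a b) * (c2 * (m%:R - 2)) + J * g a b).
  by rewrite c2E; ring.
rewrite -/J; ring.
Qed.

Lemma tr_sch : tr gi P = J.
Proof.
rewrite /P /sch (eq_tr _ (fun a b => mulrC _ c2)) trZ trB trZ (tr_metric g_sym gi_g) tr_ric.
transitivity (c2 * (m%:R - 2) * J); first by rewrite -/J; ring.
by rewrite c2E mul1r.
Qed.

Lemma weyl12 a b c d : W b a c d = - W a b c d.
Proof. rewrite /W /weylA -/(R _ _ _ _) [rlow _ _ _ _ _ _ _]rlow_anti12 -/R; ring. Qed.
Lemma weyl34 a b c d : W a b d c = - W a b c d.
Proof. rewrite /W /weylA (rlow_anti34 DC g_sym par); ring. Qed.
Lemma weyl_pair a b c d : W c d a b = W a b c d.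
Proof.
rewrite /W /weylA -/R -/P R_pair (sch_sym c a) (sch_sym d b) (sch_sym c b) (sch_sym d a).
rewrite (g_sym d b) (g_sym c a) (g_sym d a) (g_sym c b); ring.
Qed.

(** The trace of the four Schouten terms is (m - 2) P + J g, which is the Ricci tensor by [ricE]. *)
Lemma weyl_trace a b : tr gi (fun c d => W a c b d) = 0.
Proof.
rewrite /W /weylA -/P -/R !(trD, trN) trZ (tr_metric g_sym gi_g) -ric_tr ricE trZr tr_sch.
rewrite (eq_tr _ (fun c d => mulrC (P a d) _)) (tr_gl gi_sym gi_g b (P a)).
rewrite (eq_tr _ (fun c d => mulrC (P c b) _)) (tr_gr' g_sym gi_sym gi_g a (P^~ b)).
ring.
Qed.

Lemma cott12 a b c : C b a c = - C a b c.
Proof. rewrite /C /cott; ring. Qed.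

Lemma nab2_sym (t : 'I_m -> 'I_m -> A) a b c :
  (forall a b, t a b = t b a) -> nab2 D G t a b c = nab2 D G t a c b.
Proof.
move=> ts; rewrite /nab2 /cov2 (ts b); congr (_ - _); apply: eq_bigr => e _.
by rewrite (ts e c) (ts b e) addrC.
Qed.

Lemma cott_cyc a b c : C a b c + C b c a + C c a b = 0.
Proof.
rewrite /C /cott (nab2_sym a b c sch_sym) (nab2_sym b a c sch_sym) (nab2_sym c a b sch_sym).
ring.
Qed.

Let nab4W e a b c d : nab4 D G W e a b c d = nab4 D G R e a b c d
  - nab2 D G P e a c * g b d - nab2 D G P e b d * g a c
  + nab2 D G P e a d * g b c + nab2 D G P e b c * g a d.
Proof.
rewrite /nab4 /W /weylA -/P -/R.
have M r a' b' c' d' := @cov4_metric _ _ (D e) (conn G e) g (par e) r a' b' c' d'.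
rewrite !cov4D !cov4N M; congr (_ - _ - _ + _ + _).
(* The remaining three products of [P] and [g] are index permutations of the one treated by [M]. *)
- rewrite (cov4_swap12 (D e) (conn G e) (fun a b c d => P a d * g b c)).
  by rewrite (cov4_swap34 (D e) (conn G e) (fun a b c d => P a c * g b d)) M.
- by rewrite (cov4_swap34 (D e) (conn G e) (fun a b c d => P a c * g b d)) M.
- by rewrite (cov4_swap12 (D e) (conn G e) (fun a b c d => P a c * g b d)) M.
Qed.

Lemma weyl_bianchi e a b c d :
  nab4 D G W e a b c d + nab4 D G W a b e c d + nab4 D G W b e a c d =
  - (C e a c * g b d + C b e c * g a d + C a b c * g e d
     - C e a d * g b c - C b e d * g a c - C a b d * g e c).
Proof.
rewrite !nab4W.
have := second_bianchi DC G_sym par e a b c d; rewrite -/R => /eqP.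
rewrite -addrA addr_eq0 => /eqP ->.
rewrite /C /cott -/P; ring.
Qed.

Lemma nab_weyl12 e a b c d : nab4 D G W e b a c d = - nab4 D G W e a b c d.
Proof.
rewrite /nab4 -cov4_swap12 -cov4N; apply: eq_cov4 => *; exact: weyl12.
Qed.
Lemma nab_weyl34 e a b c d : nab4 D G W e a b d c = - nab4 D G W e a b c d.
Proof.
rewrite /nab4 -cov4_swap34 -cov4N; apply: eq_cov4 => *; exact: weyl34.
Qed.
Lemma nab_weyl_pair e a b c d : nab4 D G W e c d a b = nab4 D G W e a b c d.
Proof.
rewrite /nab4 -cov4_swap_pairs; apply: eq_cov4 => *; exact: weyl_pair.
Qed.
Let Z24 e a b : tr gi (fun c d => nab4 D G W e a c b d) = 0.
Proof. exact: (cov4_trace0 (par e) g_sym gi_sym gi_g weyl_trace). Qed.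

Lemma cott_trace f : tr gi (fun a b => C a f b) = 0.
Proof.
exact: (cotton_trace0 g_sym gi_sym gi_g nab_weyl12 nab_weyl34 nab_weyl_pair cott12 weyl_bianchi Z24 hf2 c2E).
Qed.

Lemma div_weyl a b c :
  tr gi (fun e d => nab4 D G W e a b c d) = - (m%:R - 3) * C a b c.
Proof.
exact: (bianchi_contraction1 g_sym gi_sym gi_g nab_weyl12 nab_weyl34 nab_weyl_pair cott12 weyl_bianchi Z24 hf2 c2E).
Qed.

End Metric.

(* [e] stands for e^{2 Upsilon}, [ei] for its inverse and [Y] for d Upsilon. *)
Section Conformal.
Context {A : comPzRingType} {m : nat} (D : 'I_m -> derivation A) (hf : A).
Hypothesis hf2 : hf * 2 = 1.
Variables (g gi : 'I_m -> 'I_m -> A) (G : 'I_m -> 'I_m -> 'I_m -> A).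
Hypothesis g_sym : forall a b, g a b = g b a.
Hypothesis gi_sym : forall a b, gi a b = gi b a.
Hypothesis gi_g : forall a c, \sum_b gi a b * g b c = (a == c)%:R.
Hypothesis LC : levi_civita D g G.
Variables (Y : 'I_m -> A) (e ei : A).
Hypothesis e_ei : e * ei = 1.
Hypothesis De : forall a, D a e = 2 * Y a * e.
Hypothesis DY : forall a b, D a (Y b) = D b (Y a).

Let G_sym : forall c a b, G c a b = G c b a := LC.1.
Let par : forall a b c, nab2 D G g a b c = 0 := LC.2.

(** The classical formula for the Christoffel symbols of e^{2 Upsilon} g, taken as a definition and
    justified by [conf_levi_civita]. *)
Definition conf_conn c a b : A :=
  G c a b + (c == a)%:R * Y b + (c == b)%:R * Y a - g a b * raise gi Y c.
Definition conf_metric a b := e * g a b.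
Definition conf_ginv a b := ei * gi a b.

Notation Gh := conf_conn.
Notation gh := conf_metric.
Notation gih := conf_ginv.
Let U := raise gi Y.
Let YY a b := nab1 D G Y a b.
Let q2 := ev1 Y U.
(** The tensor by which the Schouten tensor decreases ([sch_conf]); [q2] is the squared length of
    [Y]. *)
Definition conf_hess a b := YY a b - Y a * Y b + hf * q2 * g a b.
Notation Th := conf_hess.

Lemma conf_metric_sym a b : gh a b = gh b a.
Proof. by rewrite /gh g_sym. Qed.
Lemma conf_ginv_sym a b : gih a b = gih b a.
Proof. by rewrite /gih gi_sym. Qed.
Lemma conf_ginv_metric a c : \sum_b gih a b * gh b c = (a == c)%:R.
Proof.
rewrite -gi_g; apply: eq_bigr => b _; rewrite /gih /gh.
by rewrite mulrACA (mulrC ei) e_ei mul1r.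
Qed.

Lemma sum_conf_conn a b X :
  \sum_d Gh d a b * X d = \sum_d G d a b * X d + X a * Y b + X b * Y a - g a b * ev1 X U.
Proof.
rewrite -(sum_delta_l a X) -(sum_delta_l b X) /ev1 !mulr_suml mulr_sumr.
rewrite -!big_split -sumrB; apply: eq_bigr => d _ /=; rewrite /Gh -/U; ring.
Qed.

Let UgL b : \sum_f U f * g f b = Y b. Proof. exact: raiseK. Qed.
Let UgR b : ev1 (g b) U = Y b.
Proof. by rewrite -UgL; apply: eq_bigr => f _; rewrite g_sym. Qed.
Let UgR' b : ev1 (g^~ b) U = Y b. Proof. exact: UgL. Qed.

Lemma conf_conn_sym c a b : Gh c a b = Gh c b a.
Proof. rewrite /Gh G_sym (g_sym a b); ring. Qed.

Lemma nab2_conf t a b c : nab2 D Gh t a b c = nab2 D G t a b c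
  - (t a c * Y b + 2 * t b c * Y a - g a b * ev1 (t^~ c) U
     + t b a * Y c - g a c * ev1 (t b) U).
Proof.
rewrite /nab2 /cov2 !big_split /= /conn.
rewrite (sum_conf_conn a b (t^~ c)) (sum_conf_conn a c (t b)); ring.
Qed.

Lemma conf_levi_civita : levi_civita D gh Gh.
Proof.
split=> [c a b|a b c]; first exact: conf_conn_sym.
rewrite nab2_conf.
have -> : nab2 D G gh a b c = 2 * Y a * e * g b c.
  rewrite /nab2 /cov2 derM De (der_metric (par a)) mulr_sumr.
  rewrite [X in _ + X - _ = _](_ : _ = \sum_e0
    (conn G a e0 b * gh e0 c + conn G a e0 c * gh b e0)); first ring.
  by apply: eq_bigr => f _; rewrite /gh; ring.
rewrite !ev1Z UgR UgR' /gh (g_sym b a); ring.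
Qed.

Lemma hess_sym a b : YY a b = YY b a.
Proof.
rewrite /YY /nab1 /cov1 DY; congr (_ - _); apply: eq_bigr => d _.
by rewrite /conn G_sym.
Qed.
Lemma conf_hess_sym a b : Th a b = Th b a.
Proof. rewrite /Th hess_sym (g_sym a b); ring. Qed.

Let V b := raise gi (YY b).
Let DU b d : D b (U d) = V b d - \sum_x G d b x * U x.
Proof.
have := covv_raise g_sym gi_sym gi_g (par b) Y d.
by rewrite /covv -/U /V => <-; rewrite addrK.
Qed.

Let DYE b c : D b (Y c) = YY b c + \sum_x G x b c * Y x.
Proof. by rewrite /YY /nab1 /cov1 subrK. Qed.

(** [conf_hess] with its second index raised. *)
Let ThU b d := V b d - Y b * U d + hf * q2 * (d == b)%:R.

Let sumUG d b : \sum_x U x * Gh d b x = \sum_x G d b x * U x + (d == b)%:R * q2.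
Proof.
transitivity (\sum_x G d b x * U x + (d == b)%:R * q2
    + \sum_x (d == x)%:R * (U x * Y b) - ev1 (g b) U * U d).
  rewrite /q2 /ev1 mulr_sumr mulr_suml -!big_split -sumrB; apply: eq_bigr => x _ /=.
  rewrite /Gh -/U; ring.
by rewrite (sum_delta_r d (fun x => U x * Y b)) UgR; ring.
Qed.

Let sumGG a b c d : \sum_x G x a c * Gh d b x = \sum_x G x a c * G d b x
  + (d == b)%:R * (\sum_x G x a c * Y x) + G d a c * Y b
  - U d * \sum_x G x a c * g b x.
Proof.
transitivity (\sum_x G x a c * G d b x + (d == b)%:R * (\sum_x G x a c * Y x)
   + \sum_x (d == x)%:R * (G x a c * Y b) - U d * \sum_x G x a c * g b x).
  rewrite !mulr_sumr -!big_split -sumrB; apply: eq_bigr => x _ /=.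
  rewrite /Gh -/U; ring.
by rewrite (sum_delta_r d (fun x => G x a c * Y b)).
Qed.

Let DG a b c d : D b (Gh d a c) = D b (G d a c)
  + (d == a)%:R * (YY b c + \sum_x G x b c * Y x)
  + (d == c)%:R * (YY b a + \sum_x G x b a * Y x)
  - (\sum_x G x b a * g x c + \sum_x G x b c * g a x) * U d
  - g a c * (V b d - \sum_x G d b x * U x).
Proof.
rewrite /Gh -/U derB !derD !derM !der_nat !DYE DU (der_metric (par b)) big_split /= /conn.
ring.
Qed.

(** The change of curvature is a Kulkarni-Nomizu product of [g] and [Th]: the first derivatives of
    [Y] come from differentiating the new symbols, the quadratic terms from their products. *)
Lemma rup_conf a b c d : rup D Gh a b c d = rup D G a b c d
  - (Th a c * (d == b)%:R - Th b c * (d == a)%:R + g a c * ThU b d - g b c * ThU a d).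
Proof.
have E : forall a b c d, \sum_x Gh x a c * Gh d b x =
    \sum_x G x a c * G d b x + (d == b)%:R * (\sum_x G x a c * Y x) + G d a c * Y b
    - U d * \sum_x G x a c * g b x
    + Gh d b a * Y c + Gh d b c * Y a
    - g a c * (\sum_x G d b x * U x + (d == b)%:R * q2).
  move=> {a b c d} a b c d; rewrite (sum_conf_conn a c (Gh d b)) sumGG.
  by rewrite -sumUG /ev1; ring.
rewrite {1}/rup !E !DG /rup (hess_sym b a).
have S1 : \sum_x G x b a * Y x = \sum_x G x a b * Y x.
  by apply: eq_bigr => x _; rewrite G_sym.
have S2 x y z : \sum_i G i x y * g z i = \sum_i G i x y * g i z.
  by apply: eq_bigr => i _; rewrite (g_sym z).
have S3 z : \sum_i G i b a * g i z = \sum_i G i a b * g i z.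
  by apply: eq_bigr => i _; rewrite G_sym.
rewrite S1 !S2 !S3 /Gh /ThU /Th -/U (g_sym b a) (G_sym d b a).
(* The quadratic terms contain a whole [q2], each [Th] only one half of it; with the half named [h],
   the identity is polynomial. *)
have hq : q2 = hf * q2 + hf * q2 by rewrite -{1}(mul1r q2) -hf2; ring.
by move: hq; set h := hf * q2; clearbody h; move=> ->; ring.
Qed.

Variables (c1 c2 : A).
Hypothesis DC : forall a b x, D a (D b x) = D b (D a x).
Hypothesis c1E : c1 * (2 * (m%:R - 1)) = 1.
Hypothesis c2E : c2 * (m%:R - 2) = 1.
Notation R := (rlow D G g).
Notation P := (sch D c1 c2 g gi G).
Notation J := (schtr D c1 gi G).
Notation W := (weylA D c1 c2 g gi G).
Notation C := (cott D c1 c2 g gi G).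

Lemma rlow_conf a b c d : rlow D Gh gh a b c d = e * (R a b c d
  - (Th a c * g b d - Th b c * g a d + g a c * Th b d - g b c * Th a d)).
Proof.
have ThUg x : \sum_f ThU x f * g f d = Th x d.
  rewrite /ThU; transitivity (\sum_f V x f * g f d - Y x * (\sum_f U f * g f d)
     + hf * q2 * (\sum_f (f == x)%:R * g f d)).
    by rewrite !mulr_sumr -sumrB -big_split; apply: eq_bigr => f _ /=; ring.
  by rewrite UgL (sum_delta_l x (g^~ d)) (raiseK gi_sym gi_g (YY x)).
transitivity (e * (R a b c d - (Th a c * (\sum_f (f == b)%:R * g f d)
   - Th b c * (\sum_f (f == a)%:R * g f d) + g a c * (\sum_f ThU b f * g f d)
   - g b c * (\sum_f ThU a f * g f d)))).
  rewrite /rlow !mulr_sumr -!(sumrB, big_split) /= mulr_sumr; apply: eq_bigr => f _.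
  rewrite rup_conf /gh; ring.
by rewrite !ThUg (sum_delta_l b (g^~ d)) (sum_delta_l a (g^~ d)).
Qed.

Let trTh := tr gi Th.

Let tr_kulkarni (T : 'I_m -> 'I_m -> A) a b :
  tr gi (fun c d => T a b * g c d - T c b * g a d + g a b * T c d - g c b * T a d) =
  (m%:R - 2) * T a b + tr gi T * g a b.
Proof.
rewrite !(trD, trN, trZ) (tr_metric g_sym gi_g).
rewrite (eq_tr _ (fun c d => mulrC (T c b) _)) (tr_gr' g_sym gi_sym gi_g a (T^~ b)).
rewrite (tr_gl gi_sym gi_g b (T a)); ring.
Qed.

Lemma ric_conf a b : ric D Gh a b = ric D G a b - ((m%:R - 2) * Th a b + trTh * g a b).
Proof.
rewrite (ric_tr D Gh conf_metric_sym conf_ginv_sym conf_ginv_metric).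
rewrite (ric_tr D G g_sym gi_sym gi_g).
rewrite (eq_tr _ (fun c d => rlow_conf a c b d)) trZ /gih trZg mulrA e_ei mul1r.
by rewrite trB tr_kulkarni.
Qed.

Lemma schtr_conf : schtr D c1 gih Gh = ei * (J - trTh).
Proof.
rewrite /schtr /gih trZg (eq_tr _ ric_conf) trB trD !trZ (tr_metric g_sym gi_g).
transitivity (ei * (tr gi (ric D G) * c1 - trTh * (c1 * (2 * (m%:R - 1))))).
  by rewrite -/trTh; ring.
by rewrite c1E mulr1.
Qed.

(** The change (m - 2) Th + (tr Th) g of the Ricci tensor has the shape of [ricE], so the
    normalisation of the Schouten tensor leaves [Th] alone. *)
Lemma sch_conf a b : sch D c1 c2 gh gih Gh a b = P a b - Th a b.
Proof.
rewrite /sch ric_conf schtr_conf /gh.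
transitivity ((ric D G a b - J * g a b) * c2 - Th a b * (c2 * (m%:R - 2))
   + (e * ei - 1) * (trTh - J) * g a b * c2); first by ring.
by rewrite e_ei c2E; ring.
Qed.

Lemma weyl_conf a b c d : weylA D c1 c2 gh gih Gh a b c d = e * W a b c d.
Proof. rewrite /weylA rlow_conf !sch_conf /gh; ring. Qed.

Let q_ a := ev1 (YY a) U.
Let Dq2 a : D a q2 = 2 * q_ a.
Proof.
rewrite /q2 (der_ev1 (D a) (conn G a)) -/(nab1 D G Y a).
rewrite (eq_ev1 (fun=> erefl) (covv_raise g_sym gi_sym gi_g (par a) Y)).
rewrite (ev1_raiseC gi_sym) -/U /q_ /YY /nab1; ring.
Qed.

Let UTh b : ev1 (Th b) U = q_ b - hf * q2 * Y b.
Proof.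
have E (x y z : 'I_m -> A) c d :
    ev1 (fun f => x f - c * y f + d * z f) U = ev1 x U - c * ev1 y U + d * ev1 z U.
  by rewrite !(ev1D, ev1N, ev1Z).
rewrite [LHS](E (YY b) Y (g b) (Y b) (hf * q2)) UgR -/q2 -/(q_ b).
have hq : q2 = hf * q2 + hf * q2 by rewrite -{1}(mul1r q2) -hf2; ring.
by move: hq; set h := hf * q2; clearbody h; move=> ->; ring.
Qed.

Let nab2_Th a b c : nab2 D G Th a b c = nab2 D G YY a b c
  - (YY a b * Y c + Y b * YY a c) + q_ a * g b c.
Proof.
have E : D a (Th b c) = D a (YY b c) - (D a (Y b) * Y c + Y b * D a (Y c))
   + q_ a * g b c + hf * q2 * D a (g b c).
  have Dh : D a (hf * q2) = q_ a.
    by rewrite derM (der_cst _ hf2) Dq2 mul0r add0r mulrA hf2 mul1r.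
  by rewrite /Th derD derB (derM _ (Y b)) (derM _ (hf * q2)) Dh; ring.
rewrite /nab2 /cov2 E !DYE (der_metric (par a)) /Th.
transitivity (D a (YY b c) - ((YY a b + \sum_x G x a b * Y x) * Y c +
  Y b * (YY a c + \sum_x G x a c * Y x)) + q_ a * g b c +
  hf * q2 * (\sum_x (conn G a x b * g x c + conn G a x c * g b x)) -
  (\sum_x (conn G a x b * YY x c + conn G a x c * YY b x)
   - ((\sum_x G x a b * Y x) * Y c + Y b * (\sum_x G x a c * Y x))
   + hf * q2 * (\sum_x (conn G a x b * g x c + conn G a x c * g b x)))).
  congr (_ - _); rewrite mulr_suml !mulr_sumr -!big_split -sumrB -big_split.
  by apply: eq_bigr => x _ /=; rewrite /conn; ring.
ring.
Qed.

(** The antisymmetrised third derivatives of Upsilon become curvature by the Ricci identity; the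
    Schouten terms produced by the change of connection complete it to the Weyl tensor. *)
Lemma cott_conf a b c :
  cott D c1 c2 gh gih Gh a b c = C a b c - ev1 (W a b c) U.
Proof.
have Psym := sch_sym c1 c2 DC hf2 g_sym gi_sym gi_g LC.
have N2 x y z : nab2 D G (sch D c1 c2 gh gih Gh) x y z =
    nab2 D G P x y z - nab2 D G Th x y z.
  by rewrite /nab2 (eq_cov2 _ _ _ _ sch_conf) cov2B.
rewrite /cott !nab2_conf !N2 !nab2_Th !sch_conf.
have E x : ev1 (sch D c1 c2 gh gih Gh x) U = ev1 (P x) U - (q_ x - hf * q2 * Y x).
  by rewrite -UTh -ev1N -ev1D; apply: eq_ev1 => // y; rewrite sch_conf.
have E' x : ev1 ((sch D c1 c2 gh gih Gh)^~ x) U = ev1 (P x) U - (q_ x - hf * q2 * Y x).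
  by rewrite -E; apply: eq_ev1 => // y; rewrite !sch_conf Psym conf_hess_sym.
rewrite !E !E'.
have RI := ricci_identity DC G_sym Y a b c.
have -> : ev1 (W a b c) U = \sum_d rup D G a b c d * Y d
   - P a c * Y b - ev1 (P b) U * g a c + ev1 (P a) U * g b c + P b c * Y a.
  rewrite -(UgR b) -(UgR a) ![_ * g _ c]mulrC -!ev1Z.
  have -> : \sum_d rup D G a b c d * Y d = ev1 (R a b c) U.
    by rewrite /rlow ev1_sum; apply: eq_bigr => f _; rewrite ev1Z UgR.
  rewrite -!ev1N -!ev1D; apply: eq_ev1 => // d; rewrite /weylA; ring.
rewrite -RI -/YY (hess_sym b a) (conf_hess_sym b a) (Psym b a) (g_sym b a) /Th.
ring.
Qed.

Lemma nab3_conf t d c a b : nab3 D Gh t d c a b = nab3 D G t d c a b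
  - (t d a b * Y c + 3 * t c a b * Y d - g d c * ev1 (fun x => t x a b) U
     + t c d b * Y a - g d a * ev1 (fun x => t c x b) U
     + t c a d * Y b - g d b * ev1 (t c a) U).
Proof.
rewrite /nab3 /cov3 !big_split /= /conn.
rewrite (sum_conf_conn d c (fun x => t x a b)) (sum_conf_conn d a (fun x => t c x b)).
rewrite (sum_conf_conn d b (t c a)); ring.
Qed.

(** The factor m - 4 is m, the trace of [g], less 1 + 3 from the two terms in which [Y] carries a
    contracted index. *)
Lemma tr_nab3_conf t a b :
  (forall a b c, t b a c = - t a b c) -> (forall b, tr gi (fun c d => t c b d) = 0) ->
  tr gi (fun c d => nab3 D Gh t d c a b) = tr gi (fun c d => nab3 D G t d c a b)
  + (m%:R - 4) * ev1 (fun x => t x a b) U + ev1 (fun x => t a x b) U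
  + ev1 (t b a) U.
Proof.
move=> t12 t13; rewrite (eq_tr _ (fun c d => nab3_conf t d c a b)).
have trU (x : 'I_m -> A) : tr gi (fun c d => x c * Y d) = ev1 x U.
  by rewrite (tr_tens gi_sym) (ev1_raiseC gi_sym) ev1C ev1C.
have trU' (x : 'I_m -> A) : tr gi (fun c d => x d * Y c) = ev1 x U.
  by rewrite (tr_sym gi_sym) trU.
have E1 : tr gi (fun c d => t c d b) = 0.
  apply/eqP; rewrite -[X in X == _]mul1r -hf2 -mulrA mulr2n mulrDl mul1r.
  by rewrite {1}(tr_anti gi_sym) ?addNr ?mulr0.
have L (f1 f2 f3 f4 f5 f6 f7 : 'I_m -> 'I_m -> A) :
    tr gi (fun c d => f1 c d + f2 c d - f3 c d + f4 c d - f5 c d + f6 c d - f7 c d) =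
    tr gi f1 + tr gi f2 - tr gi f3 + tr gi f4 - tr gi f5 + tr gi f6 - tr gi f7.
  by rewrite !(trD, trN).
rewrite trB L (trU' (fun x => t x a b)) (eq_tr _ (fun c d => esym (mulrA 3 _ _))) trZ.
rewrite (trU (fun x => t x a b)) !trZr E1 t13.
rewrite (tr_gr gi_sym gi_g a (fun c => ev1 (fun x => t c x b) U)).
rewrite (tr_gr gi_sym gi_g b (fun c => ev1 (t c a) U)).
rewrite (eq_tr _ (fun c d => g_sym d c)) (tr_metric g_sym gi_g); ring.
Qed.

Let cov_W_U d c a b : nab3 D G (fun c a b => ev1 (W c a b) U) d c a b =
  ev1 (nab4 D G W d c a b) U + ev1 (W c a b) (V d).
Proof.
rewrite /nab3 cov3_ev1; congr (_ + _); apply: eq_ev1 => // x.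
exact: (covv_raise g_sym gi_sym gi_g (par d)).
Qed.

(** The contraction of W with the derivative of U occurs in the divergence of the new Cotton tensor
    and, with opposite sign, in the change of the Schouten tensor. What is left is governed by
    [div_weyl] and carries the factor m - 4. *)
Lemma bach_conf a b : bachA D c1 c2 gh gih Gh a b =
  ei * (bachA D c1 c2 g gi G a b
   + (m%:R - 4) * (ev1 (fun x => C x a b) U + ev1 (fun x => C x b a) U)
   + (m%:R - 4) * ev2 (fun c d => W a c b d) U U).
Proof.
have W12 x y z t : W y x z t = - W x y z t by exact: weyl12.
have W34 x y z t : W x y t z = - W x y z t by exact: (weyl34 c1 c2 DC gi g_sym LC).
have Wpair x y z t : W z t x y = W x y z t.
  exact: (weyl_pair c1 c2 DC hf2 g_sym gi_sym gi_g LC).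
have Wtr x y : tr gi (fun c d => W x c y d) = 0.
  exact: (weyl_trace D c1E c2E G g_sym gi_sym gi_g).
have C12 x y z : C y x z = - C x y z by exact: cott12.
have Ctr x : tr gi (fun c d => C c x d) = 0.
  exact: (cott_trace DC hf2 c1E c2E g_sym gi_sym gi_g LC).
have Cc := cott_cyc c1 c2 DC hf2 g_sym gi_sym gi_g LC.
have dW := div_weyl DC hf2 c1E c2E g_sym gi_sym gi_g LC.
have trE (t : 'I_m -> 'I_m -> A) : tr gih t = ei * tr gi t by exact: trZg.
rewrite /bachA !trE mulrDr.
have N3 c d : nab3 D Gh (cott D c1 c2 gh gih Gh) d c a b =
    nab3 D Gh (fun x y z => C x y z - ev1 (W x y z) U) d c a b.
  exact: eq_cov3 cott_conf.
have W12U x y z (u : 'I_m -> A) : ev1 (W y x z) u = - ev1 (W x y z) u.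
  by rewrite -ev1N; apply: eq_ev1.
rewrite (eq_tr _ N3) tr_nab3_conf; first last.
- move=> x; rewrite trB Ctr /ev1 tr_sum big1 ?subrr // => y _.
  rewrite trZ (_ : tr gi _ = 0) ?mulr0 // -(Wtr x y).
  by apply: eq_tr => c d; rewrite W12 W34 opprK.
- by move=> x y z; rewrite C12 W12U; ring.
have -> : tr gi (fun c d => nab3 D G (fun x y z => C x y z - ev1 (W x y z) U) d c a b) =
  tr gi (fun c d => nab3 D G C d c a b) - (m%:R - 3) * ev1 (fun x => C b x a) U
  - tr gi (fun c d => ev1 (W c a b) (V d)).
  rewrite (eq_tr _ (fun c d => cov3B _ _ _ _ _ _ _)) trB (eq_tr _ (fun c d => cov_W_U d c a b)).
  rewrite (trD _ (fun c d => ev1 (nab4 D G W d c a b) U)) opprD addrA.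
  congr (_ - _ - _); rewrite -ev1Z /ev1 tr_sum; apply: eq_bigr => x _.
  rewrite trZ; congr (_ * _); rewrite (tr_sym gi_sym).
  rewrite -[RHS]opprK -mulNr -[- (_ - _) * _]dW -trN; apply: eq_tr => c d.
  rewrite /nab4 -cov4N -(cov4_swap_pairs (D c) (conn G c) (fun a b c d => - W a b c d)).
  rewrite -(cov4_swap12 (D c) (conn G c) (fun a b c d => - W c d a b)).
  by apply: eq_cov4 => x1 x2 x3 x4; rewrite Wpair W34.
have Ph : tr gi (fun c f => tr gih (fun d f0 => weylA D c1 c2 gh gih Gh a c b d *
      sch D c1 c2 gh gih Gh f f0)) =
    tr gi (fun c f => tr gi (fun d f0 => W a c b d * P f f0))
    + tr gi (fun c d => ev1 (W c a b) (V d)) + ev2 (fun c d => W a c b d) U U.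
  transitivity (tr gi (fun c f => tr gi (fun d h => W a c b d * P f h))
    - tr gi (fun c f => tr gi (fun d h => W a c b d * YY f h))
    + tr gi (fun c f => tr gi (fun d h => (W a c b d * Y h)) * Y f)
    - hf * q2 * tr gi (fun c f => tr gi (fun d h => g f h * W a c b d))).
    rewrite -trZ -trN -!trD -trN -trD; apply: eq_tr => c f.
    rewrite trE -[in RHS]trZ -trZr -!trN -!trD -trZ; apply: eq_tr => d h.
    rewrite weyl_conf sch_conf /Th.
    transitivity ((e * ei) * (W a c b d * (P f h - (YY f h - Y f * Y h + hf * q2 * g f h)))).
      by ring.
    by rewrite e_ei mul1r; ring.
  have -> : tr gi (fun c f => tr gi (fun d h => g f h * W a c b d)) = 0.
    rewrite -(Wtr a b); apply: eq_tr => c f; exact: (tr_gr' g_sym gi_sym gi_g f (W a c b)).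
  rewrite mulr0 subr0; congr (_ + _ + _).
    rewrite -trN; apply: eq_tr => c f; rewrite W12U; congr (- _).
    by rewrite (tr_tens gi_sym) (ev1_raiseC gi_sym).
  rewrite (tr_tens gi_sym) (ev1_raiseC gi_sym); apply: eq_ev1 => // c.
  by rewrite (tr_tens gi_sym) (ev1_raiseC gi_sym).
rewrite Ph.
have EB (s t : 'I_m -> A) u : ev1 (fun x => s x - t x) u = ev1 s u - ev1 t u.
  by rewrite ev1D ev1N.
rewrite (EB (fun x => C x a b) (fun x => ev1 (W x a b) U)).
rewrite (EB (fun x => C a x b) (fun x => ev1 (W a x b) U)).
rewrite (EB (C b a) (fun x => ev1 (W b a x) U)).
have -> : ev1 (fun x => ev1 (W x a b) U) U = - ev2 (fun c d => W a c b d) U U.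
  by rewrite /ev2 -ev1N; apply: eq_ev1 => // x; rewrite W12U.
have -> : ev1 (fun x => ev1 (W b a x) U) U = 0.
  rewrite -/(ev2 (W b a) U U).
  have E : ev2 (W b a) U U = - ev2 (W b a) U U.
    by rewrite {1}ev2_swap -ev2N; apply: eq_ev2 => x y; rewrite W34.
  by rewrite -[LHS]mul1r -hf2 -mulrA mulr2n mulrDl mul1r {1}E addNr mulr0.
have -> : ev1 (fun x => C b x a) U = - ev1 (fun x => C x b a) U.
  by rewrite -ev1N; apply: eq_ev1.
(* The cyclic identity removes the Cotton term with [U] in the last place; the others then add up to
   m - 4 times an expression symmetric in [a] and [b]. *)
have -> : ev1 (C b a) U = - ev1 (fun x => C a x b) U - ev1 (fun x => C x b a) U.
  rewrite -!ev1N -ev1D; apply: eq_ev1 => // x.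
  by apply/eqP; rewrite -subr_eq0 -(Cc a x b); apply/eqP; ring.
rewrite /ev2; ring.
Qed.

End Conformal.

(** * Geometry along an immersion *)

(* The ambient tensors, restricted to the submanifold, and the inverse of the
   induced metric. *)
Record pulled (B : Type) (k n : nat) := Pulled {
  pg : 'I_n -> 'I_n -> B;
  pgi : 'I_n -> 'I_n -> B;
  pG : 'I_n -> 'I_n -> 'I_n -> B;
  pP : 'I_n -> 'I_n -> B;
  pC : 'I_n -> 'I_n -> 'I_n -> B;
  pW : 'I_n -> 'I_n -> 'I_n -> 'I_n -> B;
  pB : 'I_n -> 'I_n -> B;
  pgbi : 'I_k -> 'I_k -> B }.

(* [hf], [kinv] and [n4] stand for 1/2, 1/k and n - 4, and [T al] for the tangent
   vector d_al F. *)
Section Definitions.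
Context {B : comPzRingType} {k n : nat} (D : 'I_k -> derivation B).
Context (T : 'I_k -> 'I_n -> B) (hf kinv n4 : B) (s : pulled B k n).
Implicit Types (al be ga de : 'I_k) (u v w z : 'I_n -> B).

(** The connection matrix of the pulled-back tangent bundle, so that [snab] applies to vector fields
    defined only along Y. *)
Definition pconn al a c := \sum_b pG s a b c * T al b.
Definition sgbar al be := ev2 (pg s) (T al) (T be).
Definition stang v ga := \sum_de pgbi s ga de * ev2 (pg s) v (T de).
Definition snormal v a := v a - \sum_ga stang v ga * T ga a.
Definition snab al (V : 'I_n -> B) := covv (D al) (pconn al) V.
Definition sconn ga al be := stang (snab al (T be)) ga.
Definition ssff al be := snormal (snab al (T be)).
Definition smean a := kinv * tr (pgbi s) (fun al be => ssff al be a).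
Definition ssff0 al be a := ssff al be a - sgbar al be * smean a.
Definition sD al a :=
  snormal (fun a => \sum_b pgi s a b * \sum_c pP s c b * T al c) a
  - snormal (snab al smean) a.
Definition scalP al be := ev2 (pP s) (T al) (T be)
  + ev2 (pg s) smean (ssff0 al be) + hf * ev2 (pg s) smean smean * sgbar al be.
Definition scalC u v w := ev3 (pC s) u v w - ev4 (pW s) u v w smean.
Definition scalC_tr al := tr (pgbi s) (fun be ga => scalC (T be) (T al) (T ga)).
Definition scalB al be := ev2 (pB s) (T al) (T be)
  + 2 * n4 * (hf * (ev3 (pC s) smean (T al) (T be) + ev3 (pC s) smean (T be) (T al)))
  + n4 * ev4 (pW s) (T al) smean (T be) smean.
Definition sW1 al be :=
  tr (pgbi s) (fun ga de => ev4 (pW s) (T al) (T ga) (T be) (T de)).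
Definition sW2 := tr (pgbi s) sW1.
Definition sPW := tr (pgbi s) (fun al ga => tr (pgbi s) (fun be de =>
  scalP ga de * sW1 al be)).
Definition sDW := tr (pgbi s) (fun al ga => tr (pgbi s) (fun be de =>
  ev4 (pW s) (T al) (T be) (sD ga) (T de))).
Definition sLC := tr (pgbi s) (fun al ga => tr (pgbi s) (fun be de =>
  scalC (T al) (ssff0 ga de) (T be))).
Definition sdiv (t : 'I_k -> B) := tr (pgbi s) (nab1 D sconn t).
Definition sbracket (n4i : B) := sdiv scalC_tr - sPW + sDW + sLC
  + (k%:R - 3) * n4i * tr (pgbi s) scalB.
Definition sJ (n4i : B) := - sdiv (fun al => D al sW2)
  + 2 * sW2 * tr (pgbi s) scalP - 2 * (k%:R - 6) * sbracket n4i.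

End Definitions.

(** * The Gauss formula and the induced connection *)

Section BaseFacts.
Context {B : comPzRingType} {k n : nat} (D : 'I_k -> derivation B).
Variables (T : 'I_k -> 'I_n -> B) (hf kinv : B) (s : pulled B k n).
Hypothesis hf2 : hf * 2 = 1.
Hypothesis kinvE : kinv * k%:R = 1.
Hypothesis g_sym : forall a b, pg s a b = pg s b a.
Hypothesis gbi_sym : forall a b, pgbi s a b = pgbi s b a.
Hypothesis gbi_gbar : forall a c, \sum_b pgbi s a b * sgbar T s b c = (a == c)%:R.
Hypothesis par : forall al b c, cov2 (D al) (pconn T s al) (pg s) b c = 0.
Hypothesis torsion : forall al be a, snab D T s al (T be) a = snab D T s be (T al) a.
Implicit Types (al be ga de : 'I_k) (u v w z : 'I_n -> B).

Notation gY := (ev2 (pg s)).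
Notation gbar := (sgbar T s).
Notation gbi := (pgbi s).
Notation tang := (stang T s).
Notation norm := (snormal T s).
Notation nab := (snab D T s).
Notation cn := (sconn D T s).
Notation sff := (ssff D T s).
Notation H := (smean D T kinv s).
Notation sff0 := (ssff0 D T kinv s).

Lemma gY_sym u v : gY u v = gY v u.
Proof. by rewrite ev2_swap; apply: eq_ev2 => a b; rewrite g_sym. Qed.
Lemma gbar_sym al be : gbar al be = gbar be al. Proof. exact: gY_sym. Qed.

Lemma tang_lf ga : linear_form (fun v => tang v ga).
Proof.
exists (fun a => \sum_de gbi ga de * ev1 (pg s a) (T de)) => v.
by rewrite ev1_sum; apply: eq_bigr => de _; rewrite ev1Z.
Qed.

Lemma tang_T al ga : tang (T al) ga = (ga == al)%:R.
Proof.
by rewrite /stang -gbi_gbar; apply: eq_bigr => e _; rewrite gY_sym.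
Qed.

Lemma tang_g v al : \sum_ga tang v ga * gbar ga al = gY v (T al).
Proof.
exact: (raiseK gbi_sym gbi_gbar (fun de => gY v (T de))).
Qed.

Lemma norm_lf a : linear_form (fun v => norm v a).
Proof.
apply: lf_add; first by exists (basis_vec a) => v; rewrite ev1C ev1_basis.
apply: lf_opp; exists (fun b => \sum_ga (\sum_de gbi ga de * ev1 (pg s b) (T de)) * T ga a).
move=> v; rewrite ev1_sum; apply: eq_bigr => ga _; rewrite mulrC.
have [t E] := tang_lf ga; rewrite -[RHS]/(ev1 _ _).
rewrite (_ : ev1 _ _ = T ga a * ev1 (fun b => \sum_de gbi ga de * ev1 (pg s b) (T de)) v); last first.
  by rewrite -ev1Z; apply: eq_ev1 => // b; rewrite mulrC.
by congr (_ * _); rewrite ev1_sum; apply: eq_bigr => de _; rewrite ev1Z.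
Qed.

Lemma normE v a : v a = \sum_ga tang v ga * T ga a + norm v a.
Proof. by rewrite /snormal addrC subrK. Qed.

Lemma norm_orth v al : gY (norm v) (T al) = 0.
Proof.
rewrite /snormal (lfB _ _ (lf2_1 (pg s) (T al))) -tang_g.
by rewrite (lf_sum _ _ (lf2_1 (pg s) (T al))) subrr.
Qed.

Lemma tang_norm v ga : tang (norm v) ga = 0.
Proof. by rewrite /stang big1 // => de _; rewrite norm_orth mulr0. Qed.

Lemma norm_norm v a : norm (norm v) a = norm v a.
Proof.
by rewrite {1}/snormal big1 ?subr0 // => ga _; rewrite tang_norm mul0r.
Qed.

Lemma norm_T al a : norm (T al) a = 0.
Proof.
rewrite /snormal (eq_bigr (fun ga => (ga == al)%:R * T ga a)).
  by rewrite (sum_delta_l al (T^~ a)) subrr.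
by move=> ga _; rewrite tang_T.
Qed.

Lemma norm_eq u v a : u =1 v -> norm u a = norm v a.
Proof. exact: lf_eq (norm_lf a). Qed.
Lemma tang_eq u v ga : u =1 v -> tang u ga = tang v ga.
Proof. exact: lf_eq (tang_lf ga). Qed.

Lemma gauss al be a :
  nab al (T be) a = \sum_ga cn ga al be * T ga a + sff al be a.
Proof. exact: normE. Qed.

Lemma cn_sym ga al be : cn ga al be = cn ga be al.
Proof. by apply: tang_eq => a; apply: torsion. Qed.
Lemma sff_sym al be a : sff al be a = sff be al a.
Proof. by apply: norm_eq => b; apply: torsion. Qed.

(** The normal part of the derivative of a tangent vector is orthogonal to the tangent vectors, so
    the product rule for [gbar] sees only the coefficients [cn]. *)
Lemma sgbar_levi_civita : levi_civita D gbar cn.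
Proof.
split=> [*|al be ga]; first exact: cn_sym.
apply/eqP; rewrite subr_eq0; apply/eqP; rewrite /sgbar (der_ev2 _ (pconn T s al)).
have -> : ev2 (cov2 (D al) (pconn T s al) (pg s)) (T be) (T ga) = 0.
  rewrite /ev2 /ev1 big1 // => a _; rewrite big1 ?mulr0 // => b _.
  by rewrite par mulr0.
rewrite add0r big_split /=.
have E x y : ev2 (pg s) (covv (D al) (pconn T s al) (T x)) (T y) =
   \sum_i cn i al x * gY (T i) (T y).
  rewrite (lf_eq (lf2_1 (pg s) (T y)) (gauss al x)) (lfD _ _ (lf2_1 _ _)).
  by rewrite norm_orth addr0 (lf_sum _ _ (lf2_1 _ _)).
rewrite E gY_sym E; congr (_ + _); apply: eq_bigr => i _.
by rewrite gY_sym.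
Qed.

Lemma mean_trace a : tr gbi (fun al be => sff al be a) = k%:R * H a.
Proof. by rewrite /smean mulrA (mulrC _ kinv) kinvE mul1r. Qed.

Lemma norm_mean a : norm H a = H a.
Proof.
rewrite /smean (lfZ _ _ (norm_lf a)); congr (_ * _).
rewrite /tr (lf_eq (norm_lf a) (v := fun b => \sum_al 1 * \sum_be gbi al be * sff al be b)); last first.
  by move=> b; apply: eq_bigr => al _; rewrite mul1r.
rewrite (lf_sum _ _ (norm_lf a)); apply: eq_bigr => al _; rewrite mul1r.
rewrite (lf_sum _ _ (norm_lf a)); apply: eq_bigr => be _.
by rewrite norm_norm.
Qed.

Lemma mean_orth al : gY H (T al) = 0.
Proof.
by rewrite -(lf_eq (lf2_1 _ _) norm_mean) norm_orth.
Qed.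

Lemma norm_sff0 al be a : norm (sff0 al be) a = sff0 al be a.
Proof.
rewrite /ssff0 (lfB _ _ (norm_lf a)) norm_norm (lfZ _ _ (norm_lf a)).
by rewrite norm_mean.
Qed.
Lemma sff0_orth al be ga : gY (sff0 al be) (T ga) = 0.
Proof. by rewrite -(lf_eq (lf2_1 _ _) (norm_sff0 al be)) norm_orth. Qed.
Lemma sff0_sym al be a : sff0 al be a = sff0 be al a.
Proof. by rewrite /ssff0 sff_sym gbar_sym. Qed.
Lemma sffE al be a : sff al be a = sff0 al be a + gbar al be * H a.
Proof. by rewrite /ssff0 subrK. Qed.

(** The restriction of the ambient covariant derivative of the Weyl tensor, the index of the
    derivative first; [cov_W] relates it to differentiation along Y. *)
Variable Z : 'I_n -> 'I_n -> 'I_n -> 'I_n -> 'I_n -> B.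
Notation W := (pW s).
Notation C := (pC s).
Hypothesis W12 : forall a b c d, W b a c d = - W a b c d.
Hypothesis W34 : forall a b c d, W a b d c = - W a b c d.
Hypothesis Wpair : forall a b c d, W c d a b = W a b c d.
Hypothesis C12 : forall a b c, C b a c = - C a b c.
Hypothesis Z12 : forall e a b c d, Z e b a c d = - Z e a b c d.
Hypothesis Z34 : forall e a b c d, Z e a b d c = - Z e a b c d.
Hypothesis Zpair : forall e a b c d, Z e c d a b = Z e a b c d.
Hypothesis bianchi : forall e a b c d,
  Z e a b c d + Z a b e c d + Z b e a c d =
  - (C e a c * pg s b d + C b e c * pg s a d + C a b c * pg s e d
     - C e a d * pg s b c - C b e d * pg s a c - C a b d * pg s e c).
Hypothesis cov_W : forall al a b c d,
  cov4 (D al) (pconn T s al) W a b c d = \sum_e T al e * Z e a b c d.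

Let w12 u v x z : ev4 W v u x z = - ev4 W u v x z.
Proof. exact: ev4_anti12. Qed.
Let w34 u v x z : ev4 W u v z x = - ev4 W u v x z.
Proof. exact: ev4_anti34. Qed.
Let wpair u v x z : ev4 W x z u v = ev4 W u v x z.
Proof. exact: ev4_pair. Qed.

Let Zr e a b c d := ev1 (fun x => ev4 (Z x) (T a) (T b) (T c) (T d)) (T e).
Let Cr a b c := ev3 C (T a) (T b) (T c).

(** On tangent vectors the ambient identity has the form required by [bianchi_contraction2] for the
    induced metric, although [Zr] is not the intrinsic derivative of the restricted tensor;
    [cov_sW4] measures the difference. *)
Let Zr_bianchi e a b c d :
  Zr e a b c d + Zr a b e c d + Zr b e a c d =
  - (Cr e a c * gbar b d + Cr b e c * gbar a d + Cr a b c * gbar e d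
     - Cr e a d * gbar b c - Cr b e d * gbar a c - Cr a b d * gbar e c).
Proof.
rewrite /Zr /Cr /sgbar.
move: (T e) (T a) (T b) (T c) (T d) => u1 u2 u3 u4 u5 {e a b c d}.
move: u1; apply: lf_ext; [lf_auto|lf_auto|] => e.
move: u2; apply: lf_ext; [lf_auto|lf_auto|] => a.
move: u3; apply: lf_ext; [lf_auto|lf_auto|] => b.
move: u4; apply: lf_ext; [lf_auto|lf_auto|] => c.
move: u5; apply: lf_ext; [lf_auto|lf_auto|] => d.
by rewrite /ev4 /ev3 /ev2 !ev1_basis bianchi.
Qed.

Let Zr12 e a b c d : Zr e b a c d = - Zr e a b c d.
Proof. by rewrite /Zr -ev1N; apply: eq_ev1 => // x; exact: ev4_anti12. Qed.
Let Zr34 e a b c d : Zr e a b d c = - Zr e a b c d.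
Proof. by rewrite /Zr -ev1N; apply: eq_ev1 => // x; exact: ev4_anti34. Qed.
Let Zrpair e a b c d : Zr e c d a b = Zr e a b c d.
Proof. by rewrite /Zr; apply: eq_ev1 => // x; exact: ev4_pair. Qed.
Let Cr12 a b c : Cr b a c = - Cr a b c.
Proof.
by rewrite /Cr ev3_swap12 -ev3N; apply: eq_ev3 => x y z; rewrite C12.
Qed.

Definition sW4 a b c d := ev4 W (T a) (T b) (T c) (T d).

(** In each argument the Gauss formula splits the derivative of a tangent vector: the tangential
    part is absorbed by the intrinsic connection, the normal part remains. *)
Lemma cov_sW4 al a b c d : cov4 (D al) (conn cn al) sW4 a b c d = Zr al a b c d
  + ev4 W (sff al a) (T b) (T c) (T d) + ev4 W (T a) (sff al b) (T c) (T d)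
  + ev4 W (T a) (T b) (sff al c) (T d) + ev4 W (T a) (T b) (T c) (sff al d).
Proof.
rewrite /cov4 /sW4 (der_ev4 (D al) (pconn T s al)) !big_split /=.
have -> : ev4 (cov4 (D al) (pconn T s al) W) (T a) (T b) (T c) (T d) = Zr al a b c d.
  rewrite /Zr (eq_ev4 _ _ _ _ (cov_W al)).
  move: (T a) (T b) (T c) (T d) => u2 u3 u4 u5.
  move: u2; apply: lf_ext; [lf_auto|lf_auto|] => a'.
  move: u3; apply: lf_ext; [lf_auto|lf_auto|] => b'.
  move: u4; apply: lf_ext; [lf_auto|lf_auto|] => c'.
  move: u5; apply: lf_ext; [lf_auto|lf_auto|] => d'.
  rewrite /ev4 /ev3 /ev2 !ev1_basis; apply: eq_bigr => e _.
  by rewrite !ev1_basis.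
have E phi x : linear_form phi -> phi (covv (D al) (pconn T s al) (T x)) =
    \sum_i cn i al x * phi (T i) + phi (sff al x).
  by move=> L; rewrite (lf_eq L (gauss al x)) (lfD _ _ L) (lf_sum _ _ L).
rewrite (E _ a (lf4_1 W (T b) (T c) (T d))) (E _ b (lf4_2 W (T a) (T c) (T d))).
rewrite (E _ c (lf4_3 W (T a) (T b) (T d))) (E _ d (lf4_4 W (T a) (T b) (T c))).
rewrite /conn; ring.
Qed.

Let cn_par al b c : cov2 (D al) (conn cn al) gbar b c = 0.
Proof. exact: sgbar_levi_civita.2. Qed.

Notation tr2 t := (tr gbi (fun a b => tr gbi (fun c d => t a b c d))).

Let tr2D (f h : 'I_k -> 'I_k -> 'I_k -> 'I_k -> B) :
  tr2 (fun a b c d => f a b c d + h a b c d) = tr2 f + tr2 h.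
Proof. by rewrite -trD; apply: eq_tr => a b; rewrite trD. Qed.
Let tr2N (f : 'I_k -> 'I_k -> 'I_k -> 'I_k -> B) :
  tr2 (fun a b c d => - f a b c d) = - tr2 f.
Proof. by rewrite -trN; apply: eq_tr => a b; rewrite trN. Qed.
Let eq_tr2 (f h : 'I_k -> 'I_k -> 'I_k -> 'I_k -> B) :
  (forall a b c d, f a b c d = h a b c d) -> tr2 f = tr2 h.
Proof. by move=> e; apply: eq_tr => a b; apply: eq_tr => c d. Qed.
Let tr2_sym12 (f : 'I_k -> 'I_k -> 'I_k -> 'I_k -> B) :
  tr2 f = tr2 (fun a b c d => f b a c d).
Proof. exact: tr_sym. Qed.
Let tr2_sym34 (f : 'I_k -> 'I_k -> 'I_k -> 'I_k -> B) :
  tr2 f = tr2 (fun a b c d => f a b d c).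
Proof. by apply: eq_tr => a b; exact: tr_sym. Qed.
Let tr2_exch (f : 'I_k -> 'I_k -> 'I_k -> 'I_k -> B) :
  tr2 f = tr2 (fun a b c d => f c d a b).
Proof. exact: tr_exch. Qed.

(** Contracted with the dual of [y], [sX1] and [sX2] are the changes of [sDW] and [sLC]. *)
Definition sX1 de := tr2 (fun al ga be ep =>
  ev4 W (T al) (T be) (sff0 ga de) (T ep)).
Definition sX2 de := tr2 (fun al ga be ep =>
  ev4 W (T al) (sff0 ga ep) (T be) (T de)).

(** [bianchi_contraction2] along Y gives the Cotton trace with factor k - 2 and makes one half of
    the differential of [sW2] appear. The mean curvature terms add up to (k - 2) [h], exactly what
    turns the trace of [C] into that of the calligraphic C. *)
Lemma div_sW1 de :
  tr gbi (fun al be => nab2 D cn (sW1 T s) al be de) - hf * D de (sW2 T s) =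
  - (k%:R - 2) * scalC_tr D T kinv s de - sX1 de - sX2 de.
Proof.
have N1 al be : nab2 D cn (sW1 T s) al be de =
    tr gbi (fun ga ep => cov4 (D al) (conn cn al) sW4 be ga de ep).
  exact: (cov2_trace (cn_par al) gbar_sym gbi_sym gbi_gbar sW4).
rewrite (eq_tr _ N1).
have -> : D de (sW2 T s) = tr2 (fun al be ga ep => cov4 (D de) (conn cn de) sW4 al ga be ep).
  rewrite /sW2 (der_tr gbar_sym gbi_sym gbi_gbar (cn_par de)); apply: eq_tr => al be.
  exact: (cov2_trace (cn_par de) gbar_sym gbi_sym gbi_gbar sW4).
have BC := bianchi_contraction2 gbar_sym gbi_sym gbi_gbar Zr12 Zr34 Zrpair Cr12 Zr_bianchi de.
(* [M] is the common value of the four corrections to the differential of [sW2]; [h] is the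
   contraction with the mean curvature vector that splits off from [sff]. *)
pose M := tr2 (fun al be ga ep => ev4 W (T al) (T ga) (sff de be) (T ep)).
pose h := tr gbi (fun ga ep => ev4 W (T de) (T ga) H (T ep)).
have E5 (f0 f1 f2 f3 f4 : 'I_k -> 'I_k -> 'I_k -> 'I_k -> B) :
    tr2 (fun a b c d => f0 a b c d + f1 a b c d + f2 a b c d + f3 a b c d + f4 a b c d) =
    tr2 f0 + tr2 f1 + tr2 f2 + tr2 f3 + tr2 f4 by rewrite !tr2D.
rewrite (eq_tr2 (fun al be ga ep => cov_sW4 al be ga de ep)).
rewrite (eq_tr2 (fun al be ga ep => cov_sW4 de al ga be ep)) !E5.
have M1 : tr2 (fun al be ga ep => ev4 W (sff de al) (T ga) (T be) (T ep)) = M.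
  rewrite tr2_sym12 tr2_sym34; apply: eq_tr2 => al be ga ep.
  exact: wpair.
have M2 : tr2 (fun al be ga ep => ev4 W (T al) (sff de ga) (T be) (T ep)) = M.
  rewrite -M1 tr2_exch; apply: eq_tr2 => al be ga ep.
  by rewrite w12 w34 opprK.
have M4 : tr2 (fun al be ga ep => ev4 W (T al) (T ga) (T be) (sff de ep)) = M.
  rewrite /M tr2_exch; apply: eq_tr2 => al be ga ep.
  by rewrite w12 w34 opprK.
rewrite M1 M2 M4 -/M.
have La : tr2 (fun al be ga ep => ev4 W (sff al be) (T ga) (T de) (T ep)) = k%:R * h.
  rewrite tr_exch (tr_sym gbi_sym) /h -trZ; apply: eq_tr => ga ep.
  have L := lf4_1 W (T ep) (T de) (T ga).
  by rewrite -(lf_tr gbi sff L) (lf_eq L mean_trace) (lfZ _ _ L) -wpair.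
have Lb : tr2 (fun al be ga ep => ev4 W (T be) (sff al ga) (T de) (T ep)) = - sX2 de - h.
  transitivity (tr2 (fun al be ga ep => - ev4 W (T be) (sff0 al ga) (T ep) (T de))
     + tr2 (fun al be ga ep => gbar al ga * ev4 W (T be) H (T de) (T ep))).
    rewrite -tr2D; apply: eq_tr2 => al be ga ep.
    have L := lf4_2 W (T be) (T de) (T ep).
    by rewrite (lf_eq L (sffE al ga)) (lfD _ _ L) (lfZ _ _ L) -w34.
  congr (_ + _); first by rewrite tr2N tr2_sym12 tr2_sym34.
  rewrite /h -trN; apply: eq_tr => al be.
  rewrite (tr_gl' gbar_sym gbi_sym gbi_gbar al (fun ep => ev4 W (T be) H (T de) (T ep))).
  by rewrite w12 wpair.
have Lc : tr2 (fun al be ga ep => ev4 W (T be) (T ga) (sff al de) (T ep)) = M.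
  rewrite tr2_sym12; apply: eq_tr2 => al be ga ep.
  exact: (lf_eq (lf4_3 W (T al) (T ga) (T ep)) (sff_sym be de)).
(* Here the symmetric [sff] meets two antisymmetric indices of W. *)
have Ld : tr2 (fun al be ga ep => ev4 W (T be) (T ga) (T de) (sff al ep)) = 0.
  set X := (X in X = _); have E : X = - X.
    rewrite {1}/X tr2_exch tr2_sym12 tr2_sym34 -tr2N; apply: eq_tr2 => al be ga ep.
    by rewrite w12 (lf_eq (lf4_4 W (T be) (T ga) (T de)) (sff_sym ep al)).
  by rewrite -[LHS]mul1r -hf2 -mulrA mulr2n mulrDl mul1r {1}E addNr mulr0.
have ME : M = sX1 de + h.
  transitivity (tr2 (fun al be ga ep => ev4 W (T al) (T ga) (sff0 be de) (T ep))
     + tr2 (fun al be ga ep => gbar de be * ev4 W (T al) (T ga) H (T ep))).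
    rewrite -tr2D; apply: eq_tr2 => al be ga ep.
    have L := lf4_3 W (T al) (T ga) (T ep).
    rewrite (lf_eq L (sffE de be)) (lfD _ _ L) (lfZ _ _ L).
    by rewrite (lf_eq L (sff0_sym de be)).
  congr (_ + _); rewrite tr_exch; apply: eq_tr => ga ep.
  exact: (tr_gr' gbar_sym gbi_sym gbi_gbar de (fun al => ev4 W (T al) (T ga) H (T ep))).
have CE : scalC_tr D T kinv s de = tr gbi (fun a b => Cr a de b) - h.
  rewrite /scalC_tr /scalC trB; congr (_ - _); apply: eq_tr => be ga.
  by rewrite w12 w34 opprK.
rewrite La Lb Lc Ld CE.
transitivity (tr2 (fun e a c d => Zr e a c de d) - hf * tr2 (fun a b c d => Zr de a c b d)
  + (k%:R - 1) * h - sX2 de + M - (hf * 2) * 2 * M).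
  by rewrite /M; ring.
have -> : tr2 (fun e a c d => Zr e a c de d) - hf * tr2 (fun a b c d => Zr de a c b d) =
    - (k%:R - 2) * tr gbi (fun a b => Cr a de b).
  transitivity (- hf * (tr2 (fun a b c d => Zr de a c b d)
     - 2 * tr2 (fun e a c d => Zr e a c de d))
     + (1 - hf * 2) * tr2 (fun e a c d => Zr e a c de d)); first by ring.
  rewrite BC hf2.
  transitivity (- (hf * 2) * ((k%:R - 2) * tr gbi (fun a b => Cr a de b))); first by ring.
  by rewrite hf2; ring.
by rewrite hf2 ME; ring.
Qed.

(** * Conformal change along the submanifold *)

Variables (Y : 'I_n -> B) (YY : 'I_n -> 'I_n -> B) (e ei n4 n4i : B).
Hypothesis gi_sym : forall a b, pgi s a b = pgi s b a.
Hypothesis gi_g : forall a c, \sum_b pgi s a b * pg s b c = (a == c)%:R.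
Hypothesis e_ei : e * ei = 1.
Hypothesis De : forall al, D al e = 2 * ev1 Y (T al) * e.
Hypothesis cov_Y : forall al b,
  cov1 (D al) (pconn T s al) Y b = \sum_a T al a * YY a b.
Hypothesis n4E : n4 * n4i = 1.
Let U := raise (pgi s) Y.
Let q2 := ev1 Y U.

(** The ambient transformation laws written in the ring of Y; [pull_conf] proves that the
    restrictions of the rescaled tensors are of this form. *)
Definition conf_pulled : pulled B k n := Pulled
  (fun a b => e * pg s a b)
  (fun a b => ei * pgi s a b)
  (fun c a b => pG s c a b + (c == a)%:R * Y b + (c == b)%:R * Y a - pg s a b * U c)
  (fun a b => pP s a b - (YY a b - Y a * Y b + hf * q2 * pg s a b))
  (fun a b c => C a b c - ev1 (W a b c) U)
  (fun a b c d => e * W a b c d)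
  (fun a b => ei * (pB s a b
     + n4 * (ev1 (fun x => C x a b) U + ev1 (fun x => C x b a) U)
     + n4 * ev2 (fun c d => W a c b d) U U))
  (fun al be => ei * gbi al be).
Notation sh := conf_pulled.

(** Splitting of the gradient [U]: [UT] is its tangential part, dual to the restricted covector [y],
    [N] its normal part, and [tau] the squared length of [y]. *)
Let y al := ev1 Y (T al).
Let yu := raise gbi y.
Let UT a := \sum_ga yu ga * T ga a.
Let N := norm U.
Let tau := ev1 y yu.

Let gU v : gY U v = ev1 Y v.
Proof.
rewrite ev2_swap /ev2; rewrite ev1C [RHS]ev1C.
apply: eq_bigr => a _; congr (_ * _); rewrite -[RHS](raiseK gi_sym gi_g).
by apply: eq_bigr => b _; rewrite g_sym.
Qed.

Let UE a : U a = UT a + N a.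
Proof.
rewrite (normE U); congr (_ + _); apply: eq_bigr => ga _; congr (_ * _).
by apply: eq_bigr => de _; rewrite gU.
Qed.

Let YN v : (forall al, gY v (T al) = 0) -> gY N v = ev1 Y v.
Proof.
move=> v0; rewrite -gU (lf_eq (lf2_1 (pg s) v) UE) (lfD UT N (lf2_1 (pg s) v)).
rewrite /UT (lf_sum _ _ (lf2_1 (pg s) v)) big1 ?add0r // => ga _.
by rewrite gY_sym v0 mulr0.
Qed.

Let q2E : q2 = tau + ev1 Y N.
Proof.
rewrite /q2 (lf_eq (lf1 Y) UE) (lfD UT N (lf1 Y)) /UT (lf_sum _ _ (lf1 Y)).
by congr (_ + _).
Qed.

Lemma sgbar_conf al be : sgbar T sh al be = e * gbar al be.
Proof. exact: ev2Z. Qed.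

Lemma stang_conf v ga : stang T sh v ga = tang v ga.
Proof.
apply: eq_bigr => de _; rewrite /= ev2Z mulrACA (mulrC ei) e_ei.
by rewrite mul1r.
Qed.

Lemma snormal_conf v a : snormal T sh v a = norm v a.
Proof.
by congr (_ - _); apply: eq_bigr => ga _; rewrite stang_conf.
Qed.

Lemma snab_conf al V a : snab D T sh al V a =
  nab al V a + y al * V a + ev1 Y V * T al a - gY (T al) V * U a.
Proof.
have P c : pconn T sh al a c = pconn T s al a c + Y c * T al a + (a == c)%:R * y al
    - ev1 (fun b => pg s b c) (T al) * U a.
  have -> : Y c * T al a = \sum_b Y c * ((a == b)%:R * T al b).
    by rewrite -mulr_sumr sum_delta_r.
  have -> : (a == c)%:R * y al = \sum_b (a == c)%:R * (T al b * Y b) by rewrite -mulr_sumr.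
  have -> : ev1 (fun b => pg s b c) (T al) * U a = \sum_b T al b * pg s b c * U a.
    by rewrite -mulr_suml.
  rewrite -!big_split -sumrB; apply: eq_bigr => b _ /=; ring.
rewrite /snab /covv.
transitivity (D al (V a) + (\sum_c pconn T s al a c * V c + ev1 Y V * T al a
   + \sum_c (a == c)%:R * (y al * V c) - ev2 (fun c b => pg s b c) V (T al) * U a)).
  have -> : ev1 Y V * T al a = \sum_c V c * Y c * T al a by rewrite mulr_suml.
  have -> : ev2 (fun c b => pg s b c) V (T al) * U a =
      \sum_c V c * ev1 (fun b => pg s b c) (T al) * U a by rewrite mulr_suml.
  congr (_ + _); rewrite -!big_split -sumrB.
  by apply: eq_bigr => c _; rewrite P /=; ring.
by rewrite (sum_delta_r a (fun c => y al * V c)) -ev2_swap; ring.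
Qed.

Lemma ssff_conf al be a : ssff D T sh al be a = sff al be a - gbar al be * N a.
Proof.
rewrite /ssff snormal_conf (norm_eq _ (snab_conf al (T be))).
rewrite (lfB _ _ (norm_lf a)) !(lfD _ _ (norm_lf a)) !(lfZ _ _ (norm_lf a)).
by rewrite !norm_T !mulr0 !addr0.
Qed.

Lemma smean_conf a : smean D T kinv sh a = ei * (H a - N a).
Proof.
rewrite /smean /= trZg (eq_tr _ (fun al be => ssff_conf al be a)) trB trZr.
rewrite (tr_metric gbar_sym gbi_gbar).
transitivity (ei * (kinv * tr gbi (fun al be => sff al be a) - kinv * k%:R * N a)).
  by ring.
by rewrite kinvE mul1r.
Qed.

Lemma ssff0_conf al be a : ssff0 D T kinv sh al be a = sff0 al be a.
Proof.
rewrite /ssff0 ssff_conf sgbar_conf smean_conf.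
transitivity (sff al be a - gbar al be * N a - (e * ei) * gbar al be * (H a - N a)).
  by ring.
by rewrite e_ei; ring.
Qed.

Lemma sconn_conf ga al be : sconn D T sh ga al be =
  cn ga al be + (ga == be)%:R * y al + (ga == al)%:R * y be - gbar al be * yu ga.
Proof.
rewrite /sconn stang_conf (tang_eq _ (snab_conf al (T be))).
rewrite (lfB _ _ (tang_lf ga)) !(lfD _ _ (tang_lf ga)) !(lfZ _ _ (tang_lf ga)).
rewrite !tang_T -/(y be).
have -> : tang U ga = yu ga by apply: eq_bigr => de _; rewrite gU.
rewrite /sgbar; ring.
Qed.

(** The ambient and the intrinsic Hessian of Upsilon differ by the second fundamental form paired
    with [Y]. *)
Lemma nab1_y al be : nab1 D cn y al be = ev2 YY (T al) (T be) + ev1 Y (sff al be).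
Proof.
rewrite /nab1 /cov1 /y (der_ev1 (D al) (pconn T s al)).
rewrite (eq_ev1 (cov_Y al) (fun=> erefl)) (lf_eq (lf1 Y) (gauss al be)).
rewrite (lfD _ _ (lf1 Y)) (lf_sum _ _ (lf1 Y)) ev1_sum.
have -> : \sum_d ev1 (fun b => T al d * YY d b) (T be) = ev2 YY (T al) (T be).
  by apply: eq_bigr => d _; rewrite ev1Z.
rewrite /conn; ring.
Qed.

(** The ambient Hessian is short of the intrinsic one by [Y] applied to [sff]. The two corrections
    by H in the calligraphic P change by just this amount, its trace-free part and its trace, and by
    the normal part of [q2]. *)
Lemma scalP_conf al be : scalP D T hf kinv sh al be = scalP D T hf kinv s al be
  - (nab1 D cn y al be - y al * y be + hf * tau * gbar al be).
Proof.
rewrite /scalP /= sgbar_conf nab1_y.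
have -> : ev2 (fun a b => pP s a b - (YY a b - Y a * Y b + hf * q2 * pg s a b)) (T al) (T be) =
    ev2 (pP s) (T al) (T be) - (ev2 YY (T al) (T be) - y al * y be + hf * q2 * gbar al be).
  by rewrite ev2D ev2N ev2D (ev2D YY) ev2N ev2_tens (ev2Z (hf * q2)).
rewrite !ev2Z.
have E v : ev2 (pg s) (smean D T kinv sh) v = ei * (gY H v - gY N v).
  by rewrite (lf_eq (lf2_1 (pg s) v) smean_conf) (lfZ _ _ (lf2_1 _ _)) (lfB _ _ (lf2_1 _ _)).
rewrite !E !(gY_sym _ (smean D T kinv sh)) !E.
rewrite (lf_eq (lf2_2 (pg s) H) (ssff0_conf al be)) (lf_eq (lf2_2 (pg s) N) (ssff0_conf al be)).
rewrite (YN (sff0_orth al be)) (gY_sym H N) (YN mean_orth).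
rewrite (YN (norm_orth U)) (lf_eq (lf1 Y) (sffE al be)) (lfD _ _ (lf1 Y)) (lfZ _ _ (lf1 Y)).
rewrite q2E -/N.
transitivity (ev2 (pP s) (T al) (T be) - (ev2 YY (T al) (T be) - y al * y be +
    hf * (tau + ev1 Y N) * gbar al be) + (e * ei) * (gY H (sff0 al be) - ev1 Y (sff0 al be))
    + (e * ei) * (e * ei) * gbar al be * (hf * (gY H H + ev1 Y N) - (hf * 2) * ev1 Y H)).
  by ring.
by rewrite e_ei hf2; ring.
Qed.

Lemma scalC_conf u v w : scalC D T kinv sh u v w = scalC D T kinv s u v w - ev4 W u v w UT.
Proof.
rewrite /scalC /= ev3D ev3N ev4Z.
have -> : ev3 (fun a b c => ev1 (W a b c) U) u v w = ev4 W u v w U by [].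
have L := lf4_4 W u v w.
rewrite (lf_eq L smean_conf) (lfZ _ _ L) (lfB _ _ L) (lf_eq L UE) (lfD UT N L).
transitivity (ev3 C u v w - (ev4 W u v w UT + ev4 W u v w N)
  - (e * ei) * (ev4 W u v w H - ev4 W u v w N)); first by ring.
by rewrite e_ei; ring.
Qed.

Lemma der_ei al : D al ei = - (2 * y al * ei).
Proof.
rewrite (der_inv _ e_ei) De; congr (- _).
by rewrite -[RHS]mulr1 -e_ei /y; ring.
Qed.

Lemma eq_snab al u v a : u =1 v -> nab al u a = nab al v a.
Proof.
by move=> E; rewrite /snab /covv E; congr (_ + _); apply: eq_bigr => b _; rewrite E.
Qed.
Lemma snabD al u v a : nab al (fun a => u a + v a) a = nab al u a + nab al v a.
Proof.
rewrite /snab /covv derD addrACA -big_split /=; congr (_ + _).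
by apply: eq_bigr => b _; rewrite mulrDr.
Qed.
Lemma snabZ al x u a : nab al (fun a => x * u a) a = D al x * u a + x * nab al u a.
Proof.
rewrite /snab /covv derM -addrA; congr (_ + _); rewrite mulrDr; congr (_ + _).
by rewrite mulr_sumr; apply: eq_bigr => b _; ring.
Qed.
Lemma snabN al u a : nab al (fun a => - u a) a = - nab al u a.
Proof.
rewrite /snab /covv derN opprD; congr (_ + _); rewrite -sumrN.
by apply: eq_bigr => b _; rewrite mulrN.
Qed.
Lemma snab_sum al (x : 'I_k -> B) (u : 'I_k -> 'I_n -> B) a :
  nab al (fun a => \sum_ga x ga * u ga a) a =
  \sum_ga (D al (x ga) * u ga a + x ga * nab al (u ga) a).
Proof.
rewrite (eq_bigr _ (fun ga _ => esym (snabZ al (x ga) (u ga) a))) /snab /covv.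
rewrite der_sum big_split /=; congr (_ + _).
under eq_bigr do rewrite mulr_sumr.
by rewrite exchange_big.
Qed.

(** The normal derivative of a tangential field is the second fundamental form applied to it, split
    here into [sff0] and the mean curvature. *)
Let nab_UT al a : norm (nab al UT) a = \sum_be yu be * sff0 al be a + y al * H a.
Proof.
rewrite /UT (norm_eq _ (snab_sum al yu T)).
have -> : norm (fun a => \sum_ga (D al (yu ga) * T ga a + yu ga * nab al (T ga) a)) a =
    \sum_ga D al (yu ga) * norm (T ga) a + \sum_ga yu ga * sff al ga a.
  rewrite (norm_eq (v := fun a => \sum_ga D al (yu ga) * T ga a +
    \sum_ga yu ga * nab al (T ga) a)); last by move=> b; rewrite big_split.
  rewrite (lfD (fun a => \sum_ga D al (yu ga) * T ga a) _ (norm_lf a)).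
  by rewrite !(lf_sum _ _ (norm_lf a)).
rewrite big1 ?add0r; last by move=> ga _; rewrite norm_T mulr0.
have -> : y al * H a = \sum_ga yu ga * gbar al ga * H a.
  rewrite -mulr_suml -[in LHS](raiseK gbi_sym gbi_gbar y al); congr (_ * _).
  by apply: eq_bigr => ga _; rewrite gbar_sym.
by rewrite -big_split; apply: eq_bigr => ga _; rewrite sffE /=; ring.
Qed.

(** The normal part of the derivative of [U] comes from the Schouten tensor and from the mean
    curvature, and cancels. Since H changes by N = U - UT, the derivative of [UT] is left; its mean
    curvature part cancels against the weight of H. *)
Lemma sD_conf al a : sD D T kinv sh al a =
  ei * (sD D T kinv s al a - \sum_be yu be * sff0 al be a).
Proof.
rewrite /sD !snormal_conf.
pose v := raise (pgi s) (fun b => \sum_c pP s c b * T al c).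
have V b : \sum_b0 pgi sh b b0 * (\sum_c pP sh c b0 * T al c) =
    ei * (v b - nab al U b + y al * U b - hf * q2 * T al b).
  have -> : T al b = \sum_x pgi s b x * (\sum_c T al c * pg s c x).
    under eq_bigr do rewrite mulr_sumr.
    rewrite exchange_big /= -[LHS](sum_delta_r b (T al)); apply: eq_bigr => c _.
    by rewrite -gi_g mulr_suml; apply: eq_bigr => x _; rewrite (g_sym c); ring.
  have -> : nab al U b = raise (pgi s) (cov1 (D al) (pconn T s al) Y) b.
    exact: (covv_raise g_sym gi_sym gi_g (par al)).
  have L (p q r z : 'I_n -> B) c d : raise (pgi s) p b - raise (pgi s) q b +
      c * raise (pgi s) r b - d * (\sum_x pgi s b x * z x) =
      \sum_x pgi s b x * (p x - q x + c * r x - d * z x).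
    rewrite /raise !mulr_sumr -!(sumrB, big_split) /=.
    by apply: eq_bigr => x _; ring.
  rewrite L mulr_sumr; apply: eq_bigr => x _; rewrite cov_Y.
  have -> : \sum_c (pP s c x - (YY c x - Y c * Y x + hf * q2 * pg s c x)) * T al c =
     \sum_c pP s c x * T al c - \sum_c T al c * YY c x + y al * Y x
     - hf * q2 * \sum_c T al c * pg s c x.
    rewrite /y /ev1 mulr_suml !mulr_sumr -!(sumrB, big_split) /=.
    by apply: eq_bigr => c _; ring.
  rewrite -[pgi sh b x]/(ei * pgi s b x); ring.
rewrite (norm_eq _ V) (lfZ _ _ (norm_lf a)).
rewrite (lfB _ _ (norm_lf a)) (lfD (fun b => v b - nab al U b) _ (norm_lf a)).
rewrite (lfB v _ (norm_lf a)) !(lfZ _ _ (norm_lf a)) norm_T.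
(* The coefficient - [y al] is -2 from differentiating [ei] plus 1 from the change of connection. *)
have K b : snab D T sh al (smean D T kinv sh) b = ei * (nab al H b - nab al U b + nab al UT b
    - y al * (H b - N b) + ev1 Y (fun a => H a - N a) * T al b).
  rewrite snab_conf (eq_snab _ _ smean_conf) (lf_eq (lf1 Y) smean_conf) (lfZ _ _ (lf1 Y)).
  rewrite (lf_eq (lf2_2 (pg s) (T al)) smean_conf) (lfZ _ _ (lf2_2 _ _)) (lfB _ _ (lf2_2 _ _)).
  rewrite !(gY_sym (T al)) mean_orth (norm_orth U) snabZ der_ei smean_conf.
  rewrite (snabD al H) (snabN al N).
  have -> : nab al N b = nab al U b - nab al UT b.
    rewrite -(snabN al UT) -snabD; apply: eq_snab => c; rewrite UE; ring.
  ring.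
rewrite (norm_eq _ K) (lfZ _ _ (norm_lf a)).
pose x0 b := nab al H b - nab al U b + nab al UT b.
rewrite (lfD (fun b => x0 b - y al * (H b - N b)) _ (norm_lf a)) (lfZ _ _ (norm_lf a)) norm_T.
rewrite (lfB x0 _ (norm_lf a)) (lfZ _ _ (norm_lf a)) (lfB H N (norm_lf a)).
rewrite norm_mean norm_norm (lfD (fun b => nab al H b - nab al U b) _ (norm_lf a)).
rewrite (lfB (nab al H) _ (norm_lf a)) nab_UT /v -/N.
have -> : norm (fun b => \sum_b0 pgi s b b0 * (\sum_c pP s c b0 * T al c)) a =
  norm (raise (pgi s) (fun b => \sum_c pP s c b * T al c)) a by [].
ring.
Qed.

(** The corrections by H absorb the normal part of [U] in the law of the Bach tensor, leaving [UT]
    in place of [U] and the calligraphic C in place of [C]. *)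
Lemma scalB_conf al be : scalB D T hf kinv n4 sh al be =
  ei * (scalB D T hf kinv n4 s al be
   + n4 * (scalC D T kinv s UT (T al) (T be) + scalC D T kinv s UT (T be) (T al))
   + n4 * ev4 W (T al) UT (T be) UT).
Proof.
pose W4 x z := ev4 W (T al) x (T be) z.
have W1 x z : ev4 W x (T al) (T be) z = - W4 x z by exact: w12.
have W2 x z : ev4 W x (T be) (T al) z = - W4 z x by rewrite w12 wpair.
have L1 z : linear_form (W4^~ z) by exact: lf4_2.
have L2 x : linear_form (W4 x) by exact: lf4_4.
have B2 : ev2 (pB sh) (T al) (T be) = ei * (ev2 (pB s) (T al) (T be)
    + n4 * (ev3 C U (T al) (T be) + ev3 C U (T be) (T al)) + n4 * W4 U U).
  rewrite /= ev2Z; congr (_ * _); rewrite !ev2D !ev2Z ev2D !ev2_ev1.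
  by rewrite -(ev3_swap23 C U (T be)) /W4 ev4_swap12.
have C3 u v x : ev3 (pC sh) u v x = ev3 C u v x - ev4 W u v x U.
  by rewrite ev3D ev3N.
have W4h u v x z : ev4 (pW sh) u v x z = e * ev4 W u v x z by exact: ev4Z.
have LC u v := lf3_1 C u v.
have hC u v : ev3 C (smean D T kinv sh) u v = ei * (ev3 C H u v - ev3 C N u v).
  by rewrite (lf_eq (LC _ _) smean_conf) (lfZ _ _ (LC _ _)) (lfB H N (LC _ _)).
have h1 z : W4 (smean D T kinv sh) z = ei * (W4 H z - W4 N z).
  by rewrite (lf_eq (L1 _) smean_conf) (lfZ _ _ (L1 _)) (lfB H N (L1 _)).
have h2 x : W4 x (smean D T kinv sh) = ei * (W4 x H - W4 x N).
  by rewrite (lf_eq (L2 _) smean_conf) (lfZ _ _ (L2 _)) (lfB H N (L2 _)).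
have UC u v : ev3 C U u v = ev3 C UT u v + ev3 C N u v.
  by rewrite (lf_eq (LC _ _) UE) (lfD UT N (LC _ _)).
have U1 z : W4 U z = W4 UT z + W4 N z by rewrite (lf_eq (L1 _) UE) (lfD UT N (L1 _)).
have U2 x : W4 x U = W4 x UT + W4 x N by rewrite (lf_eq (L2 _) UE) (lfD UT N (L2 _)).
have hfK x : 2 * n4 * (hf * x) = n4 * x.
  by transitivity ((hf * 2) * (n4 * x)); [ring|rewrite hf2 mul1r].
have eK x : e * (ei * x) = x by rewrite mulrA e_ei mul1r.
rewrite /scalB B2 !C3 W4h /scalC -!/(W4 _ _) !W1 !W2 !hC !h1 !h2 !UC !U1 !U2.
rewrite !hfK eK; ring.
Qed.

Notation calC_tr := (scalC_tr D T kinv s).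

Let W1u al := \sum_de yu de * sW1 T s al de.
Let Wuu := \sum_ga yu ga * W1u ga.
Let yuC := \sum_ga yu ga * calC_tr ga.

Lemma tr_scalB_conf : tr (pgbi sh) (scalB D T hf kinv n4 sh) =
  ei * ei * (tr gbi (scalB D T hf kinv n4 s) + n4 * (Wuu - 2 * yuC)).
Proof.
rewrite /= trZg (eq_tr _ scalB_conf) trZ mulrA; congr (_ * _).
rewrite (trD _ _ (fun al be => n4 * ev4 W (T al) UT (T be) UT)) (trD _ (scalB D T hf kinv n4 s)).
rewrite !trZ -addrA -mulrDr; congr (_ + _ * _).
have LC u v : linear_form (fun x => scalC D T kinv s x u v) by apply: lf_add; lf_auto.
have C0 : tr gbi (fun al be => scalC D T kinv s UT (T al) (T be)) = - yuC.
  rewrite (eq_tr _ (fun al be => lf_sum _ _ (LC (T al) (T be)))) tr_sum /yuC -sumrN.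
  apply: eq_bigr => ga _; rewrite trZ -mulrN; congr (_ * _).
  rewrite /scalC_tr -trN; apply: eq_tr => al be.
  rewrite /scalC w12 ev3_swap12 (_ : ev3 _ _ _ _ = - ev3 C (T al) (T ga) (T be)); first ring.
  by rewrite -ev3N; apply: eq_ev3 => *; rewrite C12.
rewrite (trD _ (fun al be => scalC D T kinv s UT (T al) (T be))) C0.
rewrite [X in _ + X + _](tr_sym gbi_sym) C0.
have -> : tr gbi (fun al be => ev4 W (T al) UT (T be) UT) = Wuu.
  rewrite (eq_tr _ (fun al be => lf_sum _ _ (lf4_2 W (T al) (T be) UT))) tr_sum.
  apply: eq_bigr => ga _; rewrite trZ; congr (_ * _).
  rewrite (eq_tr _ (fun al be => lf_sum _ _ (lf4_4 W (T al) (T ga) (T be)))) tr_sum.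
  apply: eq_bigr => de _; rewrite trZ; congr (_ * _).
  by apply: eq_tr => al be; rewrite w12 w34 opprK.
ring.
Qed.

Notation div := (sdiv D T s).

(** The divergence of a covector contributes k - 2, differentiating the weight [ei] another -2; the
    outer factors [ei] are the weight and the inverse metric. *)
Lemma sdiv_conf (f t : 'I_k -> B) : (forall al, f al = ei * t al) ->
  sdiv D T sh f = ei * ei * (div t + (k%:R - 4) * \sum_ga yu ga * t ga).
Proof.
move=> fE; rewrite /sdiv /= trZg -mulrA; congr (_ * _).
have N1 al be : nab1 D (sconn D T sh) f al be = ei * (nab1 D cn t al be
    - 3 * (y al * t be) - y be * t al + gbar al be * \sum_ga yu ga * t ga).
  rewrite /nab1 /cov1 /conn fE derM der_ei.
  have -> : \sum_d sconn D T sh d al be * f d = ei * (\sum_d cn d al be * t d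
     + \sum_d (d == be)%:R * (y al * t d) + \sum_d (d == al)%:R * (y be * t d)
     - gbar al be * \sum_d yu d * t d).
    rewrite mulr_sumr -!(sumrB, big_split) /= mulr_sumr; apply: eq_bigr => d _.
    by rewrite sconn_conf fE; ring.
  by rewrite (sum_delta_l be (fun d => y al * t d)) (sum_delta_l al (fun d => y be * t d)); ring.
have tyt : tr gbi (fun al be => y al * t be) = \sum_ga yu ga * t ga.
  exact: (tr_tens gbi_sym).
rewrite (eq_tr _ N1) trZ; congr (_ * _).
have L (p q r : 'I_k -> 'I_k -> B) c : tr gbi (fun a b => p a b - 3 * q a b - r a b + gbar a b * c) =
    tr gbi p - 3 * tr gbi q - tr gbi r + k%:R * c.
  by rewrite !(trD, trN, trZ, trZr) (tr_metric gbar_sym gbi_gbar).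
rewrite L [X in _ - X + _](tr_sym gbi_sym) tyt; ring.
Qed.

Lemma sdivB f t : div (fun al => f al - t al) = div f - div t.
Proof.
rewrite /sdiv -trB; apply: eq_tr => al be; rewrite /nab1 /cov1 derB.
have -> : \sum_d conn cn al d be * (f d - t d) =
   \sum_d conn cn al d be * f d - \sum_d conn cn al d be * t d.
  by rewrite -sumrB; apply: eq_bigr => d _; rewrite mulrBr.
ring.
Qed.

Lemma scalC_tr_conf al : scalC_tr D T kinv sh al = ei * (calC_tr al - W1u al).
Proof.
rewrite /scalC_tr /= trZg; congr (_ * _).
rewrite (eq_tr _ (fun be ga => scalC_conf (T be) (T al) (T ga))) trB; congr (_ - _).
rewrite (eq_tr _ (fun be ga => lf_sum _ _ (lf4_4 W (T be) (T al) (T ga)))) tr_sum.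
apply: eq_bigr => de _; rewrite trZ; congr (_ * _).
by apply: eq_tr => be ga; rewrite w12 w34 opprK.
Qed.

Lemma sW1_conf al be : sW1 T sh al be = sW1 T s al be.
Proof.
rewrite /sW1 /= trZg (eq_tr _ (fun ga de => ev4Z e W (T al) (T ga) (T be) (T de))).
by rewrite trZ mulrA (mulrC ei) e_ei mul1r.
Qed.

Lemma sW2_conf : sW2 T sh = ei * sW2 T s.
Proof. by rewrite /sW2 /= trZg (eq_tr _ sW1_conf). Qed.

(** The contraction of the intrinsic Hessian with [sW1]: it appears in the divergence of [W1u] and
    in [sPW], and cancels between them. *)
Let Q := tr2 (fun al ga be de => nab1 D cn y ga de * sW1 T s al be).

Let div_W1u : div W1u = \sum_de yu de * tr gbi (fun al be => nab2 D cn (sW1 T s) al be de) + Q.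
Proof.
have E mu al : nab1 D cn W1u mu al = ev1 (nab2 D cn (sW1 T s) mu al) yu +
    tr gbi (fun ep de => nab1 D cn y mu ep * sW1 T s al de).
  rewrite (tr_tens gbi_sym) /nab1 [LHS]cov1_ev1; congr (_ + _).
  apply: eq_ev1 => // de.
  exact: (covv_raise gbar_sym gbi_sym gbi_gbar (cn_par mu)).
rewrite /sdiv (eq_tr _ E) (trD _ (fun mu al => ev1 (nab2 D cn (sW1 T s) mu al) yu)).
congr (_ + _); last by rewrite /Q tr2_sym12 tr2_sym34.
by rewrite /ev1 tr_sum; apply: eq_bigr => de _; rewrite trZ.
Qed.

Lemma sPW_conf : sPW D T hf kinv sh =
  ei * ei * (sPW D T hf kinv s - Q + Wuu - hf * tau * sW2 T s).
Proof.
rewrite /sPW /= trZg -mulrA; congr (_ * _).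
rewrite (eq_tr _ (fun al ga => trZg _ _ _)) trZ; congr (_ * _).
transitivity (sPW D T hf kinv s - Q + tr2 (fun al ga be de => y ga * y de * sW1 T s al be)
    - hf * tau * tr2 (fun al ga be de => gbar ga de * sW1 T s al be)).
  have L (p q r z : 'I_k -> 'I_k -> 'I_k -> 'I_k -> B) c :
      tr2 p - tr2 q + tr2 r - c * tr2 z =
      tr2 (fun al ga be de => p al ga be de - q al ga be de + r al ga be de - c * z al ga be de).
    rewrite !tr2D !tr2N; congr (_ - _ + _ - _); rewrite -trZ; apply: eq_tr => a b.
    by rewrite trZ.
  by rewrite L; apply: eq_tr2 => al ga be de; rewrite scalP_conf sW1_conf; ring.
congr (_ - _ + _ - _ * _).
  transitivity (tr gbi (fun al ga => y ga * W1u al)).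
    apply: eq_tr => al ga.
    transitivity (tr gbi (fun be de => y ga * (y de * sW1 T s al be))).
      by apply: eq_tr => be de; rewrite mulrA.
    by rewrite trZ (tr_sym gbi_sym) (tr_tens gbi_sym).
  by rewrite (tr_sym gbi_sym) (tr_tens gbi_sym).
apply: eq_tr => al ga.
exact: (tr_gr' gbar_sym gbi_sym gbi_gbar ga (fun be => sW1 T s al be)).
Qed.

Lemma sDW_conf : sDW D T kinv sh =
  ei * ei * (sDW D T kinv s - \sum_de yu de * sX1 de).
Proof.
rewrite /sDW /= trZg -mulrA; congr (_ * _).
rewrite (eq_tr _ (fun al ga => trZg _ _ _)) trZ; congr (_ * _).
rewrite (eq_bigr _ (fun de _ => esym (trZ _ _ _))) -tr_sum -trB; apply: eq_tr => al ga.
rewrite (eq_bigr _ (fun de _ => esym (trZ _ _ _))) -tr_sum -trB; apply: eq_tr => be de.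
have L := lf4_3 W (T al) (T be) (T de).
rewrite ev4Z (lf_eq L (sD_conf ga)) (lfZ _ _ L) mulrA e_ei mul1r (lfB _ _ L).
by rewrite (lf_sum _ _ L).
Qed.

Lemma sLC_conf : sLC D T kinv sh =
  ei * ei * (sLC D T kinv s - \sum_de yu de * sX2 de).
Proof.
rewrite /sLC /= trZg -mulrA; congr (_ * _).
rewrite (eq_tr _ (fun al ga => trZg _ _ _)) trZ; congr (_ * _).
rewrite (eq_bigr _ (fun de _ => esym (trZ _ _ _))) -tr_sum -trB; apply: eq_tr => al ga.
rewrite (eq_bigr _ (fun de _ => esym (trZ _ _ _))) -tr_sum -trB; apply: eq_tr => be de.
have L1 : linear_form (fun x => scalC D T kinv sh (T al) x (T be)).
  by apply: lf_add; lf_auto.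
rewrite (lf_eq L1 (ssff0_conf ga de)) scalC_conf; congr (_ - _).
exact: (lf_sum _ _ (lf4_4 W (T al) (sff0 ga de) (T be))).
Qed.

Lemma tr_scalP_conf : tr (pgbi sh) (scalP D T hf kinv sh) =
  ei * (tr gbi (scalP D T hf kinv s) - div y + tau - hf * tau * k%:R).
Proof.
rewrite /= trZg; congr (_ * _); rewrite (eq_tr _ scalP_conf).
have L (p q r : 'I_k -> 'I_k -> B) c : tr gbi (fun a b => p a b - (q a b - r a b + c * gbar a b)) =
    tr gbi p - tr gbi q + tr gbi r - c * k%:R.
  by rewrite !(trD, trN, trZ) (tr_metric gbar_sym gbi_gbar); ring.
by rewrite L (tr_tens gbi_sym).
Qed.

(** Up to the overall weight, let u be the dual of [y]. In the bracket C(u) occurs with (k - 4) + (k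
    - 2) - 2(k - 3) = 0 and W(u,u) with -(k - 4) - 1 + (k - 3) = 0, which forces the coefficient k -
    3. The bracket then changes by half of [tau] W - dW(u), W being [sW2], while the Laplacian and
    the trace of the calligraphic P together change by k - 6 times the same expression: hence the
    coefficient 2(k - 6). *)
Theorem sJ_conf : sJ D T hf kinv n4 sh n4i = ei * ei * sJ D T hf kinv n4 s n4i.
Proof.
have EC : sdiv D T sh (scalC_tr D T kinv sh) =
    ei * ei * (div calC_tr - div W1u + (k%:R - 4) * (yuC - Wuu)).
  have -> : yuC - Wuu = \sum_ga yu ga * (calC_tr ga - W1u ga).
    by rewrite -sumrB; apply: eq_bigr => ga _; rewrite mulrBr.
  by rewrite (sdiv_conf scalC_tr_conf) sdivB.
pose yuD := \sum_de yu de * D de (sW2 T s).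
have ED : sdiv D T sh (fun al => D al (sW2 T sh)) = ei * ei * (div (fun al => D al (sW2 T s))
    - 2 * (sW2 T s * div y + yuD) + (k%:R - 4) * (yuD - 2 * tau * sW2 T s)).
  rewrite (@sdiv_conf _ (fun al => D al (sW2 T s) - 2 * sW2 T s * y al)); last first.
    by move=> al; rewrite sW2_conf derM der_ei; ring.
  rewrite sdivB; congr (_ * (_ - _ + _ * _)).
    rewrite /yuD; have -> : \sum_de yu de * D de (sW2 T s) =
        tr gbi (fun al be => y be * D al (sW2 T s)).
      by rewrite (tr_sym gbi_sym) (tr_tens gbi_sym).
    rewrite /sdiv -trZ -trD -trZ; apply: eq_tr => al be.
    rewrite /nab1 /cov1 !derM (_ : D al 2 = 0); last exact: (der_nat _ 2).
    rewrite (_ : \sum_d _ = 2 * sW2 T s * \sum_d conn cn al d be * y d); first ring.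
    by rewrite mulr_sumr; apply: eq_bigr => d _; ring.
  rewrite /yuD /tau /ev1 mulr_sumr mulr_suml -sumrB; apply: eq_bigr => d _; ring.
(* [div_sW1] contracted with the dual of [y], the only relation here that is not formal. *)
have KK : \sum_de yu de * tr gbi (fun al be => nab2 D cn (sW1 T s) al be de) =
    hf * yuD - (k%:R - 2) * yuC - \sum_de yu de * sX1 de - \sum_de yu de * sX2 de.
  rewrite /yuD /yuC !mulr_sumr -!sumrB; apply: eq_bigr => de _.
  have /eqP := div_sW1 de; rewrite subr_eq => /eqP ->; ring.
rewrite /sJ /sbracket ED EC div_W1u KK sPW_conf sDW_conf sLC_conf tr_scalB_conf.
rewrite tr_scalP_conf sW2_conf.
set X1 := \sum_de yu de * sX1 de; set X2 := \sum_de yu de * sX2 de.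
have n4K x : n4i * (n4 * x) = x by rewrite mulrA (mulrC n4i) n4E mul1r.
have n4K' (z x : B) : (k%:R - 3) * n4i * (ei * ei * (z + n4 * x)) =
   ei * ei * ((k%:R - 3) * n4i * z + (k%:R - 3) * x).
  by rewrite -{2}(n4K x); ring.
rewrite n4K'.
(* [tau] and [yuD] are rewritten as doubles of their halves, so that the remaining identity is
   polynomial. *)
have h2 : hf * tau * 2 = tau by rewrite mulrAC hf2 mul1r.
have hD : hf * yuD * 2 = yuD by rewrite mulrAC hf2 mul1r.
move: h2 hD; set ht := hf * tau; set hd := hf * yuD => h2 hD.
rewrite -[tau]h2 -[yuD]hD; ring.
Qed.

End BaseFacts.

(** * Restriction of the ambient tensors by a ring morphism *)

Section Pullback.
Context {A B : comPzRingType} {k n : nat}.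
Variables (DA : 'I_n -> derivation A) (DB : 'I_k -> derivation B).
Variables (res : {rmorphism A -> B}) (T : 'I_k -> 'I_n -> B).
Hypothesis DAC : forall a b x, DA a (DA b x) = DA b (DA a x).
Hypothesis T_sym : forall al be a, DB al (T be a) = DB be (T al a).
Hypothesis chain : forall al x, DB al (res x) = \sum_a T al a * res (DA a x).

Definition christ (hf : A) (g gi : 'I_n -> 'I_n -> A) c a b :=
  hf * \sum_d gi c d * (DA a (g b d) + DA b (g a d) - DA d (g a b)).

Definition pull (c1 c2 : A) (g gi : 'I_n -> 'I_n -> A) G (gbi : 'I_k -> 'I_k -> B) :=
  Pulled (fun a b => res (g a b)) (fun a b => res (gi a b))
    (fun c a b => res (G c a b)) (fun a b => res (sch DA c1 c2 g gi G a b))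
    (fun a b c => res (cott DA c1 c2 g gi G a b c))
    (fun a b c d => res (weylA DA c1 c2 g gi G a b c d))
    (fun a b => res (bachA DA c1 c2 g gi G a b)) gbi.

Variables (hf c1 c2 : A) (g gi : 'I_n -> 'I_n -> A).
Hypothesis hf2 : hf * 2 = 1.
Hypothesis c1E : c1 * (2 * (n%:R - 1)) = 1.
Hypothesis c2E : c2 * (n%:R - 2) = 1.
Hypothesis g_sym : forall a b, g a b = g b a.
Hypothesis gi_sym : forall a b, gi a b = gi b a.
Hypothesis gi_g : forall a c, \sum_b gi a b * g b c = (a == c)%:R.

Lemma christ_levi_civita : levi_civita DA g (christ hf g gi).
Proof.
have S c a b : christ hf g gi c a b = christ hf g gi c b a.
  by rewrite /christ; congr (_ * _); apply: eq_bigr => d _; rewrite (g_sym a b); ring.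
split=> // a b c; apply/eqP; rewrite subr_eq0; apply/eqP.
have L x y z : \sum_d christ hf g gi d x y * g d z =
    hf * (DA x (g y z) + DA y (g x z) - DA z (g x y)).
  rewrite /christ; under eq_bigr do rewrite -mulrA; rewrite -mulr_sumr.
  congr (_ * _).
  exact: (raiseK gi_sym gi_g (fun d => DA x (g y d) + DA y (g x d) - DA d (g x y))).
rewrite big_split /= L.
have -> : \sum_i conn (christ hf g gi) a i c * g b i =
    \sum_i christ hf g gi i a c * g i b.
  by apply: eq_bigr => i _; rewrite g_sym.
rewrite L (g_sym c b).
transitivity ((hf * 2) * DA a (g b c)); first by rewrite hf2 mul1r.
ring.
Qed.

Variables (G : 'I_n -> 'I_n -> 'I_n -> A) (Y : 'I_n -> A) (e ei : A).
Hypothesis LC : levi_civita DA g G.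
Hypothesis e_ei : e * ei = 1.
Hypothesis De : forall a, DA a e = 2 * Y a * e.
Hypothesis DY : forall a b, DA a (Y b) = DA b (Y a).

Notation gh := (conf_metric g e).
Notation gih := (conf_ginv gi ei).
Notation Gh := (conf_conn g gi G Y).

Variables (gbi : 'I_k -> 'I_k -> B) (kinv n4i : B).
Hypothesis kinvE : kinv * k%:R = 1.
Hypothesis n4E : (n%:R - 4) * n4i = 1.
Notation s := (pull c1 c2 g gi G gbi).
Hypothesis gbi_sym : forall a b, gbi a b = gbi b a.
Hypothesis gbi_gbar : forall a c, \sum_b gbi a b * sgbar T s b c = (a == c)%:R.

Let pcE al d b : pconn T s al d b = \sum_x T al x * res (G d x b).
Proof. by apply: eq_bigr => x _; rewrite mulrC. Qed.

(** The chain rule for the components, together with the pulled-back Christoffel symbols, gives the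
    ambient covariant derivative contracted with the tangent vector; higher ranks follow by freezing
    an index. *)
Lemma cov1_pull al (t : 'I_n -> A) b :
  cov1 (DB al) (pconn T s al) (fun b => res (t b)) b =
  \sum_a T al a * res (nab1 DA G t a b).
Proof.
rewrite /cov1 chain; under [X in _ - X]eq_bigr do rewrite pcE mulr_suml.
rewrite exchange_big -sumrB; apply: eq_bigr => x _ /=.
rewrite /nab1 /cov1 rmorphB rmorph_sum mulrBr mulr_sumr; congr (_ - _).
by apply: eq_bigr => d _; rewrite [X in _ = _ * X]rmorphM mulrA.
Qed.

Lemma cov2_pull al (t : 'I_n -> 'I_n -> A) b c :
  cov2 (DB al) (pconn T s al) (fun b c => res (t b c)) b c =
  \sum_a T al a * res (nab2 DA G t a b c).
Proof.
rewrite cov2S (cov1_pull al (t b)); under [X in _ - X]eq_bigr do rewrite pcE mulr_suml.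
rewrite exchange_big -sumrB; apply: eq_bigr => x _ /=.
rewrite /nab2 cov2S [in RHS]rmorphB [in RHS]rmorph_sum [RHS]mulrBr mulr_sumr; congr (_ - _).
by apply: eq_bigr => d _; rewrite [X in _ = _ * X]rmorphM mulrA.
Qed.

Lemma cov3_pull al (t : 'I_n -> 'I_n -> 'I_n -> A) b c d :
  cov3 (DB al) (pconn T s al) (fun b c d => res (t b c d)) b c d =
  \sum_a T al a * res (nab3 DA G t a b c d).
Proof.
rewrite cov3S (cov2_pull al (t b)); under [X in _ - X]eq_bigr do rewrite pcE mulr_suml.
rewrite exchange_big -sumrB; apply: eq_bigr => x _ /=.
rewrite /nab3 cov3S [in RHS]rmorphB [in RHS]rmorph_sum [RHS]mulrBr mulr_sumr; congr (_ - _).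
by apply: eq_bigr => f _; rewrite [X in _ = _ * X]rmorphM mulrA.
Qed.

Lemma cov4_pull al (t : 'I_n -> 'I_n -> 'I_n -> 'I_n -> A) b c d f :
  cov4 (DB al) (pconn T s al) (fun b c d f => res (t b c d f)) b c d f =
  \sum_a T al a * res (nab4 DA G t a b c d f).
Proof.
rewrite cov4S (cov3_pull al (t b)); under [X in _ - X]eq_bigr do rewrite pcE mulr_suml.
rewrite exchange_big -sumrB; apply: eq_bigr => x _ /=.
rewrite /nab4 cov4S [in RHS]rmorphB [in RHS]rmorph_sum [RHS]mulrBr mulr_sumr; congr (_ - _).
by apply: eq_bigr => h _; rewrite [X in _ = _ * X]rmorphM mulrA.
Qed.

Lemma pull_conf : pull c1 c2 gh gih Gh (fun al be => res ei * gbi al be) =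
  conf_pulled (res hf) s (fun a => res (Y a)) (fun a b => res (nab1 DA G Y a b))
    (res e) (res ei) (n%:R - 4).
Proof.
have EV (t u : 'I_n -> A) : res (ev1 t u) = ev1 (fun a => res (t a)) (fun a => res (u a)).
  by rewrite rmorph_sum; apply: eq_bigr => a _; rewrite rmorphM.
have UE : (fun a => res (raise gi Y a)) =
    raise (fun a b => res (gi a b)) (fun a => res (Y a)).
  apply/funext => a; rewrite rmorph_sum; apply: eq_bigr => b _; exact: rmorphM.
have Rn p : res p%:R = p%:R by exact: rmorph_nat.
have SC := sch_conf hf2 g_sym gi_sym gi_g LC e_ei DY c1E c2E.
rewrite /pull /conf_pulled; congr Pulled.
- by apply/funext => a; apply/funext => b; rewrite rmorphM.
- by apply/funext => a; apply/funext => b; rewrite rmorphM.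
- apply/funext => c; apply/funext => a; apply/funext => b.
  by rewrite rmorphB !rmorphD !rmorphM !Rn -[raise (pgi s) _]UE.
- apply/funext => a; apply/funext => b; rewrite SC rmorphB; congr (_ - _).
  by rewrite rmorphD rmorphB !rmorphM EV -UE.
- apply/funext => a; apply/funext => b; apply/funext => c.
  by rewrite (cott_conf hf2 g_sym gi_sym gi_g LC e_ei DY DAC c1E c2E) rmorphB EV -UE.
- apply/funext => a; apply/funext => b; apply/funext => c; apply/funext => d.
  by rewrite (weyl_conf hf2 g_sym gi_sym gi_g LC e_ei DY c1E c2E) rmorphM.
- apply/funext => a; apply/funext => b.
  rewrite (bach_conf hf2 g_sym gi_sym gi_g LC e_ei DY DAC c1E c2E) -UE.
  rewrite rmorphM; congr (_ * _).
  rewrite -[pB s a b]/(res (bachA DA c1 c2 g gi G a b)).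
  move: (bachA DA c1 c2 g gi G a b) => x.
  rewrite !rmorphD !(rmorphM res (n%:R - 4)) rmorphB !Rn rmorphD !EV.
  congr (_ + _ + _ * _); apply: eq_ev1 => // c; exact: EV.
Qed.

(** The hypotheses of [sJ_conf] are ambient identities carried over by [res], with [cov2_pull],
    [cov4_pull] and [cov1_pull] providing those on [g], W and Y. *)
Theorem sJ_pull : sJ DB T (res hf) kinv (n%:R - 4)
    (pull c1 c2 gh gih Gh (fun al be => res ei * gbi al be)) n4i =
  res ei * res ei * sJ DB T (res hf) kinv (n%:R - 4) s n4i.
Proof.
rewrite pull_conf.
have Rn p : res p%:R = p%:R by exact: rmorph_nat.
apply: (@sJ_conf _ _ _ _ _ _ _ _ _ _ _ _ _ _ _ (fun e a b c d =>
   res (nab4 DA G (weylA DA c1 c2 g gi G) e a b c d))) => //=.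
- by rewrite -Rn -rmorphM hf2 rmorph1.
- by move=> a b; rewrite g_sym.
- move=> al b c; rewrite (cov2_pull al g) big1 // => a _.
  by rewrite LC.2 rmorph0 mulr0.
(* Absence of torsion along Y: second derivatives of the immersion commute and the Christoffel
   symbols are symmetric. *)
- move=> al be a; rewrite /snab /covv T_sym; congr (_ + _).
  under eq_bigr do rewrite pcE mulr_suml.
  under [RHS]eq_bigr do rewrite pcE mulr_suml.
  rewrite [RHS]exchange_big; apply: eq_bigr => c _; apply: eq_bigr => b _ /=.
  by rewrite LC.1; ring.
- by move=> a b c d; rewrite -rmorphN weyl12.
- by move=> a b c d; rewrite -rmorphN (weyl34 c1 c2 DAC gi g_sym LC).
- by move=> a b c d; rewrite (weyl_pair c1 c2 DAC hf2 g_sym gi_sym gi_g LC).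
- by move=> a b c; rewrite -rmorphN cott12.
- by move=> f a b c d; rewrite -rmorphN nab_weyl12.
- by move=> f a b c d; rewrite -rmorphN (nab_weyl34 c1 c2 DAC gi g_sym LC).
- by move=> f a b c d; rewrite (nab_weyl_pair c1 c2 DAC hf2 g_sym gi_sym gi_g LC).
- move=> f a b c d; have := weyl_bianchi c1 c2 DAC gi LC f a b c d.
  move: (nab4 DA G (weylA DA c1 c2 g gi G)) (cott DA c1 c2 g gi G) => z q /(congr1 res).
  by rewrite rmorphN !(rmorphB, rmorphD) !rmorphM.
- by move=> al a b c d; rewrite (cov4_pull al (weylA DA c1 c2 g gi G)).
- by move=> a b; rewrite gi_sym.
- move=> a c; rewrite -(Rn (a == c)) -gi_g rmorph_sum.
  by apply: eq_bigr => b _; rewrite rmorphM.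
- by rewrite -rmorphM e_ei rmorph1.
- move=> al; rewrite chain /ev1 mulr_sumr mulr_suml; apply: eq_bigr => a _.
  by rewrite De !rmorphM Rn; ring.
- by move=> al b; rewrite (cov1_pull al Y).
Qed.

End Pullback.

Import Order.TTheory Num.Theory numFieldNormedType.Exports.
Local Open Scope classical_set_scope.
Local Open Scope ring_scope.

(** * Calculus of several variables *)

(** Arithmetic of [schwarz]: [d], [d1], [d2], [d0] are values at the corners of a square, [s] its
    area, [x] and [y] the two mixed derivatives. *)
Lemma dist_second_difference (R : realFieldType) (d d1 d2 d0 x y e s : R) :
  `|d - d1 - (d2 - d0) - s * y| <= e / 2 * s ->
  `|d - d2 - (d1 - d0) - s * x| <= e / 2 * s -> `|(x - y) * s| <= e * s.
Proof. by rewrite !ler_norml => /andP[? ?] /andP[? ?]; apply/andP; split; lra. Qed.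

Section Calculus.
Context {R : realType} {n : nat}.
Implicit Types (f g : 'rV[R]_n -> R) (x h : 'rV[R]_n) (U : set 'rV[R]_n).

Lemma nbhs_coordP x (P : set 'rV[R]_n) : nbhs x P <->
  exists2 r : R, 0 < r & forall y : 'rV[R]_n, (forall i, `|x 0 i - y 0 i| < r) -> P y.
Proof.
split=> [/nbhs_ballP[r /= r0 rP]|[r r0 rP]].
  by exists r => // y xy; apply: rP; split => // i j; rewrite ord1; apply: xy.
apply/nbhs_ballP; exists r => //= y [_ xy]; apply: rP => i; exact: xy.
Qed.

Lemma is_derive_line f x v (s : R) : derivable f (x + s *: v) v ->
  is_derive s (1 : R) (fun t => f (x + t *: v)) ('D_v f (x + s *: v)).
Proof.
have E : (fun h : R => h^-1 *: (((fun t => f (x + t *: v)) \o shift s) (h *: 1) - f (x + s *: v))) =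
  (fun h : R => h^-1 *: ((f \o shift (x + s *: v)) (h *: v) - f (x + s *: v))).
  apply/funext => h /=; congr (_ *: (f _ - _)).
  by rewrite [h *: 1]mulr1 scalerDl addrCA.
by move=> df; apply: DeriveDef; rewrite /derivable /derive E.
Qed.

Lemma mean_value_line f x v (a : R) :
  (forall s : R, `|s| <= `|a| -> derivable f (x + s *: v) v) ->
  exists2 c, `|c| <= `|a| & f (x + a *: v) - f x = 'D_v f (x + c *: v) * a.
Proof.
move=> df; pose g (s : R) : R := f (x + s *: v).
have dg (s : R) : `|s| <= `|a| -> is_derive s (1 : R) g ('D_v f (x + s *: v)).
  by move=> sa; apply: is_derive_line; apply: df.
have g0 : g 0 = f x by rewrite /g scale0r addr0.
have [a0|a0] := leP 0 a.
  have I s : s \in `[0, a] -> `|s| <= `|a|.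
    by rewrite in_itv /= => /andP[s0 sa]; rewrite !ger0_norm.
  have [||c ca E] := @MVT_segment R g (fun s => 'D_v f (x + s *: v)) 0 a a0.
  - move=> s sa; apply: dg; apply: I; exact: subset_itv_oo_cc sa.
  - by apply: derivable_within_continuous => s /I /dg H; exact: ex_derive.
  by exists c; [exact: I|rewrite -g0 E subr0].
have I s : s \in `[a, 0] -> `|s| <= `|a|.
  by rewrite in_itv /= => /andP[s0 sa]; rewrite !ler0_norm ?lerN2 // ltW.
have [||c ca E] := @MVT_segment R g (fun s => 'D_v f (x + s *: v)) a 0 (ltW a0).
- move=> s sa; apply: dg; apply: I; exact: subset_itv_oo_cc sa.
- by apply: derivable_within_continuous => s /I /dg H; exact: ex_derive.
exists c; first exact: I.
by rewrite -g0 -/(g a) -opprB E sub0r mulrN opprK.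
Qed.

(** The increment is split along the coordinate axes; each step is a mean value, at a point where
    the partial derivatives are within [eps] of those at [x]. *)
Lemma C1_estimate U f x (eps : R) : open U -> U x -> Ck 1 U f -> 0 < eps ->
  exists2 r : R, 0 < r & forall h : 'rV[R]_n, (forall i, `|h 0 i| < r) ->
    `|f (x + h) - f x - \sum_j partial j f x * h 0 j| <= eps * \sum_j `|h 0 j|.
Proof.
move=> oU Ux [_ C1] eps0.
have near_x : \forall z \near x, U z /\
    forall j, `|partial j f x - partial j f z| <= eps.
  suff H : \forall z \near x, forall j, `|partial j f x - partial j f z| <= eps.
    by apply: filterS2 H (open_nbhs_nbhs (conj oU Ux)).
  apply: (filter_forall (nbhs_filter x)) => j.
  have [_ [/(_ x Ux) cj _]] := C1 j.
  by move/cvgrPdist_le : cj; apply.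
have [r r0 rP] := (nbhs_coordP x _).1 near_x.
exists r => // h hr.
(* [p j] has moved in the coordinates of index less than [j], so it runs from [x] to [x + h]. *)
pose p (j : nat) : 'rV[R]_n := x + \row_i (if (i < j)%N then h 0 i else 0).
have p0 : p 0%N = x.
  by apply/rowP => i; rewrite !mxE addr0.
have pn : p n = x + h.
  by apply/rowP => i; rewrite !mxE ltn_ord.
have pS (j : 'I_n) : p j.+1 = p j + h 0 j *: delta_mx 0 j.
  apply/rowP => i; rewrite !mxE eqxx /= -addrA; congr (_ + _).
  rewrite ltnS leq_eqVlt -[(_ == _ :> nat)]/(i == j).
  by case: (eqVneq i j) => [->|_]; rewrite /= ?ltnn ?mulr1 ?add0r ?mulr0 ?addr0.
have near_p (j : 'I_n) s : `|s| <= `|h 0 j| -> U (p j + s *: delta_mx 0 j) /\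
    forall i, `|partial i f x - partial i f (p j + s *: delta_mx 0 j)| <= eps.
  move=> sh; apply: rP => i; rewrite !mxE eqxx /=.
  rewrite opprD addrA opprD addrA subrr add0r -opprD normrN.
  case: ifPn => ij.
    by rewrite (_ : i == j = false) ?mulr0 ?addr0 // -val_eqE /= (ltn_eqF ij).
  rewrite add0r; case: eqP => _; rewrite ?mulr1 ?mulr0 ?normr0 //.
  exact: le_lt_trans sh (hr j).
have step (j : 'I_n) :
    `|f (p j.+1) - f (p j) - partial j f x * h 0 j| <= eps * `|h 0 j|.
  have [|c ch E] := @mean_value_line f (p j) (delta_mx 0 j) (h 0 j).
    by move=> s /near_p[Us _]; have [dj _] := C1 j; exact: dj.
  rewrite pS E -mulrBl normrM ler_wpM2r // distrC.
  by have [_ /(_ j)] := near_p j c ch.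
have -> : f (x + h) - f x = \sum_(j < n) (f (p j.+1) - f (p j)).
  by rewrite -(big_mkord xpredT (fun j => f (p j.+1) - f (p j))) telescope_sumr // pn p0.
rewrite -sumrB mulr_sumr; apply: le_trans (ler_norm_sum _ _ _) _.
by apply: ler_sum => j _; exact: step.
Qed.

(** Two mean values: in the direction [a] for the increment of [f] in the direction [b], then in the
    direction [b] for the partial derivative. *)
Lemma partial_second_difference U f x (a b : 'I_n) (eps : R) :
  open U -> U x -> Ck 2 U f -> 0 < eps ->
  exists2 r : R, 0 < r & forall t, `|t| < r ->
    `|f (x + t *: delta_mx 0 a + t *: delta_mx 0 b) - f (x + t *: delta_mx 0 a)
      - (f (x + t *: delta_mx 0 b) - f x) - t ^+ 2 * partial b (partial a f) x|
    <= eps * t ^+ 2.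
Proof.
move=> oU Ux [_ C2] eps0.
have [da [_ /(_ b)[dba [cba _]]]] := C2 a.
pose ea : 'rV[R]_n := delta_mx 0 a; pose eb : 'rV[R]_n := delta_mx 0 b.
have near_x : \forall z \near x, U z /\
    `|partial b (partial a f) x - partial b (partial a f) z| <= eps.
  suff H : \forall z \near x, `|partial b (partial a f) x - partial b (partial a f) z| <= eps.
    by apply: filterS2 H (open_nbhs_nbhs (conj oU Ux)).
  by have /cvgrPdist_le := cba x Ux; apply.
have [r r0 rP] := (nbhs_coordP x _).1 near_x.
(* If [a = b], both displacements fall on the same coordinate and add up. *)
exists (r / 2); first by rewrite divr_gt0.
move=> t tr.
have near_p s1 s2 : `|s1| <= `|t| -> `|s2| <= `|t| -> U (x + s1 *: ea + s2 *: eb) /\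
    `|partial b (partial a f) x - partial b (partial a f) (x + s1 *: ea + s2 *: eb)| <= eps.
  move=> s1t s2t; apply: rP => i; rewrite !mxE eqxx /=.
  have B (s : R) (c : bool) : `|s| <= `|t| -> `|s * c%:R| <= `|t|.
    by case: c; rewrite ?mulr1 ?mulr0 ?normr0.
  have H1 := B s1 (i == a) s1t; have H2 := B s2 (i == b) s2t.
  rewrite -addrA opprD addrA subrr add0r normrN.
  apply: le_lt_trans (ler_normD _ _) _; lra.
pose g y := f (y + t *: eb) - f y.
have dg s : `|s| <= `|t| -> is_derive (x + s *: ea) ea g
    (partial a f (x + s *: ea + t *: eb) - partial a f (x + s *: ea)).
  move=> st; apply: is_deriveB; last first.
    apply: DeriveDef => //; apply: da.
    by have := (near_p s 0 st); rewrite scale0r addr0 normr0 normr_ge0 => /(_ isT)[].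
  have Us : U (x + s *: ea + t *: eb) by case: (near_p s t st (lexx _)).
  have E : (fun h : R => h^-1 *: (((fun y => f (y + t *: eb)) \o shift (x + s *: ea)) (h *: ea) - f (x + s *: ea + t *: eb))) =
    (fun h : R => h^-1 *: ((f \o shift (x + s *: ea + t *: eb)) (h *: ea) - f (x + s *: ea + t *: eb))).
    by apply/funext => h /=; rewrite !addrA.
  by apply: DeriveDef; rewrite /derivable /derive E //; apply: da.
have [|c ct E1] := @mean_value_line g x ea t.
  by move=> s /dg H; exact: ex_derive.
have [|d dt E2] := @mean_value_line (partial a f) (x + c *: ea) eb t.
  by move=> s st; apply: dba; case: (near_p c s ct st).
have [_ B] := near_p c d ct dt.
have Hc := dg c ct.
have -> : f (x + t *: ea + t *: eb) - f (x + t *: ea) - (f (x + t *: eb) - f x) =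
    t ^+ 2 * partial b (partial a f) (x + c *: ea + d *: eb).
  rewrite -[LHS]/(g (x + t *: ea) - g x) E1 derive_val E2 /partial; ring.
rewrite -mulrBr normrM (ger0_norm (sqr_ge0 t)) [leRHS]mulrC distrC.
exact: ler_wpM2l (sqr_ge0 t) _ _ B.
Qed.

(** The second difference is symmetric in the two directions, hence approximates both mixed
    derivatives. *)
Lemma schwarz U f x (a b : 'I_n) : open U -> U x -> Ck 2 U f ->
  partial a (partial b f) x = partial b (partial a f) x.
Proof.
move=> oU Ux C2; apply/eqP; rewrite -subr_eq0 -normr_le0; apply/ler_addgt0Pl => e e0.
have e20 : 0 < e / 2 by rewrite divr_gt0.
have [r1 r10 H1] := partial_second_difference a b oU Ux C2 e20.
have [r2 r20 H2] := partial_second_difference b a oU Ux C2 e20.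
pose t := Num.min r1 r2 / 2.
have m0 : 0 < Num.min r1 r2 by rewrite lt_min r10.
have t0 : 0 < t by rewrite divr_gt0.
have tm : `|t| < Num.min r1 r2 by rewrite gtr0_norm // /t; lra.
have [t1 t2] : `|t| < r1 /\ `|t| < r2 by move: tm; rewrite lt_min => /andP.
have {}H1 := H1 t t1; have {}H2 := H2 t t2.
rewrite addr0.
have t20 : 0 < t ^+ 2 by rewrite exprn_gt0.
rewrite -(ler_pM2r t20) -{1}(gtr0_norm t20) -normrM.
rewrite (addrAC x) in H2; exact: dist_second_difference H1 H2.
Qed.

End Calculus.

Lemma cvg_sum_ord (R : numFieldType) (T : Type) (F : set_system T) (FF : Filter F) n
    (f : 'I_n -> T -> R) (l : 'I_n -> R) : (forall i, f i x @[x --> F] --> l i) ->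
  (\sum_i f i x) @[x --> F] --> \sum_i l i.
Proof.
move=> fl; rewrite -(fct_sumE _ _ f).
apply: (big_ind2 (fun (g : T -> R) (v : R) => g x @[x --> F] --> v)) => //.
  exact: cvg_cst.
by move=> g v g' v' gv gv'; apply: cvgD.
Qed.

Lemma is_derive_of_line (R : realType) n (f : 'rV[R]_n -> R) x v (d : R) :
  is_derive (0 : R) (1 : R) (fun t => f (t *: v + x)) d -> is_derive x v f d.
Proof.
have E : (fun h : R => h^-1 *: (((fun t => f (t *: v + x)) \o shift 0) (h *: 1) - f (0 *: v + x))) =
  (fun h : R => h^-1 *: ((f \o shift x) (h *: v) - f x)).
  by apply/funext => h /=; rewrite addr0 scale0r add0r [h *: 1]mulr1.
case=> dl dd; split; first by move: dl; rewrite /derivable E.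
by rewrite -dd /derive E.
Qed.

Section ChainRule.
Context {R : realType} {k n : nat}.

(** [F] is derivable only in the one direction [v]; the uniformity comes from [C1_estimate] for [f],
    applied to the increment of [F], which is of order h. *)
Lemma is_derive_comp (V : set 'rV[R]_n) (f : 'rV[R]_n -> R) (F : 'rV[R]_k -> 'rV[R]_n)
    (y v : 'rV[R]_k) : open V -> V (F y) -> Ck 1 V f ->
  (forall j, derivable (fun z => F z 0 j) y v) ->
  is_derive y v (f \o F)
    (\sum_j 'D_v (fun z => F z 0 j) y * partial j f (F y)).
Proof.
move=> oV Vy C1 dF.
pose dq (j : 'I_n) (h : R) := h^-1 * (F (h *: v + y) 0 j - F y 0 j).
pose dj j := 'D_v (fun z => F z 0 j) y.
have dqE j : dq j @ 0^' --> dj j by exact: dF.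
set S := \sum_j _.
suff H : h^-1 *: ((f \o F) (h *: v + y) - (f \o F) y) @[h --> 0^'] --> S.
  apply: DeriveDef; first by apply/cvg_ex; exists S.
  exact: cvg_lim H.
apply/cvgrPdist_le => e e0.
(* [M] bounds the sum of the difference quotients once each is within 1 of its limit; the extra 1
   keeps it positive. *)
pose M := 1 + \sum_j (`|dj j| + 1).
have M0 : 0 < M by rewrite ltr_wpDr // sumr_ge0 // => j _; rewrite addr_ge0.
have e10 : 0 < e / 2 / M by rewrite !divr_gt0.
have [r r0 est] := C1_estimate oV Vy C1 e10.
have cS : (\sum_j dq j h * partial j f (F y)) @[h --> 0^'] --> S.
  by apply: cvg_sum_ord => j; apply: cvgMr_tmp.
have n1 : \forall h \near 0^', `|S - \sum_j dq j h * partial j f (F y)| <= e / 2.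
  by move/cvgrPdist_le : cS; apply; rewrite divr_gt0.
have n2 : \forall h \near 0^', forall j, `|dj j - dq j h| <= 1.
  apply: filter_forall => j; by move/cvgrPdist_le : (dqE j); apply.
near=> h.
have h0 : h != 0 by near: h; exact: nbhs_dnbhs_neq.
have B1 : `|S - \sum_j dq j h * partial j f (F y)| <= e / 2 by near: h.
have B2 j : `|dq j h| <= `|dj j| + 1.
  have : forall j, `|dj j - dq j h| <= 1 by near: h.
  move=> /(_ j) H; rewrite -[dq j h](subKr (dj j)); apply: le_trans (ler_normB _ _) _.
  by rewrite lerD2l.
have hE j : F (h *: v + y) 0 j - F y 0 j = h * dq j h by rewrite /dq mulVKf.
have hr : `|h| * M < r.
  rewrite -ltr_pdivlMr //; near: h; apply: dnbhs0_lt; exact: divr_gt0.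
have {}est := est (F (h *: v + y) - F y).
have B3 : `|f (F (h *: v + y)) - f (F y) - \sum_j partial j f (F y) * (h * dq j h)|
    <= e / 2 / M * \sum_j `|h * dq j h|.
  have -> : \sum_j partial j f (F y) * (h * dq j h) =
      \sum_j partial j f (F y) * (F (h *: v + y) - F y) 0 j.
    by apply: eq_bigr => j _; rewrite !mxE hE.
  have -> : \sum_j `|h * dq j h| = \sum_j `|(F (h *: v + y) - F y) 0 j|.
    by apply: eq_bigr => j _; rewrite !mxE hE.
  rewrite -[in X in `|f X - _ - _|](subrKC (F y) (F (h *: v + y))).
  apply: est => j; rewrite !mxE hE normrM.
  apply: le_lt_trans hr; rewrite ler_wpM2l //; apply: le_trans (B2 j) _.
  rewrite /M (bigD1 j) //= addrCA; apply: ler_wpDr => //.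
  by apply: addr_ge0 => //; apply: sumr_ge0 => i _; apply: addr_ge0.
have B4 : \sum_j `|h * dq j h| <= `|h| * M.
  rewrite /M mulrDr mulr_sumr ler_wpDl ?mulr_ge0 //; apply: ler_sum => j _.
  by rewrite normrM ler_wpM2l.
have B5 : `|h^-1 *: (f (F (h *: v + y)) - f (F y)) - \sum_j dq j h * partial j f (F y)| <= e / 2.
  have -> : \sum_j dq j h * partial j f (F y) =
      h^-1 * \sum_j partial j f (F y) * (h * dq j h).
    rewrite mulr_sumr; apply: eq_bigr => j _.
    by rewrite mulrCA (mulrA h^-1) mulVf // mul1r mulrC.
  rewrite -mulrBr normrM normfV mulrC ler_pdivrMr ?normr_gt0 //.
  apply: le_trans B3 _; rewrite -mulrA ler_pM2l ?divr_gt0 //.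
  by rewrite mulrC ler_pdivrMr.
rewrite /= -(subrKA (\sum_j dq j h * partial j f (F y))).
apply: le_trans (ler_normD _ _) _; rewrite (splitr e) lerD // distrC.
exact: B5.
Unshelve. all: by end_near.
Qed.

End ChainRule.

(** * Closure properties of functions of class C^m *)

Section Ck.
Context {R : realType} {n : nat}.
Implicit Types (f g : 'rV[R]_n -> R) (U : set 'rV[R]_n).

Lemma near_eq_on U f g x : open U -> (forall x, U x -> f x = g x) -> U x ->
  \forall z \near x, f z = g z.
Proof.
by move=> oU fg Ux; apply: filterS (open_nbhs_nbhs (conj oU Ux)) => z /fg.
Qed.

Lemma eq_partial U f g x a : open U -> (forall x, U x -> f x = g x) -> U x ->
  partial a f x = partial a g x.
Proof. by move=> oU fg Ux; apply: near_eq_derive; apply: near_eq_on Ux. Qed.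

(** Rules such as those for products and inverses give partial derivatives by formulas valid on [U]
    only; openness makes this enough. *)
Lemma eq_Ck m U f g : open U -> (forall x, U x -> f x = g x) -> Ck m U f -> Ck m U g.
Proof.
move=> oU; have cE f' g' : (forall x, U x -> f' x = g' x) ->
    (forall x, U x -> {for x, continuous f'}) -> forall x, U x -> {for x, continuous g'}.
  move=> fg cf x Ux; have E := near_eq_on oU fg Ux.
  have : f' z @[z --> x] --> g' x by rewrite -fg //; exact: cf.
  by apply: cvg_trans; exact: (near_eq_cvg (FF := nbhs_filter x) E).
elim: m f g => [|m IH] f g fg [cf df]; (split; first exact: cE cf) => // a.
have [da Ca] := df a; split.
  by move=> x Ux; apply: near_eq_derivable (da x Ux); apply: near_eq_on Ux.
by apply: IH Ca => x Ux; apply: eq_partial Ux.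
Qed.

Lemma CkW m U f : Ck m.+1 U f -> Ck m U f.
Proof.
elim: m f => [|m IH] f; first by case.
by move=> [cf df]; split=> // a; have [da Ca] := df a; split=> //; apply: IH.
Qed.

Lemma Ck_cst m U (c : R) : open U -> Ck m U (cst c).
Proof.
move=> oU; elim: m c => [|m IH] c; (split; first by move=> x _; exact: cst_continuous) => //.
move=> a; split=> [x _|]; first exact: derivable_cst.
by apply: eq_Ck (IH 0) => // x _; rewrite /partial derive_cst.
Qed.

Lemma Ck_add m U f g : open U -> Ck m U f -> Ck m U g -> Ck m U (fun x => f x + g x).
Proof.
move=> oU; elim: m f g => [|m IH] f g [cf df] [cg dg].
  by split=> // x Ux; exact: (continuousD (cf x Ux) (cg x Ux)).
split=> [x Ux|a]; first exact: (continuousD (cf x Ux) (cg x Ux)).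
have [da Ca] := df a; have [db Cb] := dg a; split.
  by move=> x Ux; apply: derivableD; [exact: da|exact: db].
apply: eq_Ck (IH _ _ Ca Cb) => // x Ux.
by rewrite /partial deriveD //; [exact: da|exact: db].
Qed.

Lemma Ck_mul m U f g : open U -> Ck m U f -> Ck m U g -> Ck m U (fun x => f x * g x).
Proof.
move=> oU; elim: m f g => [|m IH] f g Cf Cg.
  move: Cf Cg => [cf _] [cg _].
  by split=> // x Ux; exact: (continuousM (cf x Ux) (cg x Ux)).
have Cf' := CkW Cf; have Cg' := CkW Cg; move: Cf Cg => [cf df] [cg dg].
split=> [x Ux|a]; first exact: (continuousM (cf x Ux) (cg x Ux)).
have [da Ca] := df a; have [db Cb] := dg a; split.
  by move=> x Ux; apply: derivableM; [exact: da|exact: db].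
apply: eq_Ck (Ck_add oU (IH _ _ Cf' Cb) (IH _ _ Cg' Ca)) => // x Ux.
by rewrite /partial deriveM //; [exact: da|exact: db].
Qed.

Lemma Ck_inv m U f : open U -> (forall x, U x -> f x != 0) -> Ck m U f ->
  Ck m U (fun x => (f x)^-1).
Proof.
move=> oU f0; elim: m => [|m IH] Cf.
  by move: Cf => [cf _]; split=> // x Ux; exact: (continuousV (f0 x Ux) (cf x Ux)).
have Cf' := CkW Cf; move: Cf => [cf df].
split=> [x Ux|a]; first exact: (continuousV (f0 x Ux) (cf x Ux)).
have [da Ca] := df a; split.
  by move=> x Ux; apply: derivableV; [exact: f0|exact: da].
have CI := IH Cf'.
apply: eq_Ck (Ck_mul oU (Ck_mul oU (Ck_cst m (-1) oU) (Ck_mul oU CI CI)) Ca) => // x Ux.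
rewrite /partial deriveV //; [|exact: f0|exact: da].
by rewrite mulN1r -exprVn expr2.
Qed.

Lemma is_derive_exp f (x v : 'rV[R]_n) : derivable f x v ->
  is_derive x v (fun z => expR (f z)) ('D_v f x * expR (f x)).
Proof.
move=> df; apply: is_derive_of_line.
pose l (t : R) := f (t *: v + x).
have dl : derivable l 0 1 by apply/(derivable1P f x _).1.
have lE : 'D_1 l 0 = 'D_v f x.
  rewrite /derive (_ : (fun h : R => h^-1 *: ((l \o shift 0) (h *: 1) - l 0)) =
    (fun h : R => h^-1 *: ((f \o shift x) (h *: v) - f x))) //.
  by apply/funext => h /=; rewrite addr0 [h *: 1]mulr1 /l scale0r add0r.
have dc : derivable (expR \o l) 0 1.
  apply/derivable1_diffP; apply: differentiable_comp; first exact/derivable1_diffP.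
  apply/derivable1_diffP; exact: (@derivable_expR R (l 0)).
apply: DeriveDef => //; rewrite -derive1E (derive1_comp dl (@derivable_expR R (l 0))).
by rewrite !derive1E lE derive_val mulrC /l scale0r add0r.
Qed.

Lemma Ck_exp m U f : open U -> Ck m U f -> Ck m U (fun x => expR (f x)).
Proof.
move=> oU; elim: m => [|m IH] Cf.
  by move: Cf => [cf _]; split=> // x Ux; apply: continuous_comp; [exact: cf|exact: continuous_expR].
have Cf' := CkW Cf; move: Cf => [cf df].
split=> [x Ux|a]; first by apply: continuous_comp; [exact: cf|exact: continuous_expR].
have [da Ca] := df a; split=> [x Ux|]; first by have H := is_derive_exp (da x Ux); exact: ex_derive.
apply: eq_Ck (Ck_mul oU Ca (IH Cf')) => // x Ux; have H := is_derive_exp (da x Ux).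
by rewrite /partial derive_val.
Qed.

End Ck.

Section Composition.
Context {R : realType} {k n : nat}.
Variables (U : set 'rV[R]_k) (V : set 'rV[R]_n) (F : 'rV[R]_k -> 'rV[R]_n).
Hypotheses (oU : open U) (oV : open V) (FUV : forall y, U y -> V (F y)).
Hypothesis sF : smooth_map_on U F.

Lemma smooth_map_continuous y : U y -> {for y, continuous F}.
Proof.
move=> Uy; have cF j : {for y, continuous (fun z => F z 0 j)}.
  by have [cF _] := sF j 0%N; exact: cF.
move=> P /nbhs_coordP[r r0 rP].
have H : \forall z \near y, forall j, `|F y 0 j - F z 0 j| < r.
  apply: (filter_forall (nbhs_filter y)) => j.
  by have /cvgrPdist_lt := cF j; apply.
by apply: filterS H => z H; apply: rP.
Qed.

Lemma derivable_smooth_map y j al : U y -> derivable (fun z => F z 0 j) y (delta_mx 0 al).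
Proof. by move=> Uy; have [_ /(_ al)[d _]] := sF j 1%N; exact: d. Qed.

Lemma is_partial_comp f y al : U y -> Ck 1 V f ->
  is_derive y (delta_mx 0 al) (f \o F)
    (\sum_j partial al (fun z => F z 0 j) y * partial j f (F y)).
Proof.
move=> Uy C1; apply: (is_derive_comp oV (FUV Uy) C1) => j.
exact: derivable_smooth_map.
Qed.

Lemma Ck_sum m p (f : 'I_p -> 'rV[R]_k -> R) : (forall i, Ck m U (f i)) ->
  Ck m U (fun y => \sum_i f i y).
Proof.
move=> Cf; rewrite -(fct_sumE _ _ f); apply: big_ind => //.
  by apply: eq_Ck (Ck_cst m 0 oU).
by move=> g h; apply: Ck_add.
Qed.

(** [f] is taken smooth rather than of class C^m, so that the induction may pass to its partial
    derivatives without counting orders. *)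
Lemma Ck_comp m f : (forall m, Ck m V f) -> Ck m U (f \o F).
Proof.
have cc (h : _ -> R) : (forall m, Ck m V h) -> forall y, U y -> {for y, continuous (h \o F)}.
  move=> Cf y Uy; apply: continuous_comp; first exact: smooth_map_continuous.
  by have [cf _] := Cf 0%N; apply: cf; apply: FUV.
elim: m f => [|m IH] f Cf; (split; first exact: cc) => // al; split.
  by move=> y Uy; have H := is_partial_comp al Uy (Cf 1%N); exact: ex_derive.
apply: (@eq_Ck _ _ _ _ (fun y => \sum_j partial al (fun z => F z 0 j) y * (partial j f \o F) y)) => //.
  by move=> y Uy; have H := is_partial_comp al Uy (Cf 1%N); rewrite /partial derive_val.
apply: Ck_sum => j; apply: Ck_mul => //.
  by have [_ /(_ al)[_]] := sF j m.+1.
by apply: IH => p; have [_ /(_ j)[_]] := Cf p.+1.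
Qed.

Lemma partial_comp f y al : U y -> smooth_on V f ->
  partial al (f \o F) y = \sum_j partial al (fun z => F z 0 j) y * partial j f (F y).
Proof.
by move=> Uy Cf; have H := is_partial_comp al Uy (Cf 1%N); rewrite /partial derive_val.
Qed.

End Composition.

(** * The ring of smooth functions on an open set *)

Section SmoothRing.
Context {R : realType} {n : nat}.

(* Requiring the value 0 outside [U] makes equality of elements the same as
   equality on [U]. *)
Record smf (U : set 'rV[R]_n) (oU : open U) := Smf {
  smf_fun :> 'rV[R]_n -> R;
  smf_smooth : smooth_on U smf_fun;
  smf_out : forall x, ~ U x -> smf_fun x = 0 }.

Variables (U : set 'rV[R]_n) (oU : open U).
Local Notation A := (smf oU).

Lemma smf_eq (f g : A) : (forall x, U x -> f x = g x) -> f = g.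
Proof.
case: f g => [f sf f0] [g sg g0] /= fg.
have E : f = g.
  apply/funext => x; have [Ux|Ux] := pselect (U x); first exact: fg.
  by rewrite f0 // g0.
by move: sf f0; rewrite E => sf f0; congr Smf; exact: Prop_irrelevance.
Qed.

Definition cutoff (f : 'rV[R]_n -> R) x := if `[< U x >] then f x else 0.

Lemma cutoffE f x : U x -> cutoff f x = f x.
Proof. by move=> Ux; rewrite /cutoff asboolT. Qed.

Lemma cutoff_out f x : ~ U x -> cutoff f x = 0.
Proof. by move=> Ux; rewrite /cutoff asboolF. Qed.

Lemma cutoff_smooth f : smooth_on U f -> smooth_on U (cutoff f).
Proof. by move=> sf m; apply: eq_Ck (sf m) => // x Ux; rewrite cutoffE. Qed.

(* Opaque, so that unification never unfolds derivatives into limits. *)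
Fact smf_of_subproof f : smooth_on U f -> {h : A | forall x, U x -> h x = f x}.
Proof.
move=> sf; exists (Smf oU (cutoff_smooth sf) (@cutoff_out f)) => x; exact: cutoffE.
Qed.
Definition smf_of f (sf : smooth_on U f) : A := sval (smf_of_subproof sf).

Lemma smf_ofE f (sf : smooth_on U f) x : U x -> smf_of sf x = f x.
Proof. exact: (svalP (smf_of_subproof sf)). Qed.

Lemma smooth_cst c : smooth_on U (cst c).
Proof. by move=> m; apply: Ck_cst. Qed.
Lemma smooth_add (f g : 'rV[R]_n -> R) :
  smooth_on U f -> smooth_on U g -> smooth_on U (fun x => f x + g x).
Proof. by move=> sf sg m; apply: Ck_add. Qed.
Lemma smooth_mul (f g : 'rV[R]_n -> R) :
  smooth_on U f -> smooth_on U g -> smooth_on U (fun x => f x * g x).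
Proof. by move=> sf sg m; apply: Ck_mul. Qed.
Lemma smooth_partial f a : smooth_on U f -> smooth_on U (partial a f).
Proof. by move=> sf m; have [_ /(_ a)[]] := sf m.+1. Qed.

Definition smf_cst c : A := smf_of (smooth_cst c).
Definition smf_add (f g : A) : A := smf_of (smooth_add (smf_smooth f) (smf_smooth g)).
Definition smf_mul (f g : A) : A := smf_of (smooth_mul (smf_smooth f) (smf_smooth g)).
Definition smf_opp (f : A) : A := smf_mul (smf_cst (-1)) f.
Fact smf_partial_subproof a (f : A) :
  {h : A | forall x, U x -> h x = partial a f x}.
Proof. by exists (smf_of (smooth_partial a (smf_smooth f))) => x; exact: smf_ofE. Qed.
Definition smf_partial a (f : A) : A := sval (smf_partial_subproof a f).

HB.instance Definition _ := gen_eqMixin A.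
HB.instance Definition _ := gen_choiceMixin A.

Fact smf_addA : associative smf_add.
Proof. by move=> f g h; apply: smf_eq => x Ux; rewrite !smf_ofE // addrA. Qed.
Fact smf_addC : commutative smf_add.
Proof. by move=> f g; apply: smf_eq => x Ux; rewrite !smf_ofE // addrC. Qed.
Fact smf_add0 : left_id (smf_cst 0) smf_add.
Proof. by move=> f; apply: smf_eq => x Ux; rewrite !smf_ofE // add0r. Qed.
Fact smf_addN : left_inverse (smf_cst 0) smf_opp smf_add.
Proof.
by move=> f; apply: smf_eq => x Ux; rewrite !smf_ofE // mulN1r addNr.
Qed.
HB.instance Definition _ :=
  GRing.isZmodule.Build A smf_addA smf_addC smf_add0 smf_addN.

Fact smf_mulA : associative smf_mul.
Proof. by move=> f g h; apply: smf_eq => x Ux; rewrite !smf_ofE // mulrA. Qed.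
Fact smf_mulC : commutative smf_mul.
Proof. by move=> f g; apply: smf_eq => x Ux; rewrite !smf_ofE // mulrC. Qed.
Fact smf_mul1 : left_id (smf_cst 1) smf_mul.
Proof. by move=> f; apply: smf_eq => x Ux; rewrite !smf_ofE // mul1r. Qed.
Fact smf_mulD : left_distributive smf_mul +%R.
Proof. by move=> f g h; apply: smf_eq => x Ux; rewrite !smf_ofE // mulrDl. Qed.
HB.instance Definition _ :=
  GRing.Zmodule_isComPzRing.Build A smf_mulA smf_mulC smf_mul1 smf_mulD.

Lemma smf_cstE c x : U x -> smf_cst c x = c. Proof. exact: smf_ofE. Qed.
Lemma smfD (f g : A) x : U x -> (f + g) x = f x + g x. Proof. exact: smf_ofE. Qed.
Lemma smfM (f g : A) x : U x -> (f * g) x = f x * g x. Proof. exact: smf_ofE. Qed.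
Lemma smf0 x : U x -> (0 : A) x = 0. Proof. exact: smf_ofE. Qed.
Lemma smf1 x : U x -> (1 : A) x = 1. Proof. exact: smf_ofE. Qed.
Lemma smfN (f : A) x : U x -> (- f) x = - f x.
Proof. by move=> Ux; rewrite !smf_ofE // mulN1r. Qed.
Lemma smfB (f g : A) x : U x -> (f - g) x = f x - g x.
Proof. by move=> Ux; rewrite smfD // smfN. Qed.
Lemma smf_sum (I : Type) (r : seq I) (f : I -> A) x : U x ->
  (\sum_(i <- r) f i) x = \sum_(i <- r) f i x.
Proof.
move=> Ux; elim: r => [|i r IH]; first by rewrite !big_nil smf0.
by rewrite !big_cons smfD // IH.
Qed.
Lemma smf_nat p x : U x -> (p%:R : A) x = p%:R.
Proof.
move=> Ux; elim: p => [|p IH]; first exact: smf0.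
by rewrite !mulrS smfD // IH smf1.
Qed.

Lemma derivable_smooth f x a : smooth_on U f -> U x -> derivable f x (delta_mx 0 a).
Proof. by move=> sf Ux; have [_ /(_ a)[d _]] := sf 1%N; exact: d. Qed.

Lemma smf_partialE a (f : A) x : U x -> smf_partial a f x = partial a f x.
Proof. exact: (svalP (smf_partial_subproof a f)). Qed.

Fact smf_partialD a : {morph smf_partial a : f g / f + g}.
Proof.
move=> f g; apply: smf_eq => x Ux; rewrite smfD // !smf_partialE //.
rewrite (eq_partial (g := f \+ g) a oU) //; last by move=> z Uz; rewrite smfD.
by rewrite /partial deriveD //; apply: derivable_smooth => //; apply: smf_smooth.
Qed.

Fact smf_partialM a f g : smf_partial a (f * g) = smf_partial a f * g + f * smf_partial a g.
Proof.
apply: smf_eq => x Ux; rewrite smfD // !smfM // !smf_partialE //.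
rewrite (eq_partial (g := f \* g) a oU) //; last by move=> z Uz; rewrite smfM.
rewrite /partial deriveM //; try by apply: derivable_smooth => //; apply: smf_smooth.
by rewrite addrC /GRing.scale /= mulrC (mulrC (f x)).
Qed.

Definition smf_der a : derivation A := Derivation (@smf_partialD a) (@smf_partialM a).

Lemma smf_derE a (f : A) x : U x -> smf_der a f x = partial a f x.
Proof. exact: smf_partialE. Qed.

Lemma smf_der_comm a b (f : A) : smf_der a (smf_der b f) = smf_der b (smf_der a f).
Proof.
apply: smf_eq => x Ux.
have E c d : smf_der c (smf_der d f) x = partial c (partial d f) x.
  transitivity (partial c (smf_der d f) x); first exact: smf_derE.
  by apply: (eq_partial c oU) => // z; exact: smf_derE.
transitivity (partial a (partial b f) x); first exact: E.
transitivity (partial b (partial a f) x); last exact/esym/E.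
exact: schwarz oU Ux (smf_smooth f 2%N).
Qed.

End SmoothRing.

(** * Restriction along the immersion as a ring morphism *)

Section Restriction.
Context {R : realType} {k n : nat}.
Variables (U : set 'rV[R]_k) (V : set 'rV[R]_n) (F : 'rV[R]_k -> 'rV[R]_n).
Variables (oU : open U) (oV : open V).
Hypothesis FUV : forall y, U y -> V (F y).
Hypothesis sF : smooth_map_on U F.

Lemma smooth_comp (f : smf oV) : smooth_on U (f \o F).
Proof. by move=> m; apply: (Ck_comp oU oV FUV sF); exact: smf_smooth. Qed.

Definition smf_res (f : smf oV) : smf oU := smf_of oU (smooth_comp f).

Lemma smf_resE f y : U y -> smf_res f y = f (F y).
Proof. exact: smf_ofE. Qed.

Fact smf_res_additive : {morph smf_res : f g / f - g}.
Proof.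
move=> f g; apply: smf_eq => y Uy; rewrite smfB // !smf_resE // smfB //.
exact: FUV.
Qed.
Fact smf_res_multiplicative : monoid_morphism smf_res.
Proof.
split=> [|f g]; apply: smf_eq => y Uy.
  by rewrite smf_resE // !smf1 //; exact: FUV.
by rewrite smfM // !smf_resE // smfM //; exact: FUV.
Qed.
HB.instance Definition _ := GRing.isZmodMorphism.Build _ _ smf_res smf_res_additive.
HB.instance Definition _ := GRing.isMonoidMorphism.Build _ _ smf_res smf_res_multiplicative.

Definition smf_coord j : smf oU := smf_of oU (sF j).

Lemma smf_res_chain al f :
  smf_der oU al (smf_res f) = \sum_j smf_der oU al (smf_coord j) * smf_res (smf_der oV j f).
Proof.
apply: smf_eq => y Uy; rewrite smf_derE // smf_sum //.
rewrite (eq_partial (g := f \o F) al oU) //; last by move=> z; exact: smf_resE.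
rewrite (partial_comp oV FUV sF al Uy (smf_smooth f)); apply: eq_bigr => j _.
rewrite smfM // smf_resE // !smf_derE //; last exact: FUV.
congr (_ * _); apply: (eq_partial al oU) => // z Uz.
by rewrite smf_ofE.
Qed.

End Restriction.

(** * Coordinate expressions in the ring of smooth functions *)

Section Evaluation.
Context {R : realType} {n : nat} {U : set 'rV[R]_n} {oU : open U}.
Local Notation A := (smf oU).

(** Evaluation carries the proof that the point lies in [U]: as a ring morphism it commutes with
    determinants and adjugates. *)
Definition smf_ev x (Ux : U x) (f : A) : R := f x.
Section Fixed.
Variables (x : 'rV[R]_n) (Ux : U x).
Fact smf_ev_additive : {morph smf_ev Ux : f g / f - g}.
Proof. by move=> f g; exact: smfB. Qed.
Fact smf_ev_multiplicative : monoid_morphism (smf_ev Ux).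
Proof. by split=> [|f g]; [exact: smf1|exact: smfM]. Qed.
HB.instance Definition _ := GRing.isZmodMorphism.Build _ _ (smf_ev Ux) smf_ev_additive.
HB.instance Definition _ :=
  GRing.isMonoidMorphism.Build _ _ (smf_ev Ux) smf_ev_multiplicative.
End Fixed.

Lemma smf_der_of (f : 'rV[R]_n -> R) (h : A) a x :
  (forall z, U z -> f z = h z) -> U x -> partial a f x = smf_der oU a h x.
Proof.
by move=> E Ux; rewrite smf_derE //; apply: (eq_partial a oU).
Qed.

Variables (m : nat) (h : 'I_m -> 'I_m -> A).
Let hM : 'M[A]_m := \matrix_(i, j) h i j.
Hypothesis h_unit : forall x, U x -> \matrix_(i, j) h i j x \in unitmx.

Let evM x (Ux : U x) : map_mx (smf_ev Ux) hM = \matrix_(i, j) h i j x.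
Proof. by apply/matrixP => i j; rewrite !mxE. Qed.

Let det_neq0 x : U x -> (\det hM : A) x != 0.
Proof.
move=> Ux; rewrite -[_ x]/(smf_ev Ux _) -det_map_mx evM.
by have := h_unit Ux; rewrite unitmxE unitfE.
Qed.

Let det_inv : A := smf_of oU (fun m => Ck_inv oU det_neq0 (smf_smooth (\det hM) m)).

(** Cramer's rule: the determinant vanishes nowhere on [U], hence is invertible in the ring. *)
Definition smf_invmx i j : A := det_inv * (\adj hM) i j.

Lemma smf_invmxE x i j : U x -> smf_invmx i j x = invmx (\matrix_(i, j) h i j x) i j.
Proof.
move=> Ux; rewrite /invmx h_unit // mxE smfM // smf_ofE //; congr (_^-1 * _).
  by rewrite -[LHS]/(smf_ev Ux _) -det_map_mx evM.
by rewrite -[LHS]/(smf_ev Ux _) -evM -map_mx_adj [RHS]mxE.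
Qed.

Lemma smf_invmx_l a c : \sum_b smf_invmx a b * h b c = (a == c)%:R.
Proof.
have D1 : det_inv * \det hM = 1.
  by apply: smf_eq => x Ux; rewrite smfM // smf_ofE // smf1 // mulVf // det_neq0.
transitivity (det_inv * (\adj hM *m hM) a c).
  by rewrite mxE mulr_sumr; apply: eq_bigr => b _; rewrite /smf_invmx mulrA !mxE.
by rewrite mul_adj_mx mxE mulrnAr D1.
Qed.

Lemma smf_invmx_sym : (forall a b, h a b = h b a) ->
  forall a b, smf_invmx a b = smf_invmx b a.
Proof.
move=> hs a b; congr (_ * _).
have E : hM^T = hM by apply/matrixP => i j; rewrite !mxE.
by rewrite -[in LHS]E -trmx_adj mxE.
Qed.

End Evaluation.

(** * Agreement of the coordinate curvature with its ring version *)

Section AmbientTransfer.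
Context {R : realType} {n : nat} {V : set 'rV[R]_n} {oV : open V}.
Local Notation A := (smf oV).
Local Notation D := (smf_der oV).
Variables (g : 'rV[R]_n -> 'M[R]_n) (gA giA : 'I_n -> 'I_n -> A).
Variables (GA : 'I_n -> 'I_n -> 'I_n -> A).
Hypothesis gE : forall a b x, V x -> g x a b = gA a b x.
Hypothesis giE : forall a b x, V x -> ginv g x a b = giA a b x.
Hypothesis GE : forall c a b x, V x -> christoffel g c a b x = GA c a b x.
Hypothesis GA_sym : forall c a b, GA c a b = GA c b a.

Let hf := smf_cst oV 2^-1.
Let c1 := smf_cst oV (2 * (n%:R - 1))^-1.
Let c2 := smf_cst oV (n%:R - 2)^-1.

Lemma nabla1E t (tA : 'I_n -> A) : (forall b x, V x -> t b x = tA b x) ->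
  forall a b x, V x -> nabla1 g t a b x = nab1 D GA tA a b x.
Proof.
move=> E a b x Vx; rewrite /nab1 /cov1 smfB // smf_sum // /nabla1; congr (_ - _).
  by apply: smf_der_of => // z Vz; exact: E.
by apply: eq_bigr => d _; rewrite smfM // E // GE.
Qed.

Lemma nabla2E t (tA : 'I_n -> 'I_n -> A) : (forall b c x, V x -> t b c x = tA b c x) ->
  forall a b c x, V x -> nabla2 g t a b c x = nab2 D GA tA a b c x.
Proof.
move=> E a b c x Vx; rewrite /nab2 /cov2 smfB // smf_sum // /nabla2; congr (_ - _).
  by apply: smf_der_of => // z Vz; exact: E.
by apply: eq_bigr => d _; rewrite smfD // !smfM // !E // !GE.
Qed.

Lemma nabla3E t (tA : 'I_n -> 'I_n -> 'I_n -> A) :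
  (forall b c d x, V x -> t b c d x = tA b c d x) ->
  forall a b c d x, V x -> nabla3 g t a b c d x = nab3 D GA tA a b c d x.
Proof.
move=> E a b c d x Vx; rewrite /nab3 /cov3 smfB // smf_sum // /nabla3; congr (_ - _).
  by apply: smf_der_of => // z Vz; exact: E.
by apply: eq_bigr => e _; rewrite !smfD // !smfM // !E // !GE.
Qed.

Lemma riemann_upE a b c d x : V x -> riemann_up g a b c d x = rup D GA a b c d x.
Proof.
move=> Vx; rewrite -(rup_dcoord (smf_der_comm (oU := oV)) GA_sym) smfB // /riemann_up.
have E1 e z : V z -> dcoord d e z = ((e == d)%:R : A) z.
  by move=> Vz; rewrite smf_nat.
by congr (_ - _); apply: nabla2E => // e f z Vz; exact: (nabla1E E1).
Qed.

Lemma riemannE a b c d x : V x -> riemann g a b c d x = rlow D GA gA a b c d x.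
Proof.
move=> Vx; rewrite /rlow smf_sum //; apply: eq_bigr => e _.
by rewrite smfM // riemann_upE // gE.
Qed.

Lemma ricciE a b x : V x -> ricci g a b x = ric D GA a b x.
Proof.
by move=> Vx; rewrite /ric smf_sum //; apply: eq_bigr => c _; rewrite riemann_upE.
Qed.

Lemma trE m (gi t : 'I_m -> 'I_m -> A) x : V x ->
  tr gi t x = \sum_a \sum_b gi a b x * t a b x.
Proof.
move=> Vx; rewrite /tr smf_sum //; apply: eq_bigr => a _; rewrite smf_sum //.
by apply: eq_bigr => b _; rewrite smfM.
Qed.

Lemma schouten_traceE x : V x -> schouten_trace g x = schtr D c1 giA GA x.
Proof.
move=> Vx; rewrite /schtr smfM // smf_cstE // trE //; congr (_ * _).
by apply: eq_bigr => a _; apply: eq_bigr => b _; rewrite giE // ricciE.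
Qed.

Lemma schoutenE a b x : V x -> schouten g a b x = sch D c1 c2 gA giA GA a b x.
Proof.
by move=> Vx; rewrite /sch smfM // smf_cstE // smfB // smfM // -ricciE // -gE // -schouten_traceE.
Qed.

Lemma weylE a b c d x : V x -> weyl g a b c d x = weylA D c1 c2 gA giA GA a b c d x.
Proof.
move=> Vx; rewrite /weyl riemannE // !schoutenE // !gE // /weylA.
move: (rlow D GA gA a b c d) (sch D c1 c2 gA giA GA) => r p.
by rewrite !(smfD, smfN) // !smfM.
Qed.

Lemma cottonE a b c x : V x -> cotton g a b c x = cott D c1 c2 gA giA GA a b c x.
Proof.
by move=> Vx; rewrite /cott smfB // /cotton; congr (_ - _); apply: nabla2E => // *; exact: schoutenE.
Qed.

Lemma bachE a b x : V x -> bach g a b x = bachA D c1 c2 gA giA GA a b x.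
Proof.
move=> Vx; rewrite /bachA smfD // !trE // /bach; congr (_ + _).
  apply: eq_bigr => c _; apply: eq_bigr => d _; rewrite giE //; congr (_ * _).
  by apply: nabla3E => // *; exact: cottonE.
(* The coordinate definition sums over [c], [d] outside and [e], [f] inside; [bachA] pairs [c] with
   [e] and [d] with [f]. *)
transitivity (\sum_c \sum_d \sum_e \sum_f
   giA c e x * (giA d f x * (weyl g a c b d x * schouten g e f x))).
  apply: eq_bigr => c _; apply: eq_bigr => d _; rewrite mulr_sumr; apply: eq_bigr => e _.
  by rewrite mulr_sumr; apply: eq_bigr => f _; rewrite !giE //; ring.
apply: eq_bigr => c _; rewrite exchange_big; apply: eq_bigr => e _ /=.
rewrite trE // mulr_sumr; apply: eq_bigr => d _; rewrite mulr_sumr; apply: eq_bigr => f _.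
by rewrite smfM // -weylE // -schoutenE.
Qed.

End AmbientTransfer.

Section EvalTransfer.
Context {R : realType} {k : nat} {U : set 'rV[R]_k} {oU : open U} {m : nat}.
Local Notation B := (smf oU).
Variables (y : 'rV[R]_k) (Uy : U y).

Lemma ev1E (t u : 'I_m -> B) : ev1 t u y = \sum_a u a y * t a y.
Proof. by rewrite /ev1 smf_sum //; apply: eq_bigr => a _; rewrite smfM. Qed.
Lemma ev2E (t : 'I_m -> 'I_m -> B) (u v : 'I_m -> B) :
  ev2 t u v y = \sum_a \sum_b t a b y * u a y * v b y.
Proof.
rewrite /ev2 ev1E; apply: eq_bigr => a _; rewrite ev1E mulr_sumr.
by apply: eq_bigr => b _; ring.
Qed.
Lemma ev3E (t : 'I_m -> 'I_m -> 'I_m -> B) (u v w : 'I_m -> B) :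
  ev3 t u v w y = \sum_a \sum_b \sum_c t a b c y * u a y * v b y * w c y.
Proof.
rewrite /ev3 ev1E; apply: eq_bigr => a _; rewrite ev2E mulr_sumr.
apply: eq_bigr => b _; rewrite mulr_sumr.
by apply: eq_bigr => c _; ring.
Qed.
Lemma ev4E (t : 'I_m -> 'I_m -> 'I_m -> 'I_m -> B) (u v w z : 'I_m -> B) :
  ev4 t u v w z y =
  \sum_a \sum_b \sum_c \sum_d t a b c d y * u a y * v b y * w c y * z d y.
Proof.
rewrite /ev4 ev1E; apply: eq_bigr => a _; rewrite ev3E mulr_sumr.
apply: eq_bigr => b _; rewrite mulr_sumr; apply: eq_bigr => c _; rewrite mulr_sumr.
by apply: eq_bigr => d _; ring.
Qed.

End EvalTransfer.

(** * Agreement of the coordinate expression of J with its ring version *)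

Section SubmanifoldTransfer.
Context {R : realType} {k n : nat}.
Variables (U : set 'rV[R]_k) (V : set 'rV[R]_n) (F : 'rV[R]_k -> 'rV[R]_n).
Variables (oU : open U) (oV : open V).
Hypothesis FUV : forall y, U y -> V (F y).
Hypothesis sF : smooth_map_on U F.
Local Notation A := (smf oV).
Local Notation B := (smf oU).
Local Notation DA := (smf_der oV).
Local Notation DB := (smf_der oU).
Local Notation res := (smf_res oU (oV := oV) FUV sF).

Definition smf_tangent al a : B := smf_der oU al (smf_coord oU sF a).
Local Notation T := smf_tangent.

Variables (g : 'rV[R]_n -> 'M[R]_n) (gA giA : 'I_n -> 'I_n -> A).
Variables (GA : 'I_n -> 'I_n -> 'I_n -> A) (gbi : 'I_k -> 'I_k -> B).
Hypothesis gE : forall a b x, V x -> g x a b = gA a b x.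
Hypothesis giE : forall a b x, V x -> ginv g x a b = giA a b x.
Hypothesis GE : forall c a b x, V x -> christoffel g c a b x = GA c a b x.
Hypothesis GA_sym : forall c a b, GA c a b = GA c b a.
Hypothesis giA_sym : forall a b, giA a b = giA b a.
Hypothesis gbiE : forall al be y, U y -> invmx (gbar g F y) al be = gbi al be y.

Let c1 := smf_cst oV (2 * (n%:R - 1))^-1.
Let c2 := smf_cst oV (n%:R - 2)^-1.
Definition smf_pull := pull DA res c1 c2 gA giA GA gbi.
Notation s := smf_pull.

Let hf : B := smf_cst oU 2^-1.
Let kinv : B := smf_cst oU k%:R^-1.
Let n4i : B := smf_cst oU (n%:R - 4)^-1.
Let n4 : B := n%:R - 4.

(** A vector at one point is related to ring elements, which are fields near the point and can be
    differentiated. *)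
Definition reps y (u : 'rV[R]_n) (uB : 'I_n -> B) := forall a, u 0 a = uB a y.

Lemma tvecE al y : U y -> reps y (tvec F al y) (T al).
Proof.
move=> Uy a; rewrite !mxE; apply: smf_der_of => // z Uz.
by rewrite smf_ofE.
Qed.

Section Point.
Variables (y : 'rV[R]_k) (Uy : U y).
Let Vy : V (F y) := FUV Uy.

Let resE (x : A) : res x y = x (F y). Proof. exact: smf_resE. Qed.

Lemma gYE u v (uB vB : 'I_n -> B) : reps y u uB -> reps y v vB ->
  gY g F y u v = ev2 (pg s) uB vB y.
Proof.
move=> Eu Ev; rewrite ev2E // /gY mxE exchange_big; apply: eq_bigr => b _ /=.
rewrite mxE mulr_suml; apply: eq_bigr => a _.
by rewrite mxE Eu Ev resE gE //; ring.
Qed.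

Lemma PYE u v (uB vB : 'I_n -> B) : reps y u uB -> reps y v vB ->
  PY g F y u v = ev2 (pP s) uB vB y.
Proof.
move=> Eu Ev; rewrite ev2E //; apply: eq_bigr => a _; apply: eq_bigr => b _.
by rewrite Eu Ev resE -(schoutenE gE giE GE GA_sym).
Qed.

Lemma BYE u v (uB vB : 'I_n -> B) : reps y u uB -> reps y v vB ->
  BY g F y u v = ev2 (pB s) uB vB y.
Proof.
move=> Eu Ev; rewrite ev2E //; apply: eq_bigr => a _; apply: eq_bigr => b _.
by rewrite Eu Ev resE -(bachE gE giE GE GA_sym).
Qed.

Lemma CYE u v w (uB vB wB : 'I_n -> B) : reps y u uB -> reps y v vB -> reps y w wB ->
  CY g F y u v w = ev3 (pC s) uB vB wB y.
Proof.
move=> Eu Ev Ew; rewrite ev3E //; apply: eq_bigr => a _; apply: eq_bigr => b _.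
by apply: eq_bigr => c _; rewrite Eu Ev Ew resE -(cottonE gE giE GE GA_sym).
Qed.

Lemma WYE u v w z (uB vB wB zB : 'I_n -> B) :
  reps y u uB -> reps y v vB -> reps y w wB -> reps y z zB ->
  WY g F y u v w z = ev4 (pW s) uB vB wB zB y.
Proof.
move=> Eu Ev Ew Ez; rewrite ev4E //; apply: eq_bigr => a _; apply: eq_bigr => b _.
apply: eq_bigr => c _; apply: eq_bigr => d _.
by rewrite Eu Ev Ew Ez resE -(weylE gE giE GE GA_sym).
Qed.

Lemma gbarE al be : gbar g F y al be = sgbar T s al be y.
Proof. by rewrite mxE; apply: gYE; exact: tvecE. Qed.

Lemma contrE t (tB : 'I_k -> 'I_k -> B) : (forall al be, t al be = tB al be y) ->
  contr g F y t = tr gbi tB y.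
Proof.
move=> E; rewrite trE //; apply: eq_bigr => al _; apply: eq_bigr => be _.
by rewrite E gbiE.
Qed.

Lemma tangentialE v (vB : 'I_n -> B) ga : reps y v vB ->
  tangential g F y v ga = stang T s vB ga y.
Proof.
move=> Ev; rewrite /stang smf_sum //; apply: eq_bigr => de _.
by rewrite smfM // gbiE //; congr (_ * _); apply: gYE => //; exact: tvecE.
Qed.

Lemma normalE v (vB : 'I_n -> B) : reps y v vB ->
  reps y (normal g F y v) (snormal T s vB).
Proof.
move=> Ev a; rewrite !mxE /snormal smfB // Ev; congr (_ - _).
rewrite smf_sum // summxE; apply: eq_bigr => ga _.
by rewrite !mxE smfM // -(tangentialE _ Ev) -tvecE // !mxE.
Qed.

End Point.

Lemma nablaYE al W (WB : 'I_n -> B) : (forall y, U y -> reps y (W y) WB) ->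
  forall y, U y -> reps y (nablaY g F al W y) (snab DB T s al WB).
Proof.
move=> E y Uy a; rewrite !mxE /snab /covv smfD //; congr (_ + _).
  by apply: smf_der_of => // z Uz; exact: E.
rewrite exchange_big smf_sum //; apply: eq_bigr => c _ /=.
rewrite smfM // /pconn smf_sum // mulr_suml; apply: eq_bigr => b _.
rewrite smfM // E //; congr (_ * _ * _); last exact: tvecE.
by rewrite smf_resE // GE //; exact: FUV.
Qed.

Lemma nablabar_coefE ga al be y : U y ->
  nablabar_coef g F ga al be y = sconn DB T s ga al be y.
Proof.
by move=> Uy; apply: tangentialE => //; apply: nablaYE => // z; exact: tvecE.
Qed.

Lemma sffE' al be y : U y -> reps y (sff g F al be y) (ssff DB T s al be).
Proof. by move=> Uy; apply: normalE => //; apply: nablaYE => // z; exact: tvecE. Qed.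

Lemma mean_curvE y : U y -> reps y (mean_curv g F y) (smean DB T kinv s).
Proof.
move=> Uy a; rewrite !mxE /smean smfM // smf_cstE // trE // summxE; congr (_ * _).
apply: eq_bigr => al _; rewrite summxE; apply: eq_bigr => be _.
by rewrite mxE gbiE // sffE'.
Qed.

Lemma sff0E al be y : U y -> reps y (sff0 g F al be y) (ssff0 DB T kinv s al be).
Proof.
move=> Uy a; rewrite /sff0 /ssff0 smfB // smfM // -sffE' // -mean_curvE // -gbarE //.
by move: (sff _ _ _ _ _) (gbar _ _ _ _ _) (mean_curv _ _ _) => u c v; rewrite !mxE.
Qed.

Lemma DmixedE al y : U y -> reps y (Dmixed g F al y) (sD DB T kinv s al).
Proof.
move=> Uy a; rewrite /sD smfB //.
have E (u v : 'rV[R]_n) : (u - v) 0 a = u 0 a - v 0 a by rewrite !mxE.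
rewrite [LHS]E; congr (_ - _); last first.
  by apply: normalE => //; apply: nablaYE => // z; exact: mean_curvE.
apply: normalE => // i; rewrite !mxE smf_sum //; apply: eq_bigr => b _.
rewrite mxE smfM // smf_sum // mulrC; congr (_ * _).
  by rewrite giE; [rewrite giA_sym [RHS]smf_resE|exact: FUV].
apply: eq_bigr => c _; rewrite smfM // smf_resE // -tvecE //; congr (_ * _).
by rewrite -(schoutenE gE giE GE GA_sym) //; exact: FUV.
Qed.

Lemma calPE al be y : U y -> calP g F al be y = scalP DB T hf kinv s al be y.
Proof.
move=> Uy; rewrite /scalP !smfD // !smfM // smf_cstE //.
rewrite -gbarE //; congr (_ + _ + _ * _ * _).
- by apply: PYE => //; exact: tvecE.
- by apply: gYE => //; [exact: mean_curvE|exact: sff0E].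
- by apply: gYE => //; exact: mean_curvE.
Qed.

Lemma calCE y u v w (uB vB wB : 'I_n -> B) : U y ->
  reps y u uB -> reps y v vB -> reps y w wB ->
  calC g F y u v w = scalC DB T kinv s uB vB wB y.
Proof.
move=> Uy Eu Ev Ew; rewrite /scalC smfB //; congr (_ - _); first exact: CYE.
by apply: WYE => //; exact: mean_curvE.
Qed.

Lemma calC_traceE al y : U y -> calC_trace g F al y = scalC_tr DB T kinv s al y.
Proof.
by move=> Uy; apply: contrE => // be ga; apply: calCE => //; exact: tvecE.
Qed.

Lemma calBE al be y : U y -> calB g F al be y = scalB DB T hf kinv n4 s al be y.
Proof.
move=> Uy; have n4E : n4 y = n%:R - 4 by rewrite /n4 smfB // !smf_nat.
have HE := mean_curvE Uy; have TE x := tvecE x Uy.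
rewrite /calB (BYE Uy (TE al) (TE be)) (CYE Uy HE (TE al) (TE be)).
rewrite (CYE Uy HE (TE be) (TE al)) (WYE Uy (TE al) HE (TE be) HE) /scalB.
rewrite smfD // smfD //; congr (_ + _ + _); last by rewrite smfM // n4E.
by rewrite smfM // [in RHS]smfM // n4E smf_nat // smfM // smf_cstE // smfD.
Qed.

Lemma W_trace1E al be y : U y -> W_trace1 g F al be y = sW1 T s al be y.
Proof. by move=> Uy; apply: contrE => // ga de; apply: WYE => //; exact: tvecE. Qed.

Lemma W_trace2E y : U y -> W_trace2 g F y = sW2 T s y.
Proof. by move=> Uy; apply: contrE => // al be; exact: W_trace1E. Qed.

Lemma calP_WE y : U y -> calP_W g F y = sPW DB T hf kinv s y.
Proof.
move=> Uy; apply: contrE => // al ga; apply: contrE => // be de.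
by rewrite smfM // calPE // W_trace1E.
Qed.

Lemma D_WE y : U y -> D_W g F y = sDW DB T kinv s y.
Proof.
move=> Uy; apply: contrE => // al ga; apply: contrE => // be de.
by apply: WYE => //; by [exact: tvecE|exact: DmixedE].
Qed.

Lemma sff0_CE y : U y -> sff0_C g F y = sLC DB T kinv s y.
Proof.
move=> Uy; apply: contrE => // al ga; apply: contrE => // be de.
by apply: calCE => //; by [exact: tvecE|exact: sff0E].
Qed.

Lemma divbarE t (tB : 'I_k -> B) : (forall al y, U y -> t al y = tB al y) ->
  forall y, U y -> divbar g F t y = sdiv DB T s tB y.
Proof.
move=> E y Uy; apply: contrE => // al be; rewrite /nab1 /cov1 smfB //.
congr (_ - _); first by apply: smf_der_of => // z; exact: E.
rewrite smf_sum //; apply: eq_bigr => ga _; rewrite smfM // E //.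
by rewrite nablabar_coefE.
Qed.

Lemma laplacebarE h (hB : B) : (forall y, U y -> h y = hB y) ->
  forall y, U y -> laplacebar g F h y = sdiv DB T s (fun al => DB al hB) y.
Proof. by move=> E; apply: divbarE => al y; apply: smf_der_of. Qed.

Theorem calJE y : U y -> calJ g F y = sJ DB T hf kinv n4 s n4i y.
Proof.
move=> Uy; rewrite /calJ (laplacebarE W_trace2E) // (divbarE calC_traceE) //.
rewrite W_trace2E // calP_WE // D_WE // sff0_CE //.
rewrite (contrE Uy (fun al be => calPE al be Uy)) (contrE Uy (fun al be => calBE al be Uy)).
rewrite /sJ /sbracket.
move: (sdiv _ _ _ _) (sW2 _ _) (tr _ _) (sdiv _ _ _ _) (sPW _ _ _ _ _) (sDW _ _ _ _)
  (sLC _ _ _ _) (tr _ _) => x1 x2 x3 x4 x5 x6 x7 x8.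
rewrite [RHS]smfB // [in RHS]smfD // smfN //; congr (_ + _ - _).
  by rewrite [RHS]smfM // [in RHS]smfM // smf_nat.
rewrite [RHS]smfM // [in RHS]smfM // [in RHS]smfB // !smf_nat //; congr (_ * _).
rewrite [RHS]smfD // !(smfD _ _ Uy) smfN //; congr (_ + _).
by rewrite [RHS]smfM // [in RHS]smfM // [in RHS]smfB // !smf_nat // smf_cstE.
Qed.

End SubmanifoldTransfer.

(** A nonzero vector in the kernel would have length 0. *)
Lemma posdef_unitmx (R : realType) m (M : 'M[R]_m) :
  (forall v : 'rV[R]_m, v != 0 -> 0 < (v *m M *m v^T) 0 0) -> M \in unitmx.
Proof.
move=> pos; rewrite -row_free_unit -kermx_eq0; apply/rowV0P => v /sub_kermxP vM.
by apply/eqP/negPn/negP => /pos; rewrite vM mul0mx mxE ltxx.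
Qed.

(** Symmetry makes [gi'] a right inverse as well, and then gi = gi (g gi') = gi'. *)
Lemma left_inverse_unique (A : comPzRingType) m (g gi gi' : 'I_m -> 'I_m -> A) :
  (forall a b, g a b = g b a) -> (forall a b, gi' a b = gi' b a) ->
  (forall a c, \sum_b gi a b * g b c = (a == c)%:R) ->
  (forall a c, \sum_b gi' a b * g b c = (a == c)%:R) ->
  forall a b, gi a b = gi' a b.
Proof.
move=> gs gs' E E' a b; transitivity (\sum_c \sum_d gi a d * g d c * gi' c b).
  rewrite exchange_big -[LHS](sum_delta_r b (gi a)); apply: eq_bigr => d _ /=.
  rewrite -E' mulr_suml; apply: eq_bigr => c _.
  by rewrite (gs d c) (gs' c b); ring.
rewrite -[RHS](sum_delta_l a (gi'^~ b)); apply: eq_bigr => c _.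
by rewrite -mulr_suml E eq_sym.
Qed.

Lemma smf_cst_inv (R : realType) m (U : set 'rV[R]_m) (oU : open U) (p : smf oU) c :
  c != 0 -> (forall x, U x -> p x = c) -> smf_cst oU c^-1 * p = 1.
Proof.
by move=> c0 E; apply: smf_eq => x Ux; rewrite smfM // smf_cstE // E // smf1 // mulVf.
Qed.

(** * The transformation law in one pair of coordinate domains *)

Section LocalModel.
Context {R : realType} {k n : nat}.
Variables (U : set 'rV[R]_k) (V : set 'rV[R]_n) (F : 'rV[R]_k -> 'rV[R]_n).
Variables (oU : open U) (oV : open V).
Hypothesis FUV : forall y, U y -> V (F y).
Hypothesis sF : smooth_map_on U F.
Hypothesis rkF : forall y, U y -> \rank (tangent_frame F y) = k.
Local Notation A := (smf oV).
Local Notation B := (smf oU).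
Local Notation DA := (smf_der oV).
Local Notation DB := (smf_der oU).
Local Notation res := (smf_res oU (oV := oV) FUV sF).
Local Notation T := (smf_tangent oU sF).
Local Notation hf := (smf_cst oV 2^-1).

(** Used for the given and for the rescaled metric separately; the existential form exposes only the
    equations by which the two models are compared. *)
Lemma local_model (g : 'rV[R]_n -> 'M[R]_n) :
  (forall a b, smooth_on V (fun x => g x a b)) ->
  (forall x, V x -> (g x)^T = g x) ->
  (forall x, V x -> forall v : 'rV[R]_n, v != 0 -> 0 < (v *m g x *m v^T) 0 0) ->
  exists (gA giA : 'I_n -> 'I_n -> A) (gbi : 'I_k -> 'I_k -> B),
  let s := smf_pull FUV sF gA giA (christ DA hf gA giA) gbi in
  [/\ forall a b x, V x -> g x a b = gA a b x,
      (forall a b, gA a b = gA b a) /\ (forall a b, giA a b = giA b a),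
      forall a c, \sum_b giA a b * gA b c = (a == c)%:R,
      (forall a b, gbi a b = gbi b a) /\
      (forall a c, \sum_b gbi a b * sgbar T s b c = (a == c)%:R) &
      forall y, U y -> calJ g F y = 
        sJ DB T (smf_cst oU 2^-1) (smf_cst oU k%:R^-1) (n%:R - 4) s (smf_cst oU (n%:R - 4)^-1) y].
Proof.
move=> sg gT gpos; pose gA a b : A := smf_of oV (sg a b).
have gE a b x : V x -> g x a b = gA a b x by move=> Vx; rewrite smf_ofE.
have gM x : V x -> \matrix_(i, j) gA i j x = g x.
  by move=> Vx; apply/matrixP => i j; rewrite mxE gE.
have gu x : V x -> \matrix_(i, j) gA i j x \in unitmx.
  by move=> Vx; rewrite gM //; apply: posdef_unitmx; exact: gpos.
have gA_sym a b : gA a b = gA b a.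
  by apply: smf_eq => x Vx; rewrite -!gE // -[in LHS](gT x Vx) mxE.
pose giA := smf_invmx gu.
have giA_sym : forall a b, giA a b = giA b a := smf_invmx_sym gu gA_sym.
have giA_l : forall a c, \sum_b giA a b * gA b c = (a == c)%:R := smf_invmx_l gu.
have giE a b x : V x -> ginv g x a b = giA a b x.
  by move=> Vx; rewrite smf_invmxE // gM.
pose GA := christ DA hf gA giA.
have GE c a b x : V x -> christoffel g c a b x = GA c a b x.
  move=> Vx; rewrite smfM // smf_cstE // smf_sum //; congr (_ * _).
  have pE i j l : partial l (fun z => g z i j) x = DA l (gA i j) x.
    by apply: smf_der_of => // z; exact: gE.
  apply: eq_bigr => d _; rewrite giE // !pE [RHS]smfM //; congr (_ * _).
  by rewrite smfB // smfD.
have hf2 : hf * 2 = 1.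
  by apply: smf_cst_inv => [|x Vx]; rewrite ?pnatr_eq0 // smf_nat.
have GA_sym : forall c a b, GA c a b = GA c b a.
  by have [+ _] := christ_levi_civita (smf_der oV) hf2 gA_sym giA_sym giA_l.
(* The induced metric is formed from [pg] and [T] alone; a zero placeholder for its inverse avoids a
   circular construction. *)
pose s0 := smf_pull FUV sF gA giA GA (fun _ _ => 0 : B).
have barE al be y : U y -> gbar g F y al be = sgbar T s0 al be y.
  by move=> Uy; exact: (gbarE FUV sF _ _ _ gE Uy).
have barM y : U y -> \matrix_(i, j) sgbar T s0 i j y = gbar g F y.
  by move=> Uy; apply/matrixP => i j; rewrite mxE barE.
have bu y : U y -> \matrix_(i, j) sgbar T s0 i j y \in unitmx.
  move=> Uy; rewrite barM //; apply: posdef_unitmx => v v0.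
  pose t := tangent_frame F y.
  have -> : gbar g F y = t *m g (F y) *m t^T.
    apply/matrixP => al be; rewrite !mxE /gY mxE; apply: eq_bigr => a _.
    by rewrite -row_mul !mxE.
  have -> : v *m (t *m g (F y) *m t^T) *m v^T = (v *m t) *m g (F y) *m (v *m t)^T.
    by rewrite trmx_mul !mulmxA.
  apply: gpos; first exact: FUV.
  (* The immersion condition: full rank keeps the image of a nonzero tangent vector nonzero. *)
  by rewrite mulmx_free_eq0 // /row_free rkF.
pose gbi := smf_invmx bu.
have gbi_sym : forall a b, gbi a b = gbi b a.
  apply: smf_invmx_sym => a b; rewrite /sgbar ev2_swap; apply: eq_ev2 => i j.
  by rewrite /= gA_sym.
exists gA, giA, gbi; split=> //; first by split=> //; exact: smf_invmx_l.
by apply: calJE => // al be y Uy; rewrite smf_invmxE // barM.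
Qed.

Hypotheses (k_ge1 : (1 <= k)%N) (n_ge3 : (3 <= n)%N) (n_neq4 : n <> 4%N).

(** The model of the rescaled metric is identified with the conformal formulas by uniqueness, of
    inverses for the metrics on X and on Y and of the Levi-Civita connection; [sJ_pull] then gives
    the square of [ei], the exponential of -2 Upsilon, hence the weight -4. *)
Theorem calJ_conf (g : 'rV[R]_n -> 'M[R]_n) (v : 'rV[R]_n -> R) :
  (forall a b, smooth_on V (fun x => g x a b)) ->
  (forall x, V x -> (g x)^T = g x) ->
  (forall x, V x -> forall w : 'rV[R]_n, w != 0 -> 0 < (w *m g x *m w^T) 0 0) ->
  smooth_on V v -> forall y, U y ->
  calJ (fun x => expR (2 * v x) *: g x) F y = expR (- 4 * v (F y)) * calJ g F y.
Proof.
move=> sg gT gpos sv.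
have sE c : smooth_on V (fun x => expR (c * v x)).
  by move=> m; apply: Ck_exp => //; apply: Ck_mul => //; exact: Ck_cst.
pose gh x := expR (2 * v x) *: g x.
have sgh a b : smooth_on V (fun x => gh x a b).
  move=> m; apply: (@eq_Ck _ _ _ _ (fun x => expR (2 * v x) * g x a b)) => //.
    by move=> x _; rewrite mxE.
  by apply: Ck_mul => //; [exact: sE|exact: sg].
have ghT x : V x -> (gh x)^T = gh x by move=> Vx; rewrite linearZ /= gT.
have ghpos x : V x -> forall w : 'rV[R]_n, w != 0 -> 0 < (w *m gh x *m w^T) 0 0.
  move=> Vx w w0; rewrite -scalemxAr -scalemxAl mxE mulr_gt0 ?expR_gt0 //; exact: gpos.
have [gA [giA [gbi [gE [gs gis] gil [gbis gbil] JE]]]] := local_model sg gT gpos.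
have [hA [hiA [hbi [hE [hs his] hil [hbis hbil] JhE]]]] := local_model sgh ghT ghpos.
pose e : A := smf_of oV (sE 2); pose ei : A := smf_of oV (sE (- 2)).
pose vA : A := smf_of oV sv; pose Y a : A := DA a vA.
have e_ei : e * ei = 1.
  by apply: smf_eq => x Vx; rewrite smfM // smf1 // !smf_ofE // -expRD -mulrDl subrr mul0r expR0.
have De a : DA a e = 2 * Y a * e.
  apply: smf_eq => x Vx; rewrite smfM // smfM // smf_nat // smf_derE //.
  have dv : derivable v x (delta_mx 0 a) by exact: derivable_smooth sv Vx.
  have d2 : is_derive x (delta_mx 0 a) (fun z => 2 * v z) (2 * partial a v x).
    by apply: DeriveDef; [exact: derivableZ|rewrite deriveZ].
  have dE := @is_derive_exp _ _ (fun z => 2 * v z) x (delta_mx 0 a) (@ex_derive _ _ _ _ _ _ _ d2).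
  rewrite (eq_partial (g := fun z => expR (2 * v z)) a oV) //; last by move=> z Vz; rewrite smf_ofE.
  rewrite /partial derive_val [e x]smf_ofE //; congr (_ * _).
  rewrite (@derive_val _ _ _ _ _ _ _ d2); congr (_ * _).
  by rewrite /Y smf_derE //; apply: (eq_partial a oV) => // z Vz; rewrite smf_ofE.
have DY a b : DA a (Y b) = DA b (Y a) by exact: smf_der_comm.
have hf2 : hf * 2 = 1.
  by apply: smf_cst_inv => [|x Vx]; rewrite ?pnatr_eq0 // smf_nat.
(* The dimension hypotheses make the four denominators invertible. *)
have n1 : 2 * (n%:R - 1) != 0 :> R.
  rewrite mulf_neq0 ?pnatr_eq0 // subr_eq0 -[1]/(1%:R) eqr_nat; lia.
have n2 : n%:R - 2 != 0 :> R by rewrite subr_eq0 eqr_nat; lia.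
have n4 : n%:R - 4 != 0 :> R by rewrite subr_eq0 eqr_nat; lia.
have k0 : k%:R != 0 :> R by rewrite pnatr_eq0; lia.
set c1 := smf_cst oV (2 * (n%:R - 1))^-1; set c2 := smf_cst oV (n%:R - 2)^-1.
have c1E : c1 * (2 * (n%:R - 1)) = 1.
  by apply: smf_cst_inv => // x Vx; rewrite smfM // smfB // smf1 // !smf_nat.
have c2E : c2 * (n%:R - 2) = 1.
  by apply: smf_cst_inv => // x Vx; rewrite smfB // !smf_nat.
set kinv := smf_cst oU k%:R^-1; set n4i := smf_cst oU (n%:R - 4)^-1.
have kinvE : kinv * k%:R = 1.
  by apply: smf_cst_inv => // x Ux; rewrite smf_nat.
have n4E : (n%:R - 4) * n4i = 1.
  by rewrite mulrC; apply: smf_cst_inv => // x Ux; rewrite smfB // !smf_nat.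
have LC := christ_levi_civita DA hf2 gs gis gil.
have hAE : hA = conf_metric gA e.
  apply/funext => a; apply/funext => b; apply: smf_eq => x Vx.
  by rewrite -hE // smfM // smf_ofE // -gE // mxE.
have hiAE : hiA = conf_ginv giA ei.
  apply/funext => a; apply/funext => b; apply: (left_inverse_unique hs _ hil).
    by move=> i j; rewrite /conf_ginv gis.
  move=> i j; rewrite hAE -gil; apply: eq_bigr => l _.
  by rewrite /conf_metric /conf_ginv mulrACA (mulrC ei) e_ei mul1r.
have GE : christ DA hf hA hiA = conf_conn gA giA (christ DA hf gA giA) Y.
  apply/funext => c; apply/funext => a; apply/funext => b.
  apply: (levi_civita_unique hf2 hs his hil).
    exact: christ_levi_civita.
  by rewrite hAE; apply: conf_levi_civita.
have hbiE : hbi = fun al be => res ei * gbi al be.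
  apply/funext => al; apply/funext => be.
  apply: (left_inverse_unique (gi' := fun al be => res ei * gbi al be) _ _ hbil).
  - by move=> i j; rewrite /sgbar ev2_swap; apply: eq_ev2 => a b; rewrite /= hs.
  - by move=> i j; rewrite gbis.
  - move=> i j; rewrite -gbil; apply: eq_bigr => l _.
    have -> : sgbar T (smf_pull FUV sF hA hiA (christ DA hf hA hiA) hbi) l j =
      res e * sgbar T (smf_pull FUV sF gA giA (christ DA hf gA giA) gbi) l j.
      rewrite /sgbar /ev2 /ev1 mulr_sumr; apply: eq_bigr => a _; rewrite mulrCA; congr (_ * _).
      rewrite mulr_sumr; apply: eq_bigr => b _; rewrite mulrCA; congr (_ * _).
      by rewrite /= hAE rmorphM.
    by rewrite mulrACA -rmorphM (mulrC ei) e_ei rmorph1 mul1r.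
have resh : smf_cst oU 2^-1 = res hf.
  by apply: smf_eq => z Uz; rewrite smf_resE // !smf_cstE //; exact: FUV.
have T_sym al be a : DB al (T be a) = DB be (T al a) by exact: smf_der_comm.
have E := sJ_pull (smf_der_comm (oU := oV)) T_sym (smf_res_chain oU FUV sF)
  hf2 c1E c2E gs gis gil LC e_ei De DY kinvE n4E gbis gbil.
move=> y Uy; rewrite -/gh JhE // JE //.
rewrite hbiE GE hAE hiAE resh /smf_pull [X in _ X y = _]E.
move: (sJ _ _ _ _ _ _ _) => j.
rewrite smfM // smfM // smf_resE // smf_ofE //; last exact: FUV.
by rewrite -expRD; congr (expR _ * _); ring.
Qed.

End LocalModel.

(** The chart image is open, so continuity of [chart_inv] within it is continuity at its points, and
    the preimage of the open chart domain under [i] composed with [chart_inv] is open there. *)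
Lemma open_coord_dom (R : realType) k n (Y : manifold (R := R) k) (X : manifold (R := R) n)
    (i : Y -> X) (c : chart Y k) (c' : chart X n) :
  continuous i -> atlas c -> atlas c' ->
  open (chart_map c @` (chart_dom c `&` i @^-1` chart_dom c')).
Proof.
move=> ci /atlas_chart[_ oc cK _ cinv] /atlas_chart[od' _ _ _ _].
rewrite openE => _ [p [cp dp] <-].
have cx : chart_img c (chart_map c p) by exists p.
have H : {for chart_map c p, continuous (chart_inv c)}.
  by move: cinv; rewrite (continuous_open_subspace _ oc); apply; rewrite inE.
rewrite /interior; have N : nbhs (chart_map c p) (chart_img c `&` (i \o chart_inv c) @^-1` chart_dom c').
  apply: filterI; first exact: open_nbhs_nbhs.
  apply: (continuous_comp H (ci _)); apply: open_nbhs_nbhs; split=> //.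
  by rewrite /= cK.
apply: filterS N => _ [[q cq <-] /=]; rewrite cK // => dq.
by exists q.
Qed.

Theorem proposition5p11 (R : realType) (k n : nat)
    (k_ge1 : (1 <= k)%N) (k_lt_n : (k < n)%N) (n_ge3 : (3 <= n)%N)
    (n_neq4 : n <> 4%N) :
  conformally_invariant (-4 : R) (@calJ R k n).
Proof.
move=> Y X g i u [sg gT gpos _] [ci si] su y c c' ac ac' cy c'iy.
have oU := open_coord_dom ci ac ac'; have [sF rkF] := si c c' ac ac'.
have [_ _ cK _ _] := atlas_chart ac; have [_ oV c'K _ _] := atlas_chart ac'.
have FUV z : (chart_map c @` (chart_dom c `&` i @^-1` chart_dom c')) z ->
    chart_img c' (coord_map i c c' z).
  by case=> p [cp dp] <-; exists (i p) => //; rewrite /coord_map /= cK.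
(* The function [v] of [calJ_conf] is [u] read in the chart [c']. *)
rewrite /scalar_at (calJ_conf oU oV FUV sF rkF) //.
- by rewrite /coord_map /= cK // c'K.
- exact: sg.
- exact: gT.
- exact: gpos.
- exact: su.
- by exists y.
Qed.
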